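(* Let $p\in(0,1)$ and let $\{\tilde S_n\}_{n\ge1}$ be the random walk with echoed steps with memory parameter $p$, spin law $X$ and echo law $\xi$, satisfying the standing hypotheses. If $pm_1>1$, then $$\lim_{n\to\infty}\frac{\tilde S_n}{n^{pm_1}}=\sum_{r\ge1}X_r\,\mathcal L_r^{(p,\xi)}\quad\text{almost surely,}$$ where $\{\mathcal L_r^{(p,\xi)}\}_{r\ge1}\subset L^1(\mathbb P)$ are the random variables defined in the context, they are independent of $\{X_r\}_{r\ge1}$, and the series is absolutely convergent almost surely and integrable. Furthermore, if $\mathbb E[\xi\log\xi]<m_1$ the series is non-degenerate, whereas otherwise $\sum_{r\ge1}X_r\mathcal L_r^{(p,\xi)}=0$ almost surely.
   Context: Standing hypotheses: $X$ and $\xi$ are real random variables with $\mathbb P(X=0)<1$, $\mathbb P(\xi=0)<1$, $\xi\ge0$ a.s., and $X,\xi\in L^\alpha(\mathbb P)$ for some $\alpha>1$. $m_\gamma=\mathbb E\,\xi^\gamma$; $0\log0=0$. Non-degenerate means not almost surely constant. Random walk with echoed steps (RWES): let $\{X_n\}_{n\ge1}$ be i.i.d. copies of $X$, $\{\varepsilon_n\}_{n\ge2}$ i.i.d. Bernoulli$(p)$, $\{\mathcal U[n]\}_{n\ge2}$ independent with $\mathcal U[n]$ uniform on $\{1,\dots,n-1\}$, $\{\xi_n\}_{n\ge2}$ i.i.d. copies of $\xi$, all these families being mutually independent. Set $\tilde X_1=X_1$, $\tilde X_n=(1-\varepsilon_n)X_n+\varepsilon_n\xi_n\tilde X_{\mathcal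 U[n]}$ for $n\ge2$, and $\tilde S_n=\tilde X_1+\cdots+\tilde X_n$. Percolated memory tree: let $\mathbb T$ be the infinite random recursive tree with root $1$ in which vertex $n\ge2$ is a child of $\mathcal U[n]$. The edge joining $n$ to its parent is deleted if $\varepsilon_n=0$ and kept if $\varepsilon_n=1$. If $r=1$ or $\varepsilon_r=0$, $T_r(n)$ is the set of vertices in $\{1,\dots,n\}$ that are descendants of $r$ (including $r$) connected to $r$ by kept edges; if $r\ge2$ and $\varepsilon_r=1$, $T_r(n)=\emptyset$. Weights: $\omega(1)=1$ and $\omega(n)=(1-\varepsilon_n)+\varepsilon_n\xi_n\,\omega(\mathcal U[n])$ for $n\ge2$; $\|T_r(n)\|=\sum_{i\in T_r(n)}\omega(i)$ (zero if empty). Then $\tilde S_n=\sum_{r=1}^nX_r\|T_r(n)\|$. Definition of $\mathcal L_r^{(p,\xi)}$: $\mathcal L_r^{(p,\xi)}=\lim_{n\to\infty}n^{-pm_1}\|T_r(n)\|$, a limit which exists almost surely and is integrable. *)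

(* Defs.v *)
From HB Require Import structures.
From mathcomp Require Import all_boot all_order all_algebra.
From mathcomp Require Import finmap.
From mathcomp Require Import all_classical all_reals all_analysis.

Set Implicit Arguments.
Unset Strict Implicit.
Unset Printing Implicit Defensive.

Import Order.TTheory GRing.Theory Num.Theory.
Import numFieldNormedType.Exports.

Local Open Scope classical_set_scope.
Local Open Scope ring_scope.

(* Indices are those of the mathematical text: spins are indexed by n >= 1 and
   eps, u, xi by n >= 2; values at smaller indices are never used. *)

Section pathwise.
Context {R : realType}.
Implicit Types (z xi : nat -> R) (eps : nat -> bool) (u : nat -> nat).

(* The recursion y_1 = z_1, y_n = (1 - eps_n) z_n + eps_n xi_n y_{u_n} (n >= 2),
   see echoed1 and echoedE.  The extra argument k is fuel: a uniform variable on
   {1, ..., n-1} satisfies 1 <= u_n < n only almost surely, so the recursion is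
   not structurally decreasing on a null set. *)
Fixpoint echoed_fuel z eps u xi (k n : nat) : R :=
  if k is k'.+1 then
    if (n <= 1)%N then z 1%N
    else (1 - (eps n)%:R) * z n
         + (eps n)%:R * xi n * echoed_fuel z eps u xi k' (u n)
  else 0.

Definition echoed z eps u xi (n : nat) : R := echoed_fuel z eps u xi n n.

Lemma echoed1 z eps u xi : echoed z eps u xi 1 = z 1%N.
Proof. by []. Qed.

Lemma echoed_fuelE z eps u xi : (forall n, (2 <= n)%N -> (1 <= u n < n)%N) ->
  forall k n, (1 <= n <= k)%N ->
  echoed_fuel z eps u xi k n = echoed z eps u xi n.
Proof.
move=> uP k n; elim/ltn_ind: n k => -[|n] IH [|k] // /andP[_ nk].
rewrite /echoed /=; case: ifP => // /negbT; rewrite -ltnNge => n1.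
have /andP[un0 unn] := uP _ n1.
rewrite IH//; last by rewrite un0 -ltnS (leq_trans unn nk).
by rewrite IH// un0.
Qed.

Lemma echoedE z eps u xi (n : nat) :
  (forall n, (2 <= n)%N -> (1 <= u n < n)%N) -> (2 <= n)%N ->
  echoed z eps u xi n = (1 - (eps n)%:R) * z n
    + (eps n)%:R * xi n * echoed z eps u xi (u n).
Proof.
move=> uP n2; rewrite {1}/echoed; case: n n2 => // n n2.
rewrite /= leqNgt n2 /= echoed_fuelE//.
by have := uP _ n2; rewrite ltnS.
Qed.

Definition echoed_sum z eps u xi (n : nat) : R :=
  \sum_(1 <= i < n.+1) echoed z eps u xi i.

Definition weight eps u xi : nat -> R := echoed (fun=> 1) eps u xi.

(* i is a descendant of r (possibly r itself) in the tree in which n >= 2 is a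
   child of u_n, and all edges on the path from r to i are kept *)
Inductive kept_descendant eps u (r : nat) : nat -> Prop :=
| kept_root : kept_descendant eps u r r
| kept_child i : (2 <= i)%N -> eps i -> kept_descendant eps u r (u i) ->
    kept_descendant eps u r i.

Definition perc_tree eps u (r n : nat) : set nat :=
  [set i | [/\ (1 <= i <= n)%N, r = 1%N \/ eps r = false
             & kept_descendant eps u r i]].

Definition tree_weight eps u xi (r n : nat) : R :=
  \sum_(1 <= i < n.+1 | `[< perc_tree eps u r n i >]) weight eps u xi i.

Definition scaled_tree_weight (a : R) eps u xi (r n : nat) : R :=
  n%:R `^ (- a) * tree_weight eps u xi r n.

Definition tree_limit (a : R) eps u xi (r : nat) : R :=
  limn (scaled_tree_weight a eps u xi r).

End pathwise.

Section probabilistic.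
Context {d : measure_display} {T : measurableType d} {R : realType}.
Variable P : probability T R.

Definition sigma_of {d'} {T' : measurableType d'} (Y : T -> T') :
  set (set T) := preimage_set_system setT Y measurable.

Definition sigma_of_family (D : set nat) (Y : nat -> T -> R) : set (set T) :=
  <<s \bigcup_(r in D) sigma_of (Y r) >>.

Definition independent2 (G H : set (set T)) : Prop :=
  forall A B, G A -> H B -> P (A `&` B) = (P A * P B)%E.

Definition mutually_independent (I : choiceType) (D : set I)
    (G : I -> set (set T)) : Prop :=
  forall (J : {fset I}) (A : I -> set T),
    (forall i, i \in J -> D i /\ G i (A i)) ->
    P (\bigcap_(i in [set` J]) A i) = (\prod_(i <- J) P (A i))%E.

Definition same_law {d'} {T' : measurableType d'} (Y Z : {mfun T >-> T'}) :
  Prop := forall A, measurable A -> distribution P Y A = distribution P Z A.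

Definition non_degenerate (Y : T -> R) : Prop :=
  ~ exists c : R, {ae P, forall w, Y w = c}.

Definition m1 (xi : T -> R) : R := fine 'E_P[xi].

(* The library's ln vanishes at 0, hence 0 log 0 = 0. *)
Definition mean_xlogx (xi : T -> R) : \bar R :=
  'E_P[fun w => xi w * ln (xi w)].

Record standing (X xi : {RV P >-> R}) : Prop := {
  spin_neq0 : (P [set w | X w = 0%R] < 1)%E ;
  echo_neq0 : (P [set w | xi w = 0%R] < 1)%E ;
  echo_ge0 : {ae P, forall w, 0 <= xi w} ;
  spin_echo_Lfun : exists alpha : R,
    [/\ 1 < alpha, (X : T -> R) \in Lfun P alpha%:E
      & (xi : T -> R) \in Lfun P alpha%:E] }.

Section driving_variables.
Variables (Xs : nat -> {RV P >-> R}) (eps : nat -> {RV P >-> bool})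
  (U : nat -> {RV P >-> nat}) (xis : nat -> {RV P >-> R}).

(* The four summands index, in order, X_n, eps_n, U[n] and xi_n. *)
Definition driving_index : choiceType := ((nat + nat) + (nat + nat))%type.

Definition driving_dom : set driving_index := fun i =>
  match i with
  | inl (inl n) => (1 <= n)%N
  | inl (inr n) | inr (inl n) | inr (inr n) => (2 <= n)%N
  end.

Definition driving_sigma (i : driving_index) : set (set T) :=
  match i with
  | inl (inl n) => sigma_of (Xs n)
  | inl (inr n) => sigma_of (eps n)
  | inr (inl n) => sigma_of (U n)
  | inr (inr n) => sigma_of (xis n)
  end.

Record rwes_driven (p : R) (X xi : {RV P >-> R}) : Prop := {
  spin_law : forall n, (1 <= n)%N -> same_law (Xs n) X ;
  memory_law : forall n, (2 <= n)%N -> forall A, measurable A ->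
    distribution P (eps n) A = bernoulli_prob p A ;
  parent_law : forall n, (2 <= n)%N -> forall k, (1 <= k < n)%N ->
    P [set w | U n w = k] = (n.-1%:R^-1)%:E ;
  echo_law : forall n, (2 <= n)%N -> same_law (xis n) xi ;
  driving_indep : mutually_independent driving_dom driving_sigma }.

Definition rwes (n : nat) (w : T) : R :=
  echoed_sum (Xs ^~ w) (eps ^~ w) (U ^~ w) (xis ^~ w) n.

Definition scaled_T (a : R) (r n : nat) (w : T) : R :=
  scaled_tree_weight a (eps ^~ w) (U ^~ w) (xis ^~ w) r n.

Definition L_ (a : R) (r : nat) (w : T) : R :=
  tree_limit a (eps ^~ w) (U ^~ w) (xis ^~ w) r.

Definition limit_series (a : R) (w : T) : R :=
  limn (fun n => \sum_(1 <= r < n.+1) Xs r w * L_ a r w).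

End driving_variables.
End probabilistic.

(* Main.v *)
(** Write [a = p m1] and take nonnegative spins first.  The walk obeys
    [E(S_(n+1) | F_n) = (1 + a / n) S_n + (1 - p) E X] and
    [1 + a / n <= (1 + 1 / n)^a], so [S_n / n^a] is a supermartingale up to a
    summable error and converges; the expected contribution of the spins of index
    greater than [N] is at most of the order of the tail of [sum_r r^(-a)], which is
    finite because [a > 1], hence the limit is the series [sum_r X_r L_r].

    If [E(xi log xi) >= m1], the potential [k(x) = max(0, x (B - log x - x^delta))]
    summed over the normalised steps of a tree, on the event that the normalised
    tree weight stays below a constant, is bounded and loses at step [n] at least
    a multiple of [1/n] times the sum of the [(1 + delta)]-th powers of the steps.
    As [sum_n 1/n] diverges, that sum is small infinitely often, and so is the
    normalised weight: [L_r = 0].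

    If [E(xi log xi) < m1], then [E xi^(1 + t) < (1 + t) m1] for some small [t > 0],
    which bounds [S_n / n^a] in [L^(1 + t)], hence gives convergence in [L^1].  For [H]
    known at time [k], the covariance [D_n] of [H] and [S_n] satisfies
    [D_(n+1) = (1 + a / n) D_n], so a constant limit forces [D_k = 0].  Time [1] shows
    that [X] is a constant [x], and then time [2] with [H = 1 - eps_2] gives
    [x (a - p) = 0]. *)
Require Import Defs.
From HB Require Import structures.
From mathcomp Require Import all_boot all_order all_algebra.
From mathcomp Require Import finmap.
From mathcomp Require Import all_classical all_reals all_analysis.
From mathcomp Require Import measurable_realfun ring lra.

Set Implicit Arguments.
Unset Strict Implicit.
Unset Printing Implicit Defensive.

Import Order.TTheory GRing.Theory Num.Theory.
Import numFieldNormedType.Exports.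

Local Open Scope classical_set_scope.
Local Open Scope ring_scope.

(** * Independence and freezing *)

(** Conditional expectations never appear: a statement about the next step given the past is tested
    against weights [H] known at that time, and the past is frozen by Tonelli on a product law
    ([integral_freezing]). Nonnegative variables keep these integrals meaningful before any
    integrability is known; signs come back by subtracting the walks of the positive and negative
    parts of the spins. The bounds on [U] and the sign of [xis] hold only almost surely, so the work
    is done with corrected versions [parent] and [echo], for which the recursion holds at every
    point. A tree weight is the walk whose only nonzero spin is a deterministic 1 at [r], so the
    existence of [L_r] is an instance of the convergence theorem for walks. In the critical case a
    convergent path is bounded, so barriers at integer heights exhaust almost all paths. Only a
    moment of order [alpha > 1] is available, and logarithms are paid for by small powers:
    [1 + 2 * delta = alpha] in the critical case, [1 + 3 * c = alpha] for choosing [t] in the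
    subcritical one. *)

Section independence.
Context {d : measure_display} {T : measurableType d} {R : realType}.
Variable P : probability T R.

(** The measures [mrestr P mB] and [P B] times [P] agree on the pi-system [C], which contains the
    whole space, hence on the sigma-algebra it generates. *)
Lemma independent_generated (C : set (set T)) (B : set T) :
  setI_closed C -> C setT -> C `<=` measurable -> measurable B ->
  (forall A, C A -> P (A `&` B) = (P A * P B)%E) ->
  forall A, <<s C >> A -> P (A `&` B) = (P A * P B)%E.
Proof.
move=> CI CT mC mB CB A sA.
have b0 : 0 <= fine (P B) by exact: fine_ge0.
have /= := @g_sigma_algebra_measure_unique _ _ _ C mC (fun=> setT) (fun=> CT) _
  (mrestr P mB) (mscale (NngNum b0) P) CI _ _ A sA.
rewrite /mrestr /mscale/= fineK ?fin_num_measure// => ->; first by rewrite muleC.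
- by rewrite bigcup_const//; exists 0%N.
- by move=> E CE; rewrite CB// muleC.
- by move=> _; rewrite -ge0_fin_numE// fin_num_measure//; exact: measurableI.
Qed.

Context {I : choiceType}.
Variables (Dom : set I) (G : I -> set (set T)).
Hypothesis mG : forall i, G i `<=` measurable.
Hypothesis GI : forall i, setI_closed (G i).
Hypothesis GT : forall i, G i setT.
Hypothesis indG : mutually_independent P Dom G.

Definition generated (D : set I) : set (set T) := \bigcup_(i in D) G i.

(** The union [generated D] is not stable under intersection; these finite intersections form a
    pi-system with the same generated sigma-algebra. The family [F] is total, with [G i (F i)]
    everywhere, so that two families can be merged pointwise. *)
Let cylinder (D : set I) : set (set T) :=
  [set A | exists (J : {fset I}) (F : I -> set T),
     [/\ forall i, i \in J -> D i, forall i, G i (F i) &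
       A = \bigcap_(i in [set` J]) F i]].

Let cylinderI D : setI_closed (cylinder D).
Proof.
move=> _ _ [J [F [JD GF ->]]] [K [H [KD GH ->]]].
pose F' i := if i \in J then F i else setT.
pose H' i := if i \in K then H i else setT.
exists (J `|` K)%fset, (fun i => F' i `&` H' i); split.
- by move=> i; rewrite in_fsetU => /orP[/JD|/KD].
- by move=> i; apply: GI; rewrite /F' /H'; case: ifP.
- apply/seteqP; split => w.
    move=> [h1 h2] i _; rewrite /F' /H'; split.
    + by case: ifPn => // iJ; exact: h1.
    + by case: ifPn => // iK; exact: h2.
  move=> h; split => i/= iJ.
  + by have [] := h i; rewrite /= ?in_fsetU ?iJ// /F' iJ.
  + by have [] := h i; rewrite /= ?in_fsetU ?iJ ?orbT// /H' iJ.
Qed.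

Let cylinderT D : cylinder D setT.
Proof.
exists fset0, (fun=> setT); split => //.
by apply/seteqP; split => // w _ i.
Qed.

Let cylinder_measurable D : cylinder D `<=` measurable.
Proof.
move=> _ [J [F [JD GF ->]]].
rewrite bigcap_fset; apply: bigsetI_measurable => i _; exact: (@mG i).
Qed.

Let sub_cylinder D : <<s generated D >> `<=` <<s cylinder D >>.
Proof.
apply: smallest_sub; first exact: smallest_sigma_algebra.
move=> A [i Di GiA]; apply: sub_sigma_algebra.
exists [fset i]%fset, (fun j => if j == i then A else setT); split.
- by move=> j; rewrite inE => /eqP ->.
- by move=> j; case: eqP => [->|].
- apply/seteqP; split => w.
    by move=> Aw j /=; rewrite inE => /eqP ->; rewrite eqxx.
  by move/(_ i); rewrite /= inE eqxx; exact.
Qed.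

(** Since [J] and [K] are disjoint, the two families glue to a single [E] on their union; mutual
    independence is then used on the union and on each part. *)
Let cylinder_indep D D' A B : D `<=` Dom -> D' `<=` Dom -> [disjoint D & D'] ->
  cylinder D A -> cylinder D' B -> P (A `&` B) = (P A * P B)%E.
Proof.
move=> DD DD' /disj_setPS dis [J [F [JD GF ->]]] [K [H [KD GH ->]]].
have JK : [disjoint J & K]%fset.
  apply/fdisjointP => i iJ; apply/negP => iK.
  by have := dis i; apply; split; [exact: JD|exact: KD].
pose E i := if i \in J then F i else H i.
have EJ i : i \in J -> E i = F i by rewrite /E => ->.
have EK i : i \in K -> E i = H i.
  by rewrite /E; case: ifP => // iJ iK; move/fdisjointP : JK => /(_ _ iJ); rewrite iK.
rewrite [X in P X](_ : _ = \bigcap_(i in [set` (J `|` K)%fset]) E i); last first.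
  apply/seteqP; split => w.
    move=> [h1 h2] i /=; rewrite in_fsetU => /orP[iJ|iK].
      by rewrite EJ//; exact: h1.
    by rewrite EK//; exact: h2.
  move=> h; split => i /= ij.
    by rewrite -EJ//; apply: h; rewrite /= in_fsetU ij.
  by rewrite -EK//; apply: h; rewrite /= in_fsetU ij orbT.
rewrite indG; last first.
  move=> i; rewrite in_fsetU => /orP[iJ|iK]; split.
  - exact/DD/JD.
  - by rewrite EJ.
  - exact/DD'/KD.
  - by rewrite EK.
rewrite (perm_big (J ++ K)) /=; last first.
  apply: uniq_perm; rewrite ?fset_uniq//.
    rewrite cat_uniq !fset_uniq /= andbT; apply/hasPn => i /= iK.
    apply/negP => iJ.
    by move/fdisjointP : JK => /(_ _ iJ); rewrite iK.
  by move=> i; rewrite mem_cat in_fsetU.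
rewrite big_cat/= indG; last by move=> i iJ; split; [exact/DD/JD|exact: GF].
rewrite indG; last by move=> i iJ; split; [exact/DD'/KD|exact: GH].
congr (_ * _)%E.
- by apply: eq_big_seq => i iJ; rewrite EJ.
- by apply: eq_big_seq => i iJ; rewrite EK.
Qed.

Lemma generated_measurable D : <<s generated D >> `<=` measurable.
Proof.
apply: smallest_sub; first exact: sigma_algebra_measurable.
by move=> A [i _]; exact: mG.
Qed.

(** The pi-system argument is applied twice, once in each event. *)
Lemma independent_generated2 D D' : D `<=` Dom -> D' `<=` Dom ->
  [disjoint D & D'] ->
  independent2 P <<s generated D >> <<s generated D' >>.
Proof.
move=> DD DD' dis A B /sub_cylinder sA /sub_cylinder sB.
have scylm E : <<s cylinder E >> `<=` measurable.
  apply: smallest_sub; first exact: sigma_algebra_measurable.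
  exact: cylinder_measurable.
have mA := scylm _ _ sA; have mB := scylm _ _ sB.
apply: (@independent_generated (cylinder D)) => // A' cA'.
rewrite setIC muleC.
apply: (@independent_generated (cylinder D')) => //.
  exact: (@cylinder_measurable D).
by move=> B' cB'; rewrite setIC muleC; apply: cylinder_indep cA' cB'.
Qed.

End independence.

Section freezing.
Context {d : measure_display} {T : measurableType d} {R : realType}.
Variable P : probability T R.
Context {d' : measure_display} {S : measurableType d'}.
Variables (G : set (set T)) (Y : T -> S).
Hypothesis mG : <<s G >> `<=` measurable.
Hypothesis mY : measurable_fun setT Y.
Hypothesis GY : independent2 P <<s G >> (sigma_of Y).

Local Notation TG := (g_sigma_algebraType G).

(** The identity as a random variable with values in [T] carrying the smaller sigma-algebra: its law
    encodes everything known to [G], and [GY] says that its joint law with [Y] is a product. *)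
Let idG (w : T) : TG := w.

Let midG : measurable_fun setT idG.
Proof. by move=> _ B mB; rewrite setTI; exact: mG. Qed.

Let pairG (w : T) : TG * S := (idG w, Y w).

Let mpairG : measurable_fun setT pairG.
Proof. by apply/measurable_fun_pairP; split. Qed.

HB.instance Definition _ := isMeasurableFun.Build _ _ _ _ idG midG.
HB.instance Definition _ := isMeasurableFun.Build _ _ _ _ Y mY.
HB.instance Definition _ := isMeasurableFun.Build _ _ _ _ pairG mpairG.

(** The joint law of [idG] and [Y] is the product of their laws because it is so on rectangles;
    Tonelli then integrates over [Y] with the part known to [G] held fixed. This is the averaged
    form of the freezing rule for conditional expectations. *)
Lemma integral_freezing (phi : TG * S -> \bar R) :
  measurable_fun setT phi -> (forall x, 0 <= phi x)%E ->
  (\int[P]_w phi (w, Y w) = \int[P]_w \int[P]_w' phi (w, Y w'))%E.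
Proof.
move=> mphi phi0.
have -> : (\int[P]_w phi (w, Y w) = \int[distribution P pairG]_z phi z)%E.
  by rewrite ge0_integral_pushforward.
have -> : (\int[distribution P pairG]_z phi z =
    \int[distribution P idG \x distribution P Y]_z phi z)%E.
  apply: eq_measure_integral => A mA _; apply/esym.
  apply: product_measure_unique => // B C mB mC.
  rewrite /distribution /pushforward/= -GY//.
    by exists C => //; rewrite setTI.
rewrite fubini_tonelli1//.
rewrite ge0_integral_pushforward//; last 2 first.
- exact: measurable_fun_fubini_tonelli_F.
- by move=> w _; exact: integral_ge0.
rewrite preimage_setT; apply: eq_integral => w _ /=; rewrite /fubini_F.
rewrite ge0_integral_pushforward//.
exact: measurableT_comp.
Qed.

Lemma integralM_independent (f : T -> R) (g : S -> R) :
  measurable_fun (setT : set TG) f -> measurable_fun setT g ->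
  (forall w, 0 <= f w) -> (forall s, 0 <= g s) ->
  (\int[P]_w (f w * g (Y w))%:E
   = (\int[P]_w (f w)%:E) * (\int[P]_w (g (Y w))%:E))%E.
Proof.
move=> mf mg f0 g0.
have mfT : measurable_fun (setT : set T) f.
  by move=> _ B mB; apply: mG; exact: mf.
have mgY : measurable_fun setT (fun w => (g (Y w))%:E).
  by apply/measurable_EFinP; exact: (measurableT_comp mg mY).
have mphi : measurable_fun setT (fun z : TG * S => (f z.1 * g z.2)%:E).
  apply/measurable_EFinP; apply: measurable_funM.
    exact: (measurableT_comp mf).
  exact: (measurableT_comp mg).
have phi0 z : (0 <= (f z.1 * g z.2)%:E :> \bar R)%E by rewrite lee_fin mulr_ge0.
rewrite (integral_freezing mphi phi0)/=.
transitivity (\int[P]_w ((f w)%:E * \int[P]_w' (g (Y w'))%:E))%E.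
  apply: eq_integral => w _; under eq_integral do rewrite EFinM.
  by rewrite ge0_integralZl// => *; rewrite lee_fin.
rewrite ge0_integralZr//; first exact/measurable_EFinP.
- by move=> *; rewrite lee_fin.
- by apply: integral_ge0 => *; rewrite lee_fin.
Qed.

End freezing.

(** * Convergence of almost supermartingales *)

Section upcrossings.
Context {R : realType}.
Implicit Types (x : nat -> R) (a b : R).

(** Doob's betting strategy: buy when the path falls below [a], sell when it exceeds [b]. The value
    at [n] depends on the path up to [n] only and decides whether the increment from [n] to [n.+1]
    is collected. *)
Fixpoint holding x a b n : bool :=
  if n is n'.+1 then
    if holding x a b n' then x n <= b else x n < a
  else x 0%N < a.

Fixpoint upcrossings x a b n : R :=
  if n is n'.+1 then
    upcrossings x a b n' + (holding x a b n' && (b < x n))%:R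
  else 0.

Definition infinitely_often (Q : nat -> Prop) : Prop :=
  forall N, exists2 n, (N <= n)%N & Q n.

Lemma upcrossings_ge0 x a b n : 0 <= upcrossings x a b n.
Proof. by elim: n => //= n IH; rewrite addr_ge0. Qed.

Lemma nondecreasing_upcrossings x a b :
  {homo upcrossings x a b : m n / (m <= n)%N >-> m <= n}.
Proof. by apply/nondecreasing_seqP => n /=; rewrite lerDl. Qed.

(** A position held at [m] and not at [n] has been sold in between, and each sale completes an
    upcrossing. *)
Lemma upcrossings_released x a b m n : (m <= n)%N ->
  holding x a b m -> ~~ holding x a b n ->
  upcrossings x a b m + 1 <= upcrossings x a b n.
Proof.
elim: n => [|n IH]; first by rewrite leqn0 => /eqP -> ->.
rewrite leq_eqVlt => /predU1P[->->//|]; rewrite ltnS => mn hm /=.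
have [hn|hn] := boolP (holding x a b n); last first.
  by move=> _; rewrite /= addr0 IH.
by rewrite -ltNge => ->; rewrite lerD2r nondecreasing_upcrossings.
Qed.

Lemma upcrossings_unbounded x a b :
  infinitely_often (fun n => x n < a) -> infinitely_often (fun n => b < x n) ->
  forall k : nat, exists n, k%:R <= upcrossings x a b n.
Proof.
move=> xa xb; elim=> [|k [n kn]]; first by exists 0%N.
have [m nm hm] : exists2 m, (n <= m)%N & holding x a b m.
  have [[//|m] nm xma] := xa n.+1.
  have [hm|hm] := boolP (holding x a b m); first by exists m.
  by exists m.+1; [exact: ltnW|rewrite /= (negbTE hm)].
have [[//|l] ml bx] := xb m.+1.
exists l.+1; rewrite -natr1.
apply: (@le_trans _ _ (upcrossings x a b m + 1)).
  by rewrite lerD2r (le_trans kn)// nondecreasing_upcrossings.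
rewrite /= bx andbT; have [hl|hl] := boolP (holding x a b l).
  by rewrite lerD2r nondecreasing_upcrossings.
by rewrite /= addr0; exact: upcrossings_released.
Qed.

(** The limit is the infimum of the set [A] of rationals below which the path falls infinitely
    often. Thresholds are rational so that only countably many pairs have to be excluded almost
    surely, and positive because the elements of [A] are. *)
Lemma cvgn_no_oscillation x : (forall n, 0 <= x n) ->
  (exists B, infinitely_often (fun n => x n < B)) ->
  (forall p q : rat, 0 < ratr p :> R -> ratr p < ratr q :> R ->
    infinitely_often (fun n => x n < ratr p) ->
    infinitely_often (fun n => ratr q < x n) -> False) ->
  cvgn x.
Proof.
move=> x0 [B xB] osc.
pose A : set R := [set a | exists2 p : rat, a = ratr p &
  infinitely_often (fun n => x n < ratr p)].
have A0 : A !=set0.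
  have [q] := @rat_in_itvoo R B (B + 1) (ltr_pwDr ltr01 (lexx _)).
  rewrite in_itv/= => /andP[Bq _].
  exists (ratr q), q => // N; have [n Nn xn] := xB N; exists n => //.
  exact: lt_trans Bq.
have Age a : A a -> 0 < a.
  by move=> [p -> /(_ 0%N)[n _]]; exact: le_lt_trans.
have Alb : has_inf A by split => //; exists 0 => a /Age/ltW.
apply/cvg_ex; exists (inf A); apply/cvgrPdist_le => e e0.
have [_ [p -> ioP] pe] : exists2 a, A a & a < inf A + e / 2.
  by apply: inf_adherent => //; rewrite divr_gt0.
have p0 : 0 < ratr p :> R by apply: Age; exists p.
have [q] := rat_in_itvoo pe; rewrite in_itv/= => /andP[pq qe].
have [N1 hN1] : exists N, forall n, (N <= n)%N -> x n <= ratr q.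
  apply: contrapT => h; apply: (osc p q) => // N.
  apply: contrapT => h2; apply: h; exists N => n Nn; rewrite leNgt; apply/negP => qx.
  by apply: h2; exists n.
have eA : inf A - e < inf A by rewrite ltrBlDr ltrDl.
have [r] := rat_in_itvoo eA; rewrite in_itv/= => /andP[er rA].
have [N2 hN2] : exists N, forall n, (N <= n)%N -> ratr r <= x n.
  apply: contrapT => h; have : A (ratr r).
    exists r => // N; apply: contrapT => h2; apply: h; exists N => n Nn.
    by rewrite leNgt; apply/negP => qx; apply: h2; exists n.
  by move/(ge_inf Alb.2); rewrite leNgt rA.
exists (maxn N1 N2) => // n /=; rewrite geq_max => /andP[/hN1 xq /hN2 rx].
by rewrite ler_distl; apply/andP; split; lra.
Qed.

End upcrossings.

(** * Inferior limits and countable almost sure statements *)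

Section limn_einf_bounds.
Context {R : realType}.
Implicit Types u : nat -> \bar R.

Lemma limn_einf_le u K : (forall n, u n <= K)%E -> (limn_einf u <= K)%E.
Proof.
move=> uK; rewrite limn_einf_lim; apply: lime_le; first exact: is_cvg_einfs.
apply: nearW => n; apply: le_trans (uK n).
by apply: ereal_inf_lbound; exists n => /=.
Qed.

Lemma limn_einf_ge_near u K N : (forall n, (N <= n)%N -> K <= u n)%E ->
  (K <= limn_einf u)%E.
Proof.
move=> uK; rewrite limn_einf_lim; apply: lime_ge; first exact: is_cvg_einfs.
exists N => // n Nn; apply: le_ereal_inf_tmp => _ [m /= nm <-].
by apply: uK; exact: leq_trans nm.
Qed.

Lemma limn_einf_ge u K : (forall n, K <= u n)%E -> (K <= limn_einf u)%E.
Proof. by move=> uK; apply: (@limn_einf_ge_near _ _ 0) => n _. Qed.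

Lemma limn_einf_lt_io (x : nat -> R) B :
  (limn_einf (fun n => (x n)%:E) < B%:E)%E ->
  infinitely_often (fun n => x n < B).
Proof.
move=> xB N; apply: contrapT => h; move: xB; apply/negP; rewrite -leNgt.
apply: (@limn_einf_ge_near _ _ N) => n Nn; rewrite lee_fin leNgt.
by apply/negP => xnB; apply: h; exists n.
Qed.

End limn_einf_bounds.

Lemma measurable_fun_limn_einf {d : measure_display} {T : measurableType d}
    {R : realType} (f : nat -> T -> \bar R) :
  (forall n, measurable_fun setT (f n)) ->
  measurable_fun setT (fun w => limn_einf (f ^~ w)).
Proof.
move=> mf; apply: measurableT_comp => //.
by apply: measurable_fun_limn_esup => n; exact: measurableT_comp.
Qed.

Lemma ae_forall_countable {d : measure_display} {T : measurableType d}
    {R : realType} (P : probability T R) (I : countType) (Q : I -> T -> Prop) :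
  (forall i, {ae P, forall w, Q i w}) -> {ae P, forall w, forall i, Q i w}.
Proof.
move=> aeQ.
have : {ae P, forall w n, if @choice.unpickle I n is Some i then Q i w else True}.
  apply: ae_foralln => n; case: (@choice.unpickle I n) => [i|]; [exact: aeQ|exact: aeW].
by apply: filterS => w + i => /(_ (choice.pickle i)); rewrite choice.pickleK.
Qed.

Lemma integral_cst_prob {d : measure_display} {T : measurableType d}
  {R : realType} (P : probability T R) (c : R) : (\int[P]_w c%:E = c%:E)%E.
Proof.
by rewrite integral_cst// (_ : _ setT = 1%E) ?mule1//; exact: probability_setT.
Qed.

Section almost_supermartingale.
Context {d : measure_display} {T : measurableType d} {R : realType}.
Variable P : probability T R.
Variables (F : nat -> set (set T)) (M : nat -> T -> R) (c : nat -> R) (C : R).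
Hypothesis mF : forall n, <<s F n >> `<=` measurable.
Hypothesis ndF : forall n, <<s F n >> `<=` <<s F n.+1 >>.
Hypothesis mM : forall n,
  measurable_fun (setT : set (g_sigma_algebraType (F n))) (M n).
Hypothesis M0 : forall n w, 0 <= M n w.
Hypothesis M_start : (\int[P]_w (M 0 w)%:E <= C%:E)%E.
Hypothesis c_sum : forall n, \sum_(0 <= k < n) c k <= C.
(** The supermartingale inequality up to an error [c n], tested against events known at time [n];
    indicators suffice because the strategy [holding] is one. *)
Hypothesis M_step : forall n (h : T -> bool),
  measurable_fun (setT : set (g_sigma_algebraType (F n))) h ->
  (\int[P]_w ((h w)%:R * M n.+1 w)%:E
    <= \int[P]_w ((h w)%:R * M n w)%:E + (c n)%:E)%E.

Lemma coarse_measurable_fun {d'} {S : measurableType d'} n (f : T -> S) :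
  measurable_fun (setT : set (g_sigma_algebraType (F n))) f ->
  measurable_fun (setT : set T) f.
Proof. by move=> mf _ B mB; apply: (@mF n); exact: mf. Qed.

Let mMT n : measurable_fun (setT : set T) (M n).
Proof. exact: coarse_measurable_fun (@mM n). Qed.

Lemma integral_almost_supermartingale n :
  (\int[P]_w (M n w)%:E <= (C + \sum_(0 <= k < n) c k)%:E)%E.
Proof.
elim: n => [|n IH]; first by rewrite big_geq// addr0.
have := @M_step n xpredT (measurable_cst _).
under eq_integral do rewrite mul1r; under [X in (_ <= X + _)%E]eq_integral do rewrite mul1r.
move/le_trans; apply; rewrite big_nat_recr//= addrA EFinD.
exact: leeD.
Qed.

Let intM_lty n : (\int[P]_w (M n w)%:E < +oo)%E.
Proof. exact: le_lt_trans (integral_almost_supermartingale n) (ltry _). Qed.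

Section threshold.
Variables (a b : R).
Hypotheses (a0 : 0 < a) (ab : a < b).

Let h n w := holding (M ^~ w) a b n.
Let u n w := upcrossings (M ^~ w) a b n.
(** Wealth of the strategy started with cash [a], each sale being booked at the price [b] and each
    purchase at the price [a]. The actual prices are more favourable, so [V] increases by at most
    the increments of [M] collected while holding. *)
Let V n w := (b - a) * u n w + (if h n w then M n w else a).

Let mh n : measurable_fun (setT : set (g_sigma_algebraType (F n))) (h n).
Proof.
elim: n => [|n IH]; first by apply: measurable_fun_ltr => //; exact: measurable_cst.
rewrite [h _](_ : _ = fun w => if h n w then M n.+1 w <= b else M n.+1 w < a)//.
apply: (@measurable_fun_ifT _ _ (g_sigma_algebraType (F n.+1))).
- by move=> _ B mB; apply: ndF; exact: IH.
- by apply: measurable_fun_ler => //; exact: measurable_cst.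
- by apply: measurable_fun_ltr => //; exact: measurable_cst.
Qed.

Let mhT n : measurable_fun (setT : set T) (h n).
Proof. exact: coarse_measurable_fun (@mh n). Qed.

Let mbool (f : T -> bool) : measurable_fun setT f ->
  measurable_fun setT (fun w => (f w)%:R : R).
Proof. by move=> mf; exact: (measurableT_comp (f := fun b : bool => b%:R : R)). Qed.

Let mu n : measurable_fun (setT : set T) (u n).
Proof.
elim: n => [|n IH]; first exact: measurable_cst.
apply: measurable_funD => //; apply: mbool; apply: measurable_and; first exact: mhT.
by apply: measurable_fun_ltr => //; exact: measurable_cst.
Qed.

Let mV n : measurable_fun (setT : set T) (V n).
Proof.
apply: measurable_funD; first by apply: measurable_funM => //; exact: measurable_cst.
by apply: measurable_fun_ifT => //; exact: measurable_cst.
Qed.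

Let V0 n w : 0 <= V n w.
Proof.
rewrite addr_ge0 ?mulr_ge0 ?subr_ge0 ?upcrossings_ge0 ?(ltW ab)//.
by case: ifP => // _; exact: ltW.
Qed.

(** The increment inequality is written without subtraction, so that it can be integrated term by
    term between nonnegative functions. *)
Let V_step n w : V n.+1 w + (h n w)%:R * M n w <= V n w + (h n w)%:R * M n.+1 w.
Proof.
rewrite /V /u /h /=; have := M0 n w; have := M0 n.+1 w.
case: (holding _ _ _ n) => /= M1 M2; last first.
  by case: ltP => ? /=; lra.
by case: (leP (M n.+1 w) b) => ? /=; lra.
Qed.

Let intV n : (\int[P]_w (V n w)%:E <= (a + \sum_(0 <= k < n) c k)%:E)%E.
Proof.
elim: n => [|n IH].
  rewrite big_geq// addr0.
  apply: (@le_trans _ _ (\int[P]_w a%:E)%E); last first.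
    by rewrite integral_cst_prob.
  apply: ge0_le_integral => //=.
  - by move=> w _; rewrite lee_fin.
  - exact/measurable_EFinP.
  - by move=> w _; rewrite lee_fin /V /u /h/= mulr0 add0r; case: ifP => // /ltW.
have mhM k : measurable_fun setT (fun w => (h n w)%:R * M k w).
  by apply: measurable_funM => //; exact: mbool.
(* Finiteness of this integral allows it to be added to both sides, and cancelled, in the extended
   reals. *)
have fin : (\int[P]_w ((h n w)%:R * M n w)%:E)%E \is a fin_num.
  rewrite ge0_fin_numE; last by apply: integral_ge0 => w _; rewrite lee_fin mulr_ge0.
  apply: le_lt_trans (intM_lty n); apply: ge0_le_integral => //.
  - by move=> w _; rewrite lee_fin mulr_ge0.
  - exact/measurable_EFinP.
  - exact/measurable_EFinP.
  - by move=> w _; rewrite lee_fin; case: (h n w); rewrite ?mul1r ?mul0r.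
rewrite -(leeD2rE _ _ fin) -ge0_integralD//; first last.
- exact/measurable_EFinP.
- by move=> w _; rewrite lee_fin mulr_ge0.
- exact/measurable_EFinP.
- by move=> w _; rewrite lee_fin.
apply: (@le_trans _ _ (\int[P]_w ((V n w)%:E + ((h n w)%:R * M n.+1 w)%:E))%E).
  apply: ge0_le_integral => //.
  - by move=> w _; rewrite -EFinD lee_fin addr_ge0// mulr_ge0.
  - by apply: emeasurable_funD; exact/measurable_EFinP.
  - by apply: emeasurable_funD; exact/measurable_EFinP.
  - by move=> w _; rewrite -!EFinD lee_fin.
rewrite ge0_integralD//; first last.
- exact/measurable_EFinP.
- by move=> w _; rewrite lee_fin mulr_ge0.
- exact/measurable_EFinP.
- by move=> w _; rewrite lee_fin.
have -> : (a + \sum_(0 <= k < n.+1) c k)%:E =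
    ((a + \sum_(0 <= k < n) c k)%:E + (c n)%:E)%E.
  by rewrite big_nat_recr//= addrA EFinD.
by rewrite -[leRHS]addeA; apply: leeD => //; rewrite [leRHS]addeC; exact: (M_step (@mh n)).
Qed.

(** Doob's inequality: [(b - a) * u n <= V n] bounds the mean number of upcrossings by
    [(a + C) / (b - a)] for every [n], so by monotone convergence their total number is almost
    surely finite. *)
Lemma ae_not_oscillating : {ae P, forall w,
  infinitely_often (fun n => M n w < a) ->
  infinitely_often (fun n => b < M n w) -> False}.
Proof.
have ba : 0 < b - a by rewrite subr_gt0.
have intu n : (\int[P]_w (u n w)%:E <= ((b - a)^-1 * (a + C))%:E)%E.
  rewrite EFinM muleC lee_pdivlMr//.
  rewrite -ge0_integralZr//; [|exact/measurable_EFinP|by move=> *; rewrite lee_fin upcrossings_ge0|by rewrite lee_fin ltW].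
  apply: (@le_trans _ _ (\int[P]_w (V n w)%:E)%E).
    apply: ge0_le_integral => //.
    + by move=> w _; rewrite mule_ge0// lee_fin ?upcrossings_ge0// ltW.
    + apply/measurable_EFinP; apply: measurable_funM => //; exact: measurable_cst.
    + exact/measurable_EFinP.
    + move=> w _; rewrite -EFinM lee_fin mulrC lerDl; case: ifP => // _; exact: ltW.
  by apply: (le_trans (intV n)); rewrite lee_fin lerD2l.
have ndu w : nondecreasing_seq (fun n => (u n w)%:E).
  by move=> m n mn; rewrite lee_fin; exact: nondecreasing_upcrossings.
pose f w := limn (fun n => (u n w)%:E).
have mf : measurable_fun setT f.
  apply: (emeasurable_fun_cvg (fun n w => (u n w)%:E)).
    by move=> n; exact/measurable_EFinP.
  by move=> w _; exact: ereal_nondecreasing_is_cvgn.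
have f0 w : (0 <= f w)%E.
  apply: lime_ge; first exact: ereal_nondecreasing_is_cvgn.
  by apply: nearW => n; rewrite lee_fin upcrossings_ge0.
have intf : P.-integrable setT f.
  apply/integrableP; split => //.
  under eq_integral do rewrite gee0_abs//.
  rewrite /f monotone_convergence//; last 2 first.
  - by move=> n; exact/measurable_EFinP.
  - by move=> n w _; rewrite lee_fin upcrossings_ge0.
  apply: (@le_lt_trans _ _ ((b - a)^-1 * (a + C))%:E); last exact: ltry.
  apply: lime_le; last exact: nearW.
  apply: ereal_nondecreasing_is_cvgn => m n mn; apply: ge0_le_integral => //.
  - by move=> w _; rewrite lee_fin upcrossings_ge0.
  - exact/measurable_EFinP.
  - exact/measurable_EFinP.
  - by move=> w _; exact: ndu.
have := integrable_ae measurableT intf; apply: filterS => w /(_ I) fw ioa iob.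
(* An oscillating path would complete more upcrossings than their finite total [f w]. *)
have [n] := upcrossings_unbounded ioa iob (Num.truncn (fine (f w))).+1.
apply/negP; rewrite -ltNge; apply: le_lt_trans (truncnS_gt _).
rewrite -lee_fin fineK//.
apply: lime_ge; first exact: ereal_nondecreasing_is_cvgn.
by exists n => // m /= nm; exact: ndu.
Qed.

End threshold.

(** The absence of oscillation leaves divergence to infinity possible; Fatou's lemma excludes it,
    because the means of [M n] are bounded by [C + C]. *)
Theorem ae_cvgn_almost_supermartingale : {ae P, forall w, cvgn (M ^~ w)}.
Proof.
have osc : {ae P, forall w, forall pq : rat * rat,
    0 < ratr pq.1 :> R -> ratr pq.1 < ratr pq.2 :> R ->
    infinitely_often (fun n => M n w < ratr pq.1) ->
    infinitely_often (fun n => ratr pq.2 < M n w) -> False}.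
  apply: ae_forall_countable => -[p q]/=.
  have [p0|p0] := ltP 0 (ratr p : R); last by apply: aeW => w; lra.
  have [pq|pq] := ltP (ratr p : R) (ratr q); last by apply: aeW => w; lra.
  by apply: filterS (ae_not_oscillating p0 pq) => w h _ _; exact: h.
have fin : {ae P, forall w, (limn_einf (fun n => (M n w)%:E) < +oo)%E}.
  have mMe n : measurable_fun setT (fun w => (M n w)%:E) by exact/measurable_EFinP.
  pose f w := limn_einf (fun n => (M n w)%:E).
  have f0 w : (0 <= f w)%E by apply: limn_einf_ge => n; rewrite lee_fin.
  have intf : P.-integrable setT f.
    apply/integrableP; split; first exact: measurable_fun_limn_einf.
    under eq_integral do rewrite gee0_abs//.
    apply: le_lt_trans (ltry (C + C)).
    apply: (le_trans (fatou P measurableT mMe _)); first by move=> *; rewrite lee_fin.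
    apply: limn_einf_le => n; apply: (le_trans (integral_almost_supermartingale n)).
    by rewrite lee_fin lerD2l.
  have := integrable_ae measurableT intf; apply: filterS => w /(_ I).
  by rewrite ge0_fin_numE.
apply: filterS2 osc fin => w oscw finw; apply: cvgn_no_oscillation => //.
  have l0 : (0 <= limn_einf (fun n => (M n w)%:E))%E.
    by apply: limn_einf_ge => n; rewrite lee_fin.
  have lf : limn_einf (fun n => (M n w)%:E) \is a fin_num by rewrite ge0_fin_numE.
  exists (fine (limn_einf (fun n => (M n w)%:E)) + 1); apply: limn_einf_lt_io.
  by rewrite EFinD fineK// lteDl// lte_fin.
by move=> p q p0 pq; exact: (oscw (p, q)).
Qed.

End almost_supermartingale.

(** * Linearity of the echoed recursion *)

Section echoed_paths.
Context {R : realType}.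
Variables (eps : nat -> bool) (u : nat -> nat) (xi : nat -> R).
Hypothesis uP : forall n, (2 <= n)%N -> (1 <= u n < n)%N.
Implicit Types (z : nat -> R) (r n : nat).

Local Notation echoed z := (echoed z eps u xi).
Local Notation echoed_sum z := (echoed_sum z eps u xi).

Let echoedS z n : (2 <= n)%N -> echoed z n =
  (1 - (eps n)%:R) * z n + (eps n)%:R * xi n * echoed z (u n).
Proof. by move=> n2; exact: echoedE. Qed.

(** Induction along the line of ancestors, which ends at the root [1]. *)
Lemma echoed_ind (Q : nat -> Prop) : Q 1%N ->
  (forall n, (2 <= n)%N -> Q (u n) -> Q n) -> forall n, (1 <= n)%N -> Q n.
Proof.
move=> Q1 QS; elim/ltn_ind => n IH n1.
have [n2|] := leqP 2 n; last by case: n n1 {IH} => [|[|]].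
by apply: QS => //; have /andP[u1 un] := uP n2; exact: IH.
Qed.

Lemma echoed_ge0 z n : (forall n, 0 <= z n) -> (forall n, 0 <= xi n) ->
  0 <= echoed z n.
Proof.
move=> z0 xi0; case: n => [//|n].
have : (1 <= n.+1)%N by []; move: n.+1 => {n}.
apply: echoed_ind => [|n n2 IH]; first by rewrite echoed1.
by rewrite (echoedS _ n2); case: (eps n); rewrite ?subrr ?subr0 ?mul0r ?mul1r ?add0r ?addr0 ?mulr_ge0.
Qed.

Lemma eq_echoed z z' n : (forall k, (1 <= k)%N -> z k = z' k) ->
  (1 <= n)%N -> echoed z n = echoed z' n.
Proof.
move=> zz'; move: n; apply: echoed_ind => [|n n2 IH]; first by rewrite !echoed1 zz'.
by rewrite !(echoedS _ n2) IH zz'// ltnW.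
Qed.

Lemma echoedD z z' n : (1 <= n)%N ->
  echoed (fun k => z k + z' k) n = echoed z n + echoed z' n.
Proof.
move: n; apply: echoed_ind => [|n n2 IH]; first by rewrite !echoed1.
by rewrite !(echoedS _ n2) IH; ring.
Qed.

Lemma echoedZ c z n : (1 <= n)%N -> echoed (fun k => c * z k) n = c * echoed z n.
Proof.
move: n; apply: echoed_ind => [|n n2 IH]; first by rewrite !echoed1.
by rewrite !(echoedS _ n2) IH; ring.
Qed.

Lemma echoed_sumS z n : echoed_sum z n.+1 = echoed_sum z n + echoed z n.+1.
Proof. by rewrite /Defs.echoed_sum big_nat_recr. Qed.

Lemma eq_echoed_sum z z' n : (forall k, (1 <= k)%N -> z k = z' k) ->
  echoed_sum z n = echoed_sum z' n.
Proof.
move=> zz'; rewrite /Defs.echoed_sum big_nat [RHS]big_nat.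
by apply: eq_bigr => i /andP[i1 _]; exact: eq_echoed.
Qed.

Lemma echoed_sumD z z' n :
  echoed_sum (fun k => z k + z' k) n = echoed_sum z n + echoed_sum z' n.
Proof.
rewrite /Defs.echoed_sum -big_split/= big_nat [RHS]big_nat.
by apply: eq_bigr => i /andP[i1 _]; exact: echoedD.
Qed.

Lemma echoed_sumZ c z n : echoed_sum (fun k => c * z k) n = c * echoed_sum z n.
Proof.
rewrite /Defs.echoed_sum mulr_sumr big_nat [RHS]big_nat.
by apply: eq_bigr => i /andP[i1 _]; exact: echoedZ.
Qed.

Lemma echoed_sum0 n : echoed_sum (fun=> 0) n = 0.
Proof.
transitivity (echoed_sum (fun=> 0 * 0) n).
  by apply: eq_echoed_sum => k _; rewrite mul0r.
by rewrite (echoed_sumZ 0 (fun=> 0)) mul0r.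
Qed.

(** By linearity, the walk driven by this spin is the coefficient of [z r] in the walk driven by
    [z]. *)
Definition single_spin r : nat -> R := fun k => (k == r)%:R.

Lemma echoed_sum_head z n N :
  echoed_sum (fun k => (k <= N)%:R * z k) n
  = \sum_(1 <= r < N.+1) z r * echoed_sum (single_spin r) n.
Proof.
elim: N => [|N IH].
  rewrite big_geq// -(echoed_sum0 n); apply: eq_echoed_sum => -[//|k] _.
  by rewrite leqn0/= mul0r.
rewrite big_nat_recr//= -IH -echoed_sumZ -echoed_sumD.
apply: eq_echoed_sum => k _; rewrite /single_spin leq_eqVlt ltnS.
have [->|_] := eqVneq k N.+1; first by rewrite ltnn /= mul1r mul0r add0r mulr1.
by rewrite /= mulr0 addr0.
Qed.

Lemma kept_descendantE r i : (2 <= i)%N ->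
  kept_descendant eps u r i <-> i = r \/ eps i /\ kept_descendant eps u r (u i).
Proof.
move=> i2; split; last first.
  by move=> [->|[ei ki]]; [exact: kept_root|exact: kept_child].
move=> k; case: k i2 => [|j j2 ej kj] _; by [left|right].
Qed.

(** Both sides obey the same recursion towards the parent: a deleted edge resets the step to its
    spin and starts a new cluster, a kept edge multiplies step and weight by [xi i] and stays in the
    cluster of the parent. *)
Lemma echoed_single_spinE r i : (1 <= i)%N ->
  echoed (single_spin r) i =
  (`[< (r = 1%N \/ eps r = false) /\ kept_descendant eps u r i >])%:R
    * weight eps u xi i.
Proof.
move: i; apply: echoed_ind => [|i i2 IH].
  rewrite /weight !echoed1 mulr1 /single_spin; congr (_%:R); congr nat_of_bool.
  apply/eqP/asboolP => [<-|[_ k]]; first by split; [left|exact: kept_root].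
  by inversion k.
rewrite /weight !(echoedS _ i2) IH -/(weight eps u xi) /single_spin.
have [ei|ei] := boolP (eps i); last first.
  rewrite !mul0r subr0 !mul1r !addr0 mulr1; congr (_%:R); congr nat_of_bool.
  apply/eqP/asboolP => [ir|[_]].
    by split; [right; rewrite -ir; exact/negbTE|rewrite ir; exact: kept_root].
  by rewrite (kept_descendantE r i2) (negbTE ei) => -[//|[]].
rewrite subrr !mul0r !add0r mulrCA; congr (_ * _).
congr (_%:R); congr nat_of_bool; apply: asbool_equiv_eq.
rewrite (kept_descendantE r i2); split=> [[h1 h2]|[h1 [ir|[_ //]]]].
  by split => //; right.
(* Here [i = r] has a kept edge to its parent, whereas [h1] makes [r] the root of its cluster. *)
exfalso; case: h1 => h1; first by rewrite ir h1 in i2.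
by move: ei; rewrite ir h1.
Qed.

(** This identity reduces all questions on the trees to walks with a deterministic spin. *)
Lemma tree_weightE r n : tree_weight eps u xi r n = echoed_sum (single_spin r) n.
Proof.
rewrite /tree_weight /Defs.echoed_sum big_mkcond/= big_nat [RHS]big_nat.
apply: eq_bigr => i /andP[i1]; rewrite ltnS => ni.
rewrite echoed_single_spinE// [X in if X then _ else _](_ : _ =
    `[< (r = 1%N \/ eps r = false) /\ kept_descendant eps u r i >]).
  by case: asboolP => _; rewrite ?mul1r ?mul0r.
apply: asbool_equiv_eq; rewrite /perc_tree/= i1 ni.
by split => [[]|[]].
Qed.

End echoed_paths.

(** The equality holds fuel by fuel; it carries walks from [U] and [xis] to their corrected versions
    on the event where these agree. *)
Lemma echoed_fuel_eq {R : realType} (z : nat -> R) eps u u' xi xi' :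
  (forall n, (2 <= n)%N -> u n = u' n) -> (forall n, (2 <= n)%N -> xi n = xi' n) ->
  forall k n, echoed_fuel z eps u xi k n = echoed_fuel z eps u' xi' k n.
Proof.
move=> uu xx; elim=> //= k IH n; case: leqP => // n2.
by rewrite uu// xx// IH.
Qed.

Lemma echoed_sum_eq {R : realType} (z : nat -> R) eps u u' xi xi' n :
  (forall n, (2 <= n)%N -> u n = u' n) -> (forall n, (2 <= n)%N -> xi n = xi' n) ->
  echoed_sum z eps u xi n = echoed_sum z eps u' xi' n.
Proof. by move=> uu xx; apply: eq_bigr => i _; exact: echoed_fuel_eq. Qed.

(** * Real inequalities *)

Section power_inequalities.
Context {R : realType}.
Implicit Types (a s x y t : R) (n : nat).

(** Young's inequality for the product of [1 + x] and [1], with conjugate exponents [a] and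
    [a / (a - 1)]. *)
Lemma powR_bernoulli a x : 1 < a -> -1 <= x -> 1 + a * x <= (1 + x) `^ a.
Proof.
move=> a1 x1; have a0 : 0 < a by lra.
have q0 : 0 < a / (a - 1) by rewrite divr_gt0//; lra.
have x0 : 0 <= 1 + x by lra.
have := @conjugate_powR R (1 + x) 1 a (a / (a - 1)) x0 ler01 a0 q0.
rewrite powR1 mul1r invf_div mulr1 => h.
have {}h : 1 + x <= (1 + x) `^ a / a + (a - 1) / a.
  by apply: h; field; lra.
rewrite -(ler_pM2l a0) in h; set v := (1 + x) `^ a in h *.
have e : a * (v / a + (a - 1) / a) = v + a - 1 by field; lra.
by rewrite e in h; lra.
Qed.

(** The previous inequality with exponent [1 / t] at the point [t * x], raised to the power [t]. *)
Lemma powR_concave_bernoulli t x : 0 < t < 1 -> 0 <= x -> (1 + x) `^ t <= 1 + t * x.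
Proof.
move=> /andP[t0 t1] x0.
have h : 1 + x <= (1 + t * x) `^ t^-1.
  have := @powR_bernoulli t^-1 (t * x); rewrite mulrA mulVf ?mul1r ?gt_eqF//; apply.
    by rewrite invf_gt1.
  by rewrite (@le_trans _ _ 0)// ?mulr_ge0// ltW.
have /= := @ge0_ler_powR R t (ltW t0) (1 + x) ((1 + t * x) `^ t^-1).
rewrite -powRrM mulVf ?gt_eqF// powRr1 ?addr_ge0 ?mulr_ge0// ?(ltW t0)//.
by apply => //; rewrite nnegrE ?powR_ge0 ?addr_ge0.
Qed.

(** A proportion [q] in the unit interval satisfies [q <= q^t]; this is applied to the shares of [x]
    and of [y] in [x + y], which sum to one. *)
Lemma powR_subadditive t x y : 0 < t < 1 -> 0 <= x -> 0 <= y ->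
  (x + y) `^ t <= x `^ t + y `^ t.
Proof.
move=> /andP[t0 t1] x0 y0.
have [xy|xy] := eqVneq (x + y) 0.
  by rewrite xy powR0 ?gt_eqF// addr_ge0 ?powR_ge0.
have xy0 : 0 < x + y by rewrite lt_def xy addr_ge0.
have h z : 0 <= z -> z <= x + y -> z / (x + y) * (x + y) `^ t <= z `^ t.
  move=> z0 zxy; have [->|zn] := eqVneq z 0; first by rewrite !mul0r powR_ge0.
  have z1 : 0 < z / (x + y) <= 1.
    have zp : 0 < z by rewrite lt_def zn.
    by apply/andP; split; [exact: divr_gt0|rewrite ler_pdivrMr// mul1r].
  apply: (@le_trans _ _ ((z / (x + y)) `^ t * (x + y) `^ t)).
    by rewrite ler_wpM2r ?powR_ge0//; apply: ger1_powR => //; exact: ltW.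
  rewrite -powRM ?divfK//; first by case/andP : z1 => /ltW.
  exact: ltW.
apply: le_trans (lerD (h x x0 _) (h y y0 _)); [|lra|lra].
by rewrite -mulrDl -mulrDl divff ?mul1r.
Qed.

(** Write the left side as [x (x + y)^t + y (x + y)^t], and bound the first power by its tangent and
    the second by subadditivity. With [x] the walk and [y] the next step, the middle term is linear
    in the step and its mean is known exactly. *)
Lemma powR_taylor t x y : 0 < t < 1 -> 0 <= x -> 0 <= y ->
  (x + y) `^ (1 + t) <= x `^ (1 + t) + (1 + t) * (x `^ t * y) + y `^ (1 + t).
Proof.
move=> t01 x0 y0; have /andP[t0 t1] := t01.
have pS z : 0 <= z -> z `^ (1 + t) = z * z `^ t.
  by move=> z0; rewrite powRD ?powRr1// (_ : (1 + t == 0) = false)//; lra.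
rewrite !pS ?addr_ge0//.
have h1 : x * (x + y) `^ t <= x * x `^ t + t * (x `^ t * y).
  have [->|xn] := eqVneq x 0; first by rewrite !mul0r powR0 ?gt_eqF// !mul0r mulr0 addr0.
  have xp : 0 < x by rewrite lt_def xn.
  have -> : x + y = x * (1 + y / x) by field.
  rewrite powRM//; last by rewrite addr_ge0// divr_ge0.
  have := @powR_concave_bernoulli t (y / x) t01 (divr_ge0 y0 x0).
  have c0 : 0 <= x * x `^ t by rewrite mulr_ge0 ?powR_ge0.
  move=> /(ler_wpM2l c0); set A := x `^ t; set B := (1 + y / x) `^ t => h.
  have e : x * A * (1 + t * (y / x)) = x * A + t * (A * y) by field.
  by rewrite e in h; lra.
have := powR_subadditive t01 x0 y0 => /(ler_wpM2l y0).
by move: h1; set A := (x + y) `^ t; set B := x `^ t; set C := y `^ t; lra.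
Qed.

(** Bernoulli's inequality at [1 / n]. The change of normalisation absorbs the growth factor
    [1 + a / n] of the mean, which is what makes the normalised walk an almost supermartingale. *)
Lemma natr_powR_scale a n : 1 < a -> (0 < n)%N ->
  (1 + a / n%:R) * n.+1%:R `^ (- a) <= n%:R `^ (- a).
Proof.
move=> a1 n0; have nR : 0 < n%:R :> R by rewrite ltr0n.
rewrite !powRN ler_pdivrMr ?powR_gt0//.
have -> : n.+1%:R = n%:R * (1 + n%:R^-1) :> R.
  by rewrite mulrDr divff ?mulr1 ?gt_eqF// natr1.
rewrite powRM ?addr_ge0 ?invr_ge0 ?(ltW nR)// mulKf ?gt_eqF ?powR_gt0//.
by apply: powR_bernoulli => //; apply: (@le_trans _ _ 0); rewrite ?lerN10 ?invr_ge0 ?ltW.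
Qed.

(** The lower bound is the upper one at [- x / (1 + x)], because [1 - x / (1 + x)] is the inverse of
    [1 + x]. *)
Lemma ln1D_bounds x : 0 <= x -> x - x ^+ 2 <= ln (1 + x) <= x.
Proof.
move=> x0; have x1 : 0 < 1 + x by lra.
apply/andP; split; last by apply: le_ln1Dx; lra.
have : ln (1 + (- (x / (1 + x)))) <= - (x / (1 + x)).
  by apply: le_ln1Dx; rewrite ltrN2 ltr_pdivrMr//; lra.
have -> : 1 + (- (x / (1 + x))) = (1 + x)^-1 by field; lra.
rewrite lnV ?posrE// lerN2; apply: le_trans.
rewrite ler_pdivlMr//.
have : 0 <= x ^+ 3 by rewrite exprn_ge0.
by rewrite !exprS expr0; lra.
Qed.

(** A converse of [natr_powR_scale], up to factors whose infinite product is positive since [n^-2]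
    is summable. It serves to show that a quantity multiplied by [1 + a / n] at each step cannot
    become negligible with respect to [n^a]. *)
Lemma natr_powR_ratio a n : 0 < a -> (0 < n)%N ->
  expR (- (a ^+ 2 / n%:R ^+ 2)) * n%:R `^ (- a)
    <= (1 + a / n%:R) * n.+1%:R `^ (- a).
Proof.
move=> a0 n0; have nR : 0 < n%:R :> R by rewrite ltr0n.
have an : 0 <= a / n%:R by rewrite divr_ge0 ?ltW.
have l1 := ln1D_bounds an.
have := @ln1D_bounds n%:R^-1; rewrite invr_ge0 ltW// => /(_ isT) /andP[_ l2].
have n1 : 0 < 1 + n%:R^-1 :> R by rewrite addr_gt0 ?invr_gt0.
have -> : n.+1%:R = n%:R * (1 + n%:R^-1) :> R.
  by rewrite mulrDr divff ?mulr1 ?gt_eqF// natr1.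
rewrite powRM ?(ltW nR) ?(ltW n1)// mulrCA mulrC ler_pM2l ?powR_gt0//.
have p1 : 1 + a / n%:R \is Num.pos by rewrite posrE ltr_pwDl.
rewrite -[1 + a / n%:R](lnK p1).
rewrite /powR gt_eqF// -expRD ler_expR.
have /andP[l1' _] := l1; rewrite expr_div_n in l1'.
have : a * ln (1 + n%:R^-1) <= a / n%:R by apply: ler_wpM2l => //; exact: ltW.
by lra.
Qed.

(** Comparison with the integral of [x^(- s)] in telescoping form: from the second on, each term is
    at most the decrease of [k^(- (s - 1)) / (s - 1)]. *)
Lemma sum_powRN_le s n : 1 < s ->
  \sum_(0 <= k < n) k.+1%:R `^ (- s) <= 1 + (s - 1)^-1.
Proof.
move=> s1; have s0 : 0 < s - 1 by lra.
suff h m : \sum_(0 <= k < m.+1) k.+1%:R `^ (- s) <=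
    1 + (s - 1)^-1 * (1 - m.+1%:R `^ (- (s - 1))).
  case: n => [|n].
    by rewrite big_geq// addr_ge0 ?invr_ge0// ltW.
  apply: (le_trans (h n)); rewrite lerD2l; apply: ler_piMr.
    by rewrite invr_ge0 ltW.
  by rewrite gerBl powR_ge0.
elim: m => [|m IH].
  by rewrite big_nat1 !powR1 subrr mulr0 addr0.
rewrite big_nat_recr//=; apply: (le_trans (lerD IH (lexx _))).
have m0 : 0 < m.+1%:R :> R by [].
have m1 : 0 < m.+2%:R :> R by [].
set A := m.+1%:R `^ (- (s - 1)).
have -> : m.+2%:R `^ (- s) = m.+2%:R `^ (- (s - 1)) * m.+2%:R^-1 :> R.
  rewrite -(@powR_inv1 _ m.+2%:R)// -powRD; last first.
    by apply/implyP => _; rewrite pnatr_eq0.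
  by congr (_ `^ _); ring.
set B := m.+2%:R `^ (- (s - 1)).
suff : (s - 1) * (B * m.+2%:R^-1) <= A - B.
  rewrite -ler_pdivlMl// => h2; apply: (le_trans (lerD (lexx _) h2)).
  by rewrite le_eqVlt; apply/orP; left; apply/eqP; ring.
have e2 : m.+2%:R = m.+1%:R * (1 + m.+1%:R^-1) :> R.
  by rewrite mulrDr divff ?mulr1 ?gt_eqF// natr1.
have r0 : 0 < 1 + m.+1%:R^-1 :> R by rewrite addr_gt0 ?invr_gt0.
have -> : A = B * (1 + m.+1%:R^-1) `^ (s - 1).
  rewrite /A /B e2 powRM ?ltW// -mulrA -powRD; last first.
    by apply/implyP => _; rewrite gt_eqF.
  by rewrite addNr powRr0 mulr1.
rewrite mulrCA -[X in _ <= _ - X]mulr1 -mulrBr ler_pM2l ?powR_gt0//.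
rewrite lerBrDl; apply: le_trans (_ : 1 + (s - 1) * ln (1 + m.+1%:R^-1) <= _).
  rewrite lerD2l ler_pM2l//.
  have : ln (1 + (- m.+2%:R^-1)) <= - m.+2%:R^-1 :> R.
    by apply: le_ln1Dx; rewrite ltrN2 invf_lt1// ltr1n.
  have -> : 1 + (- m.+2%:R^-1) = (1 + m.+1%:R^-1)^-1 :> R.
    by rewrite -[m.+2%:R]natr1; field; rewrite !gt_eqF//= -?natr1; have := ler0n R m; lra.
  by rewrite lnV ?posrE// lerN2.
by rewrite /powR gt_eqF//; exact: expR_ge1Dx.
Qed.

Lemma powRN_ge1 s n : 0 <= s -> (0 < n)%N ->
  1 - s / n%:R <= (n%:R / n.+1%:R) `^ s.
Proof.
move=> s0 n0; have nR : 0 < n%:R :> R by rewrite ltr0n.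
have q0 : 0 < n%:R / n.+1%:R :> R by rewrite divr_gt0.
rewrite /powR gt_eqF//; apply: le_trans (expR_ge1Dx _); rewrite lerD2l.
have -> : n%:R / n.+1%:R = (1 + n%:R^-1)^-1 :> R.
  by rewrite -natr1; field; rewrite !gt_eqF//; lra.
have n1 : 0 < 1 + n%:R^-1 :> R by rewrite addr_gt0 ?invr_gt0.
rewrite lnV ?posrE// mulrN lerN2 ler_wpM2l//.
by apply: le_ln1Dx; apply: (@lt_trans _ _ 0) => //; rewrite ?ltrN10 ?invr_gt0.
Qed.

End power_inequalities.

(** * The entropy potential *)

Section entropy_potential.
Context {R : realType}.
Variables (B delta : R).
Hypothesis delta0 : 0 < delta.
Implicit Types (x z w K : R).

(** Renormalisation by a factor close to [1 - a / n] raises [- x ln x], beyond its rescaling, by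
    about [a x / n]; the new steps [xi x], of total rate [p / n], bring [- p l x / n] with [l] the
    mean of [xi ln xi]. As [a = p m] and [m <= l], the balance is not positive. The same account for
    [- x^(1 + delta)] gives a strict loss when the moment of order [1 + delta] exceeds
    [(1 + delta) m]. The truncation at 0 keeps the potential nonnegative for large [xi x]. *)
Definition entropy_potential x : R := Num.max 0 (x * (B - ln x - x `^ delta)).
Local Notation k := entropy_potential.

Lemma entropy_potential_ge0 x : 0 <= k x.
Proof. by rewrite le_max lexx. Qed.

Lemma entropy_potential0 : k 0 = 0.
Proof. by rewrite /k mul0r maxxx. Qed.

Lemma measurable_entropy_potential : measurable_fun setT k.
Proof.
apply: measurable_maxr => //; apply: measurable_funM => //.
apply: measurable_funB; last exact: measurable_powR.
by apply: measurable_funB => //; exact: measurable_ln.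
Qed.

Lemma powR1D x t : 0 <= x -> 0 < t -> x `^ (1 + t) = x * x `^ t.
Proof. by move=> x0 t0; rewrite powRD ?powRr1// (_ : (1 + t == 0) = false)//; lra. Qed.

Variable K' : R.
Hypothesis K'1 : 1 <= K'.
Hypothesis BK' : ln K' + K' `^ delta <= B.

Let K'0 : 0 < K'. Proof. exact: lt_le_trans K'1. Qed.

(** The bracket decreases in [x], and [BK'] makes it nonnegative at [K']. *)
Lemma entropy_potentialE x : 0 <= x <= K' -> k x = x * (B - ln x - x `^ delta).
Proof.
move=> /andP[x0 xK]; apply/max_idPr; apply: mulr_ge0 => //.
have [->|xn] := eqVneq x 0.
  rewrite ln0// powR0 ?gt_eqF//.
  by have := ln_ge0 K'1; have := powR_ge0 K' delta; have := BK'; lra.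
have xp : 0 < x by rewrite lt_def xn.
have : ln x <= ln K' by rewrite ler_ln ?posrE.
have : x `^ delta <= K' `^ delta.
  by apply: ge0_ler_powR => //; rewrite ?nnegrE// ltW.
by have := BK'; lra.
Qed.

Lemma ln_le_powR z : 0 < z -> ln z <= z `^ delta / delta.
Proof.
move=> z0; rewrite ler_pdivlMr// mulrC -ln_powR.
by apply/ltW/ln_sublinear; rewrite powR_gt0.
Qed.

(** The cost of removing the maximum. Above [K'] the bracket is at least
    [- (1 + 1 / delta) z^delta], and a further factor [K'^(- delta) z^delta], at least 1 there,
    makes the error small for large [K'] at the price of a moment of order [1 + 2 delta]. *)
Lemma entropy_potential_le z : 0 <= z ->
  k z <= z * (B - ln z - z `^ delta)
         + (1 + delta^-1) * K' `^ (- delta) * z `^ (1 + 2 * delta).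
Proof.
move=> z0; have d20 : 0 < 2 * delta by rewrite mulr_gt0.
have c0 : 0 <= (1 + delta^-1) * K' `^ (- delta) * z `^ (1 + 2 * delta).
  by rewrite !mulr_ge0 ?powR_ge0// addr_ge0// invr_ge0 ltW.
have [zK|zK] := leP z K'.
  by rewrite entropy_potentialE ?z0// lerDl.
rewrite /k; have [v0|v0] := leP 0 (z * (B - ln z - z `^ delta)).
  by rewrite lerDl.
have zp : 0 < z by exact: lt_trans zK.
have l1 := ln_le_powR zp.
have KB : 0 <= B by have := ln_ge0 K'1; have := powR_ge0 K' delta; have := BK'; lra.
have -> : z `^ (1 + 2 * delta) = z * z `^ delta * z `^ delta.
  rewrite powR1D// -mulrA -powRD ?mulr2n ?mulrDl ?mul1r//.
  by apply/implyP => _; rewrite gt_eqF.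
have Kz : 1 <= K' `^ (- delta) * z `^ delta.
  rewrite powRN -ler_pdivrMl ?invr_gt0 ?powR_gt0// invrK mulr1.
  by apply: ge0_ler_powR; rewrite ?nnegrE// ltW.
set Q := z `^ delta in l1 Kz *; have Q0 : 0 <= Q by exact: powR_ge0.
have di : 0 <= delta^-1 by rewrite invr_ge0 ltW.
have e : (1 + delta^-1) * K' `^ (- delta) * (z * Q * Q) =
  z * ((1 + delta^-1) * Q) * (K' `^ (- delta) * Q) by ring.
have zQ : 0 <= z * ((1 + delta^-1) * Q) by rewrite !mulr_ge0// addr_ge0.
rewrite e; apply: (@le_trans _ _ (z * (B - ln z - Q) + z * ((1 + delta^-1) * Q))); last first.
  by rewrite lerD2l ler_peMr.
by rewrite -mulrDr mulr_ge0//; lra.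
Qed.

(** The preceding bound for an echo [s] of a step [x], sorted by functions of [s] whose means are
    known. The bound [x <= K] brings the truncation error down to the order [x^(1 + delta)], where
    the strict loss can absorb it. *)
Lemma entropy_potentialM_le K x s : 0 < x <= K -> 0 <= s ->
  k (s * x) <= x * (B - ln x) * s - x * (s * ln s)
    - x `^ (1 + delta) * s `^ (1 + delta)
    + (1 + delta^-1) * K' `^ (- delta) * K `^ delta
      * x `^ (1 + delta) * s `^ (1 + 2 * delta).
Proof.
move=> /andP[x0 xK] s0; have d20 : 0 < 2 * delta by rewrite mulr_gt0.
have dn0 : 1 + delta != 0 by rewrite gt_eqF// addr_gt0.
have d2n0 : 1 + 2 * delta != 0 by rewrite gt_eqF// addr_gt0.
have K0 : 0 < K by exact: lt_le_trans xK.
have [->|sn] := eqVneq s 0.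
  by rewrite mul0r entropy_potential0 !(powR0 dn0) !(powR0 d2n0) !(mulr0, mul0r, subr0, addr0).
have sp : 0 < s by rewrite lt_def sn.
apply: (le_trans (entropy_potential_le (mulr_ge0 s0 (ltW x0)))).
rewrite lnM ?posrE// !powRM ?(ltW x0)//; apply: lerD.
  rewrite !powR1D// ?(ltW x0)// le_eqVlt; apply/orP; left; apply/eqP; ring.
have -> : x `^ (1 + 2 * delta) = x `^ delta * x `^ (1 + delta).
  rewrite -powRD; last by apply/implyP => _; rewrite gt_eqF.
  by congr (_ `^ _); ring.
have Kx : x `^ delta <= K `^ delta.
  by apply: ge0_ler_powR; rewrite ?nnegrE// ltW.
set c := _ * K' `^ _; set S := s `^ (1 + 2 * delta); set X := x `^ (1 + delta).
have c0 : 0 <= c by rewrite /c !mulr_ge0 ?powR_ge0// addr_ge0// invr_ge0 ltW.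
have S0 : 0 <= S by exact: powR_ge0.
have X0 : 0 <= X by exact: powR_ge0.
have -> : c * (S * (x `^ delta * X)) = (c * S * X) * x `^ delta by ring.
have -> : c * K `^ delta * X * S = (c * S * X) * K `^ delta by ring.
by apply: ler_wpM2l => //; exact: (mulr_ge0 (mulr_ge0 c0 S0) X0).
Qed.

(** Either [w] is so small that the logarithm makes the bracket exceed [Lam], or [ln w] is bounded
    below and [w^delta] is at least [1 / C]. Bounded potential and small sum of powers thus force a
    small total weight. *)
Lemma entropy_potential_dominates K Lam : 0 < K <= K' -> 0 < Lam ->
  exists2 C, 0 <= C & forall w, 0 <= w <= K -> w <= Lam^-1 * k w + C * w `^ (1 + delta).
Proof.
move=> /andP[K0 KK'] L0.
exists (expR (- (delta * (B - K `^ delta - Lam)))); first exact: expR_ge0.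
move=> w /andP[w0 wK].
have k0 := entropy_potential_ge0 w; have Li : 0 < Lam^-1 by rewrite invr_gt0.
have [->|wn] := eqVneq w 0.
  by rewrite entropy_potential0 mulr0 add0r mulr_ge0 ?expR_ge0 ?powR_ge0.
have wp : 0 < w by rewrite lt_def wn.
have wd : w `^ delta <= K `^ delta.
  by apply: ge0_ler_powR; rewrite ?nnegrE// ltW.
have [lw|lw] := leP (ln w) (B - K `^ delta - Lam).
  apply: (@le_trans _ _ (Lam^-1 * k w)); last first.
    by rewrite lerDl mulr_ge0 ?expR_ge0 ?powR_ge0.
  rewrite mulrC ler_pdivlMr// entropy_potentialE; last by rewrite w0 (le_trans wK).
  by rewrite ler_pM2l//; lra.
apply: (@le_trans _ _ (expR (- (delta * (B - K `^ delta - Lam))) * w `^ (1 + delta))).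
  rewrite powR1D// mulrCA ler_peMr//.
  have -> : w `^ delta = expR (delta * ln w) by rewrite /powR gt_eqF.
  rewrite -expRD -[leLHS]expR0 ler_expR.
  by have := ltW lw; rewrite -(ler_pM2l delta0); lra.
by rewrite lerDr mulr_ge0// ltW.
Qed.

(* One step of the critical recursion, in units where the scale of the tree
   grows by [c^-1]: the drift terms cancel because [m <= l]. *)
Lemma entropy_potential_step K w c N a p m l m' eta :
  0 < w <= K -> K <= K' -> 0 < c <= 1 -> 0 < N -> 0 < p -> 0 < a ->
  a = p * m -> m <= l ->
  c * (1 + a / N) <= 1 -> - ln c <= a / N ->
  1 - a * (1 + delta) / N <= c `^ (1 + delta) ->
  0 <= m' - eta ->
  k (c * w) + p / N * (c * w * (B - ln (c * w)) * m - c * w * l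
                       - (c * w) `^ (1 + delta) * (m' - eta))
  <= k w - (p * (m' - eta) - a * (1 + delta)) / N * w `^ (1 + delta)
     + (a ^+ 2 + p * (m' - eta) * (a * (1 + delta)) * K `^ delta) / N ^+ 2 * w.
Proof.
move=> /andP[w0 wK] KK' /andP[c0 c1] N0 p0 a0 am ml cN lc cd g0.
have cw0 : 0 < c * w by rewrite mulr_gt0.
have cww : c * w <= w by rewrite ger_pMl.
rewrite !entropy_potentialE; last 2 first.
- by rewrite (ltW w0) (le_trans wK).
- by rewrite (ltW cw0) (le_trans cww)// (le_trans wK).
rewrite lnM ?posrE// !powR1D ?(ltW cw0) ?(ltW w0)//.
have b0 : 0 <= B - ln w.
  have : ln w <= ln K' by rewrite ler_ln ?posrE// (le_trans wK).
  by have := powR_ge0 K' delta; have := BK'; lra.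
rewrite powRM ?(ltW c0) ?(ltW w0)//; rewrite powR1D ?(ltW c0)// in cd.
have Wd : 0 <= w `^ delta by exact: powR_ge0.
have WK : w `^ delta <= K `^ delta.
  by apply: ge0_ler_powR; rewrite ?nnegrE ?(ltW w0) ?(ltW delta0)//; lra.
move: (powR_ge0 c delta) cd Wd WK.
set cD := c `^ delta; set W := w `^ delta; set KD := K `^ delta.
set b := B - ln w in b0 *; set L := - ln c in lc *; set g := m' - eta in g0 *.
move=> cD0 cd Wd WK.
set i := N^-1; have i0 : 0 < i by rewrite invr_gt0.
have lnE : - (ln c + ln w) = L - ln w by rewrite opprD.
pose d' := 1 + delta; have d'0 : 0 < d' by rewrite addr_gt0.
rewrite -/d' in cd *.
have Lpl : L * (1 + a * i) - p * i * l <= a ^+ 2 * i ^+ 2.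
  have h1 : L * (1 + a * i) <= a * i * (1 + a * i).
    by apply: ler_wpM2r => //; rewrite addr_ge0// mulr_ge0 ?ltW.
  have h2 : p * i * m <= p * i * l by apply: ler_wpM2l => //; rewrite mulr_ge0 ?ltW.
  rewrite mulrAC -am in h2.
  have e : a * i * (1 + a * i) - a * i = a ^+ 2 * i ^+ 2 by ring.
  by lra.
have T2 : c * (L * (1 + a * i) - p * i * l) <= a ^+ 2 * i ^+ 2.
  apply: (le_trans (ler_wpM2l (ltW c0) Lpl)).
  by rewrite ler_piMl// mulr_ge0// sqr_ge0.
have T1 : c * (1 + a * i) * b <= b by rewrite ler_piMl.
have pgi : 0 <= 1 + p * g * i by apply: addr_ge0 => //; apply: mulr_ge0; [apply: mulr_ge0 => //|]; exact: ltW.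
have T3 : W * ((1 - a * d' * i) * (1 + p * g * i)) <= W * (c * cD * (1 + p * g * i)).
  by apply: ler_wpM2l => //; exact: ler_wpM2r.
(* This is the second-order cross term from expanding [T3]; [w^delta <= K^delta] puts it in the
   multiple of [w] of the conclusion. *)
have T4 : p * g * (a * d') * i ^+ 2 * W <= p * g * (a * d') * i ^+ 2 * KD.
  apply: ler_wpM2l => //; apply: mulr_ge0; last exact: sqr_ge0.
  by apply: mulr_ge0; apply: mulr_ge0 => //; exact: ltW.
have Nexp : N ^- 2 = i ^+ 2 by rewrite /i exprVn.
rewrite Nexp.
have -> : c * w * (B - (ln c + ln w) - cD * W) +
    p * i * (c * w * (B - (ln c + ln w)) * m - c * w * l - c * w * (cD * W) * g) =
  w * (c * (1 + p * m * i) * b + c * (L * (1 + p * m * i) - p * i * l)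
       - W * (c * cD * (1 + p * g * i))) by rewrite /b /L; ring.
rewrite -am.
have -> : w * (B - ln w - W) - (p * g - a * d') * i * (w * W) +
    (a ^+ 2 + p * g * (a * d') * KD) * i ^+ 2 * w =
  w * (b - W - (p * g - a * d') * i * W + (a ^+ 2 * i ^+ 2 + p * g * (a * d') * i ^+ 2 * KD)).
  by rewrite /b; ring.
rewrite ler_pM2l//.
have e3 : W * ((1 - a * d' * i) * (1 + p * g * i)) =
  W + (p * g - a * d') * i * W - p * g * (a * d') * i ^+ 2 * W by ring.
rewrite e3 in T3; lra.
Qed.

End entropy_potential.

(** * Driving variables and nonnegative walks *)

Section preliminaries.
Context {d : measure_display} {T : measurableType d} {R : realType}.

Lemma measurable_natr_bool {d'} {S : measurableType d'} (f : S -> bool) :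
  measurable_fun setT f -> measurable_fun setT (fun w => (f w)%:R : R).
Proof. by move=> mf; exact: (measurableT_comp (f := fun b : bool => b%:R : R)). Qed.

Lemma integral_same_law {d'} {S : measurableType d'} (P : probability T R)
    (Y Z : {mfun T >-> S}) (g : S -> \bar R) :
  same_law P Y Z -> measurable_fun setT g -> (forall s, 0 <= g s)%E ->
  (\int[P]_w g (Y w) = \int[P]_w g (Z w))%E.
Proof.
move=> YZ mg g0.
have e (V : {mfun T >-> S}) : (\int[P]_w g (V w) = \int[distribution P V]_s g s)%E.
  by rewrite ge0_integral_pushforward.
by rewrite !e; apply: eq_measure_integral => A mA _; exact: YZ.
Qed.

End preliminaries.

Section driven_processes.
Context {d : measure_display} {T : measurableType d} {R : realType}.
Variables (P : probability T R) (p : R) (X xi : {RV P >-> R}).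
Variables (Xs : nat -> {RV P >-> R}) (eps : nat -> {RV P >-> bool})
  (U : nat -> {RV P >-> nat}) (xis : nat -> {RV P >-> R}).
Hypothesis driven : rwes_driven Xs eps U xis p X xi.

Local Notation dsigma := (driving_sigma Xs eps U xis).
Definition known (D : set driving_index) : set (set T) := generated dsigma D.
Local Notation mfun_known D f :=
  (measurable_fun (setT : set (g_sigma_algebraType (known D))) f).

Let sigma_of_measurable {d'} {S : measurableType d'} (Y : {RV P >-> S}) :
  sigma_of Y `<=` measurable.
Proof. by move=> _ [B mB <-]; rewrite setTI; exact: measurable_funPTI. Qed.

Let sigma_ofI {d'} {S : measurableType d'} (Y : {RV P >-> S}) :
  setI_closed (sigma_of Y).
Proof.
move=> _ _ [A mA <-] [B mB <-]; exists (A `&` B); first exact: measurableI.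
by rewrite !setTI preimage_setI.
Qed.

Let sigma_ofT {d'} {S : measurableType d'} (Y : {RV P >-> S}) : sigma_of Y setT.
Proof. by exists setT => //; rewrite setTI preimage_setT. Qed.

Let mdsigma i : dsigma i `<=` measurable.
Proof. by case: i => -[] n; exact: sigma_of_measurable. Qed.

Let dsigmaI i : setI_closed (dsigma i).
Proof. by case: i => -[] n; exact: sigma_ofI. Qed.

Let dsigmaT i : dsigma i setT.
Proof. by case: i => -[] n; exact: sigma_ofT. Qed.

Lemma known_measurable D : <<s known D >> `<=` measurable.
Proof. exact: generated_measurable. Qed.

Lemma known_independent D D' : D `<=` driving_dom -> D' `<=` driving_dom ->
  [disjoint D & D'] -> independent2 P <<s known D >> <<s known D' >>.
Proof. by apply: independent_generated2 => //; exact: driving_indep driven. Qed.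

Lemma known_sub D D' : D `<=` D' -> <<s known D >> `<=` <<s known D' >>.
Proof.
move=> DD; apply: smallest_sub; first exact: smallest_sigma_algebra.
by move=> A [i Di iA]; apply: sub_sigma_algebra; exists i => //; exact: DD.
Qed.

Lemma mfun_knownS {d'} {S : measurableType d'} D D' (f : T -> S) :
  D `<=` D' -> mfun_known D f -> mfun_known D' f.
Proof. by move=> DD mf _ B mB; apply: (known_sub DD); exact: mf. Qed.

Lemma mfun_known_measurable {d'} {S : measurableType d'} D (f : T -> S) :
  mfun_known D f -> measurable_fun (setT : set T) f.
Proof. by move=> mf _ B mB; apply: (@known_measurable D); exact: mf. Qed.

Lemma mfun_known_sigma {d'} {S : measurableType d'} D i (Y : T -> S) :
  D i -> sigma_of Y `<=` dsigma i -> mfun_known D Y.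
Proof.
move=> Di Yi _ B mB; apply: sub_sigma_algebra; exists i => //; apply: Yi.
by exists B.
Qed.

Lemma mfun_known_X D n : D (inl (inl n)) -> mfun_known D (Xs n).
Proof. by move=> Dn; exact: mfun_known_sigma Dn _. Qed.

Lemma mfun_known_eps D n : D (inl (inr n)) -> mfun_known D (eps n).
Proof. by move=> Dn; exact: mfun_known_sigma Dn _. Qed.

Lemma mfun_known_U D n : D (inr (inl n)) -> mfun_known D (U n).
Proof. by move=> Dn; exact: mfun_known_sigma Dn _. Qed.

Lemma mfun_known_xi D n : D (inr (inr n)) -> mfun_known D (xis n).
Proof. by move=> Dn; exact: mfun_known_sigma Dn _. Qed.

Lemma known_independent1 {d'} {S : measurableType d'} D i (Y : T -> S) :
  D `<=` driving_dom -> driving_dom i -> ~ D i -> sigma_of Y `<=` dsigma i ->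
  independent2 P <<s known D >> (sigma_of Y).
Proof.
move=> DD di Di Yi A B sA sB.
apply: (@known_independent D [set i]) => //.
- by move=> _ ->.
- by apply/disj_setPS => j [Dj /= ji]; apply: Di; rewrite -ji.
- by apply: sub_sigma_algebra; exists i => //; exact: Yi.
Qed.

(** Together with [parent], versions of the driving variables that are admissible at every point and
    almost surely equal to the given ones, so that the algebra of the recursion needs no exceptional
    set. *)
Definition echo n (w : T) : R := `|xis n w|.
Definition parent n (w : T) : nat :=
  if (1 <= U n w < n)%N then U n w else 1%N.

Lemma parentP w n : (2 <= n)%N -> (1 <= parent n w < n)%N.
Proof. by rewrite /parent; case: ifPn => //; rewrite leqnn. Qed.

Lemma echo0 n w : 0 <= echo n w. Proof. exact: normr_ge0. Qed.

Definition label (i : driving_index) : nat :=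
  match i with inl (inl n) | inl (inr n) | inr (inl n) | inr (inr n) => n end.

Definition past n : set driving_index :=
  [set i | driving_dom i /\ (label i <= n)%N].

Lemma past_dom n : past n `<=` driving_dom. Proof. by move=> i []. Qed.

Lemma past_sub m n : (m <= n)%N -> past m `<=` past n.
Proof. by move=> mn i [di li]; split => //; exact: leq_trans mn. Qed.

Lemma mfun_known_echo D n : D (inr (inr n)) -> mfun_known D (echo n).
Proof. by move=> Dn; apply: measurableT_comp => //; exact: mfun_known_xi. Qed.

Lemma mfun_known_parent D n : D (inr (inl n)) -> mfun_known D (parent n).
Proof.
move=> Dn; have := @mfun_known_U D n Dn.
by move/(measurableT_comp (f := fun k => if (1 <= k < n)%N then k else 1%N)); exact.
Qed.

Section spins.
Variable f : nat -> R -> R.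
Hypothesis mf : forall n, measurable_fun setT (f n).
Hypothesis f0 : forall n x, 0 <= f n x.

(** The function may depend on the time in order to cover the positive and negative parts of the
    spins, the spins after a given time, and the deterministic spin of a single tree. *)
Definition spin n (w : T) : R := f n (Xs n w).
Definition step n (w : T) : R :=
  echoed (spin ^~ w) (eps ^~ w) (parent ^~ w) (echo ^~ w) n.
Definition walk n (w : T) : R :=
  echoed_sum (spin ^~ w) (eps ^~ w) (parent ^~ w) (echo ^~ w) n.

Lemma walkE n w : walk n w = \sum_(1 <= i < n.+1) step i w. Proof. by []. Qed.

Lemma spin_ge0 n w : 0 <= spin n w. Proof. exact: f0. Qed.

Lemma step_ge0 n w : 0 <= step n w.
Proof.
by apply: echoed_ge0; [exact: parentP|move=> k; exact: f0|move=> k; exact: echo0].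
Qed.

Lemma walk_ge0 n w : 0 <= walk n w.
Proof. by apply: sumr_ge0 => i _; exact: step_ge0. Qed.

Lemma walkS n w : walk n.+1 w = walk n w + step n.+1 w.
Proof. exact: echoed_sumS. Qed.

(** Disjoint cases: a deleted edge, or a kept edge to each possible parent. The function [phi] is
    general because powers and the entropy potential are both used. *)
Lemma stepE (phi : R -> R) n w : (1 <= n)%N ->
  phi (step n.+1 w) = (~~ eps n.+1 w)%:R * phi (spin n.+1 w)
    + \sum_(1 <= k < n.+1) (eps n.+1 w)%:R * ((parent n.+1 w == k)%:R
        * phi (echo n.+1 w * step k w)).
Proof.
move=> n1; have uP := @parentP w.
rewrite /step echoedE//; case: (eps n.+1 w) => /=.
  rewrite subrr !mul0r !add0r mul1r; under eq_bigr do rewrite mul1r.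
  have /andP[p1 pn] := uP n.+1 n1.
  rewrite (bigD1_seq (parent n.+1 w))/= ?iota_uniq ?mem_index_iota ?p1//.
  by rewrite eqxx mul1r big1 ?addr0// => i; rewrite eq_sym => /negbTE ->; rewrite mul0r.
rewrite subr0 !mul1r !mul0r addr0 big1 ?addr0// => i _; by rewrite mul0r.
Qed.

Lemma mfun_known_spin D n : D (inl (inl n)) -> mfun_known D (spin n).
Proof. by move=> Dn; apply: measurableT_comp => //; exact: mfun_known_X. Qed.

Lemma mfun_known_eqparent D n k : D (inr (inl n)) ->
  mfun_known D (fun w => (parent n w == k)%:R : R).
Proof.
move=> Dn; apply: measurable_natr_bool.
exact: (measurableT_comp (f := fun j => j == k) _ (mfun_known_parent Dn)).
Qed.

Lemma mfun_known_step n : (1 <= n)%N -> mfun_known (past n) (step n).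
Proof.
elim/ltn_ind: n => -[//|[|n]] IH _.
  by apply: (@mfun_known_spin (past 1) 1); split.
rewrite [step _](_ : _ = fun w => (~~ eps n.+2 w)%:R * spin n.+2 w
    + \sum_(1 <= k < n.+2) (eps n.+2 w)%:R * ((parent n.+2 w == k)%:R
        * (echo n.+2 w * step k w))); last first.
  by apply/funext => w; rewrite (stepE id).
have me := @mfun_known_eps (past n.+2) n.+2 (conj isT (leqnn _)).
apply: measurable_funD.
  apply: measurable_funM; last by apply: mfun_known_spin; split.
  apply: measurable_natr_bool; exact: (measurableT_comp (f := negb)).
rewrite (_ : (fun _ => _) = (fun w => \sum_(k <- index_iota 1 n.+2)
  if (1 <= k < n.+2)%N then (eps n.+2 w)%:R * ((parent n.+2 w == k)%:R
        * (echo n.+2 w * step k w)) else 0)); last first.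
  by apply/funext => w; rewrite big_nat_cond [RHS]big_nat_cond; apply: eq_bigr => i; rewrite andbT => ->.
apply: measurable_sum => k; have [/andP[k1 kn]|_] := boolP (1 <= k < n.+2)%N; last exact: measurable_cst.
apply: measurable_funM; first exact: measurable_natr_bool.
apply: measurable_funM; first by apply: mfun_known_eqparent; split.
apply: measurable_funM; first by apply: mfun_known_echo; split.
by apply: mfun_knownS (IH k kn k1); apply: past_sub; exact: ltnW.
Qed.

Lemma mfun_known_walk n : mfun_known (past n) (walk n).
Proof.
elim: n => [|n IH].
  rewrite [walk _](_ : _ = cst 0); first exact: measurable_cst.
  by apply/funext => w; rewrite /walk /echoed_sum big_geq.
rewrite [walk _](_ : _ = fun w => walk n w + step n.+1 w); last first.
  by apply/funext => w; exact: walkS.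
apply: measurable_funD; last exact: mfun_known_step.
by apply: mfun_knownS IH; exact: past_sub.
Qed.

Lemma measurable_step n : (1 <= n)%N -> measurable_fun (setT : set T) (step n).
Proof. by move=> n1; exact: mfun_known_measurable (mfun_known_step n1). Qed.

Lemma measurable_walk n : measurable_fun (setT : set T) (walk n).
Proof. exact: mfun_known_measurable (@mfun_known_walk n). Qed.

End spins.

End driven_processes.

(** * The one-step identity *)

Section sums.
Context {d : measure_display} {T : measurableType d} {R : realType}.
Implicit Types (B : nat -> T -> R) (m n : nat).

Lemma measurable_sum_nat B m n :
  (forall k, (m <= k < n)%N -> measurable_fun setT (B k)) ->
  measurable_fun setT (fun w => \sum_(m <= k < n) B k w).
Proof.
move=> mB; rewrite (_ : (fun _ => _) = fun w =>
    \sum_(k <- index_iota m n) if (m <= k < n)%N then B k w else 0).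
  apply: measurable_sum => k.
  by have [/mB//|_] := boolP (m <= k < n)%N; exact: measurable_cst.
apply/funext => w; rewrite big_nat_cond [RHS]big_nat_cond.
by apply: eq_bigr => i; rewrite andbT => ->.
Qed.

Lemma ge0_integral_sum_nat (P : probability T R) B m n :
  (forall k, (m <= k < n)%N -> measurable_fun setT (B k)) ->
  (forall k w, 0 <= B k w) ->
  (\int[P]_w (\sum_(m <= k < n) B k w)%:E
   = \sum_(m <= k < n) \int[P]_w (B k w)%:E)%E.
Proof.
move=> + B0; have [mn|/ltnW mn] := leqP n m.
  by move=> _; rewrite big_geq//; under eq_integral do rewrite big_geq//; rewrite integral0.
move: mn; elim: n => [|n IH] mn mB.
  move: mn; rewrite leqn0 => /eqP ->.
  by rewrite big_geq//; under eq_integral do rewrite big_geq//; rewrite integral0.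
move: mn; rewrite leq_eqVlt => /predU1P[->|mn].
  by rewrite big_geq//; under eq_integral do rewrite big_geq//; rewrite integral0.
have mB' k : (m <= k < n)%N -> measurable_fun setT (B k).
  by move=> /andP[mk kn]; apply: mB; rewrite mk ltnW.
rewrite big_nat_recr//= -IH//; under eq_integral do rewrite big_nat_recr//= EFinD.
rewrite ge0_integralD//.
- by move=> w _; rewrite lee_fin sumr_ge0.
- exact/measurable_EFinP/measurable_sum_nat.
- by move=> w _; rewrite lee_fin.
- by apply/measurable_EFinP; apply: mB; rewrite leqnn andbT.
Qed.

End sums.

Section one_step.
Context {d : measure_display} {T : measurableType d} {R : realType}.
Variables (P : probability T R) (p : R) (X xi : {RV P >-> R}).
Variables (Xs : nat -> {RV P >-> R}) (eps : nat -> {RV P >-> bool})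
  (U : nat -> {RV P >-> nat}) (xis : nat -> {RV P >-> R}).
Hypothesis p01 : 0 < p < 1.
Hypothesis driven : rwes_driven Xs eps U xis p X xi.

Local Notation known := (known Xs eps U xis).
Local Notation mfun_known D f :=
  (measurable_fun (setT : set (g_sigma_algebraType (known D))) f).

Lemma integral_memory (g : bool -> R) n : (2 <= n)%N -> (forall b, 0 <= g b) ->
  (\int[P]_w (g (eps n w))%:E = (p * g true + (1 - p) * g false)%:E)%E.
Proof.
move=> n2 g0.
have mg : measurable_fun setT (EFin \o g) by [].
have ge0 b : (0 <= (EFin \o g) b)%E by rewrite lee_fin.
transitivity (\int[distribution P (eps n)]_b (EFin \o g) b)%E.
  by rewrite ge0_integral_pushforward.
rewrite (eq_measure_integral (bernoulli_prob p)); last first.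
  by move=> A mA _; exact: memory_law driven _ n2 _ mA.
by rewrite integral_bernoulli_prob//; case/andP : p01 => p0 p1; apply/andP; split; lra.
Qed.

(** The [n - 1] admissible values have mass [1 / (n - 1)] each, which exhausts the total mass. *)
Lemma ae_parent_bounds n : (2 <= n)%N -> {ae P, forall w, (1 <= U n w < n)%N}.
Proof.
move=> n2; pose A := [set w | (1 <= U n w < n)%N].
have mUk B : measurable (U n @^-1` B) by exact: measurable_funPTI.
have mA : measurable A by exact: (mUk [set k | (1 <= k < n)%N]).
have PA1 : P A = 1%E.
  have -> : P A = (\int[P]_w (\sum_(1 <= k < n) ((U n w == k)%:R)%:E))%E.
    transitivity (P (A `&` setT)); first by rewrite setIT.
    rewrite -integral_indic//; apply: eq_integral => w _.
    rewrite sumEFin indicE; congr (_%:E).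
    have [h|h] := boolP (1 <= U n w < n)%N.
      rewrite (bigD1_seq (U n w))/= ?iota_uniq ?mem_index_iota//.
      rewrite eqxx big1 ?addr0; first by rewrite mem_set.
      by move=> i; rewrite eq_sym => /negbTE ->.
    rewrite memNset; last exact/negP.
    rewrite big_nat big1// => i ih; case: eqP => // Ui.
    by move: h; rewrite Ui ih.
  rewrite ge0_integral_sum//; last first.
    move=> k; apply/measurable_EFinP/measurable_natr_bool.
    exact: (measurableT_comp (f := fun j => j == k)).
  rewrite (@eq_big_nat _ _ _ 1 n _ (fun=> (n.-1%:R^-1)%:E)); last first.
    move=> k kn; rewrite -(parent_law driven n2 kn).
    transitivity (P ([set w | U n w = k] `&` setT)); last by rewrite setIT.
    rewrite -integral_indic//; last exact: (mUk [set k]).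
    apply: eq_integral => w _; rewrite indicE.
    by case: eqP => h; [rewrite mem_set|rewrite memNset].
  transitivity ((\sum_(1 <= k < n) n.-1%:R^-1 : R)%:E); first by rewrite -sumEFin.
  rewrite sumr_const_nat subn1 -[X in X *+ _]mulr1 -mulrnAr.
  by rewrite mulVf// pnatr_eq0; case: n n2 {mUk mA A} => [|[]].
apply/negligibleP; first by apply: measurableC.
have PAC : P (~` A) = 0%E by rewrite probability_setC// PA1 subee.
exact: PAC.
Qed.

Lemma ae_driving_regular : {ae P, forall w, 0 <= xi w} ->
  {ae P, forall w, forall n, (2 <= n)%N ->
    U n w = parent U n w /\ xis n w = echo xis n w}.
Proof.
move=> xi0; apply: ae_forall_countable => n.
have [n2|n1] := leqP 2 n; last exact: aeW.
have xin0 : {ae P, forall w, 0 <= xis n w}.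
  have mN (Y : {RV P >-> R}) : measurable [set w | Y w < 0].
    by rewrite [X in measurable X](_ : _ = Y @^-1` `]-oo, 0[%classic)//;
       apply: measurable_funPTI.
  have aeN (Y : {RV P >-> R}) : {ae P, forall w, 0 <= Y w} <-> P [set w | Y w < 0] = 0%E.
    have e : [set w | Y w < 0] = ~` [set w | 0 <= Y w].
      by apply/seteqP; split => w /=; [rewrite ltNge => /negP|move/negP; rewrite -ltNge].
    have mC : measurable (~` [set w | 0 <= Y w]) by rewrite -e.
    by rewrite e; split => h; exact/(negligibleP _ mC).
  apply/aeN; move/aeN : xi0 => <-.
  by have := echo_law driven n2 (measurable_itv `]-oo, 0[); rewrite /distribution/pushforward/=.
apply: filterS2 (ae_parent_bounds n2) xin0 => w Un xn _.
by rewrite /parent Un /echo ger0_norm.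
Qed.
Lemma integral_eq_parent n k : (1 <= k < n.+1)%N ->
  (\int[P]_w ((parent U n.+1 w == k)%:R)%:E = (n%:R^-1)%:E)%E.
Proof.
move=> kn; have n1 : (2 <= n.+1)%N by case/andP : kn => k1; exact: leq_trans.
have mUk : measurable [set w | U n.+1 w = k].
  exact: (@measurable_funPTI _ _ _ _ (U n.+1) [set k]).
transitivity (\int[P]_w ((U n.+1 w == k)%:R)%:E)%E.
  apply: ae_eq_integral => //.
  - apply/measurable_EFinP/measurable_natr_bool.
    apply: (measurableT_comp (f := fun j => j == k)) => //.
    exact: (measurableT_comp (f := fun j => if (1 <= j < n.+1)%N then j else 1%N)).
  - apply/measurable_EFinP/measurable_natr_bool.
    exact: (measurableT_comp (f := fun j => j == k)).
  - by apply: filterS (ae_parent_bounds n1) => w Un _; rewrite /parent Un.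
rewrite -(parent_law driven n1 kn).
transitivity (P ([set w | U n.+1 w = k] `&` setT)); last by rewrite setIT.
rewrite -integral_indic//; apply: eq_integral => w _; rewrite indicE.
by case: eqP => h; [rewrite mem_set|rewrite memNset].
Qed.

Lemma integralM_known {d'} {S : measurableType d'} D i (Y : {RV P >-> S})
    (h : T -> R) (g : S -> R) :
  D `<=` driving_dom -> driving_dom i -> ~ D i ->
  sigma_of Y `<=` driving_sigma Xs eps U xis i ->
  mfun_known D h -> measurable_fun setT g ->
  (forall w, 0 <= h w) -> (forall x, 0 <= g x) ->
  (\int[P]_w (h w * g (Y w))%:E
   = (\int[P]_w (h w)%:E) * (\int[P]_w (g (Y w))%:E))%E.
Proof.
move=> DD di Di Yi mh mg h0 g0.
have mY : measurable_fun setT Y by [].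
have ind : independent2 P <<s known D >> (sigma_of Y).
  exact: (known_independent1 driven DD di Di Yi).
exact: (integralM_independent (@known_measurable _ _ _ _ _ _ _ _ _) mY ind).
Qed.

Section spins.
Variable f : nat -> R -> R.
Hypothesis mf : forall n, measurable_fun setT (f n).
Hypothesis f0 : forall n x, 0 <= f n x.

Local Notation spin := (spin Xs f).
Local Notation step := (step Xs eps U xis f).
Local Notation walk := (walk Xs eps U xis f).
Local Notation echo := (echo xis).
Local Notation parent := (parent U).

(** The conditional law of the next step given the past, tested against [H]: a fresh spin with
    probability [1 - p], and with probability [p / n] for each earlier step, that step times an
    independent echo. The inner integral averages over the echo. *)
Theorem integral_one_step (phi : R -> R) (H : T -> R) n : (1 <= n)%N ->
  measurable_fun setT phi -> (forall x, 0 <= phi x) ->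
  mfun_known (past n) H -> (forall w, 0 <= H w) ->
  (\int[P]_w (H w * phi (step n.+1 w))%:E =
   (1 - p)%:E * \int[P]_w (phi (spin n.+1 w))%:E * \int[P]_w (H w)%:E
   + (p / n%:R)%:E * \sum_(1 <= k < n.+1)
       \int[P]_w ((H w)%:E * \int[P]_w' (phi (`|xi w'| * step k w))%:E))%E.
Proof.
move=> n1 mphi phi0 mH H0.
have n2 : (2 <= n.+1)%N by [].
have notpast i : label i = n.+1 -> ~ past n i by move=> li [_]; rewrite li ltnn.
have mHT := mfun_known_measurable mH.
have mspin : measurable_fun setT (spin n.+1) by exact: measurableT_comp.
have meps (g : bool -> R) : measurable_fun setT (fun w => g (eps n.+1 w)).
  exact: (measurableT_comp (f := g)).
have mecho : measurable_fun setT (echo n.+1) by exact: measurableT_comp.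
have meqp k : measurable_fun setT (fun w => (parent n.+1 w == k)%:R : R).
  apply: measurable_natr_bool.
  apply: (measurableT_comp (f := fun j => j == k)) => //.
  exact: (measurableT_comp (f := fun j => if (1 <= j < n.+1)%N then j else 1%N)).
have mstep k : (1 <= k < n.+1)%N -> mfun_known (past n) (step k).
  move=> /andP[k1 kn]; apply: mfun_knownS (mfun_known_step _ k1) => //.
  by apply: past_sub; rewrite -ltnS.
pose A w := H w * phi (spin n.+1 w) * (~~ eps n.+1 w)%:R.
pose B k w := H w * phi (echo n.+1 w * step k w) * (parent n.+1 w == k)%:R
               * (eps n.+1 w)%:R.
have A0 w : 0 <= A w by rewrite /A !mulr_ge0.
have B0 k w : 0 <= B k w by rewrite /B !mulr_ge0.
have mA : measurable_fun setT A.
  apply: measurable_funM; last exact: (meps (fun b => (~~ b)%:R)).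
  by apply: measurable_funM => //; exact: measurableT_comp.
have mB k : (1 <= k < n.+1)%N -> measurable_fun setT (B k).
  move=> kn; apply: measurable_funM; last exact: (meps (fun b => b%:R)).
  apply: measurable_funM => //; apply: measurable_funM => //.
  apply: measurableT_comp => //; apply: measurable_funM => //.
  exact: mfun_known_measurable (mstep k kn).
have -> : (\int[P]_w (H w * phi (step n.+1 w))%:E =
    \int[P]_w ((A w)%:E + (\sum_(1 <= k < n.+1) B k w)%:E))%E.
  apply: eq_integral => w _; rewrite -EFinD stepE// mulrDr mulr_sumr.
  congr (_%:E); congr (_ + _); first by rewrite /A; ring.
  by apply: eq_bigr => k _; rewrite /B; ring.
rewrite ge0_integralD//; first last.
- exact/measurable_EFinP/measurable_sum_nat.
- by move=> w _; rewrite lee_fin sumr_ge0.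
- exact/measurable_EFinP.
- by move=> w _; rewrite lee_fin.
congr (_ + _)%E.
  (* The variables of time [n.+1] are integrated out one at a time; the index set lists what the
     remaining factor still depends on. *)
  rewrite /A (@integralM_known _ _ (past n `|` [set inl (inl n.+1)])
    (inl (inr n.+1)) (eps n.+1) (fun w => H w * phi (spin n.+1 w))
    (fun b => (~~ b)%:R))//.
  - rewrite (integral_memory (g := fun b => (~~ b)%:R))//= mulr0 mulr1 add0r.
    rewrite [LHS]muleC -[RHS]muleA; congr (_ * _)%E.
    rewrite (@integralM_known _ _ (past n) (inl (inl n.+1)) (Xs n.+1) H
      (phi \o f n.+1))//.
    + by rewrite [LHS]muleC.
    + exact: past_dom.
    + exact: notpast.
    + exact: measurableT_comp.
    + by move=> x; exact: phi0.
  - by move=> i [/past_dom//|->].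
  - by case=> [|//]; exact: notpast.
  - apply: measurable_funM; first by apply: mfun_knownS mH => i; left.
    by apply: measurableT_comp => //; apply: mfun_known_spin => //; right.
  - by move=> w; rewrite mulr_ge0.
rewrite ge0_integral_sum_nat// ge0_sume_distrr; last first.
  by move=> k _; apply: integral_ge0 => w _; rewrite mule_ge0 ?lee_fin//;
     apply: integral_ge0 => w' _; rewrite lee_fin.
apply: eq_big_nat => k kn.
rewrite /B (@integralM_known _ _ (past n `|` [set inr (inl n.+1); inr (inr n.+1)])
    (inl (inr n.+1)) (eps n.+1)
    (fun w => H w * phi (echo n.+1 w * step k w) * (parent n.+1 w == k)%:R)
    (fun b => b%:R))//; first last.
- by move=> w; rewrite !mulr_ge0.
- apply: measurable_funM; last by apply: mfun_known_eqparent => //; right; left.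
  apply: measurable_funM; first by apply: mfun_knownS mH => i; left.
  apply: measurableT_comp => //; apply: measurable_funM.
    by apply: mfun_known_echo; right; right.
  by apply: mfun_knownS (mstep k kn) => i; left.
- by case=> [|[]//]; exact: notpast.
- by move=> i [/past_dom//|[|]->].
rewrite (integral_memory (g := fun b => b%:R))//= mulr0 mulr1 addr0.
rewrite (@integralM_known _ _ (past n `|` [set inr (inr n.+1)])
    (inr (inl n.+1)) (U n.+1) (fun w => H w * phi (echo n.+1 w * step k w))
    (fun j => ((if (1 <= j < n.+1)%N then j else 1%N) == k)%:R))//; first last.
- by move=> w; rewrite !mulr_ge0.
- apply: measurable_funM; first by apply: mfun_knownS mH => i; left.
  apply: measurableT_comp => //; apply: measurable_funM.
    by apply: mfun_known_echo; right.
  by apply: mfun_knownS (mstep k kn) => i; left.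
- by case=> [|//]; exact: notpast.
- by move=> i [/past_dom//|->].
rewrite integral_eq_parent// -[LHS]muleA -EFinM [LHS]muleC [n%:R^-1 * p]mulrC.
congr (_ * _)%E.
(* Echo and past are mixed inside [phi], so the integral does not factor; the past is frozen
   instead. *)
pose Phi (z : g_sigma_algebraType (known (past n)) * R) :=
  (H z.1 * phi (`|z.2| * step k z.1))%:E.
have mPhi : measurable_fun setT Phi.
  apply/measurable_EFinP; apply: measurable_funM; first exact: (measurableT_comp mH).
  apply: measurableT_comp => //; apply: measurable_funM.
    exact: measurableT_comp.
  exact: (measurableT_comp (mstep k kn)).
have Phi0 z : (0 <= Phi z)%E by rewrite lee_fin mulr_ge0.
have mxi : measurable_fun setT (xis n.+1) by [].
have ind : independent2 P <<s known (past n) >> (sigma_of (xis n.+1)).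
  by apply: (known_independent1 driven (i := inr (inr n.+1))) => //;
      [exact: past_dom|exact: notpast].
rewrite (integral_freezing (@known_measurable _ _ _ _ _ _ _ _ _) mxi ind mPhi Phi0).
apply: eq_integral => w _.
have mphik : measurable_fun setT (fun x : R => (phi (`|x| * step k w))%:E).
  apply/measurable_EFinP; apply: measurableT_comp => //.
  by apply: measurable_funM => //; exact: measurable_cst.
transitivity (\int[P]_w' ((H w)%:E * (phi (`|xis n.+1 w'| * step k w))%:E))%E.
  by apply: eq_integral => w' _; rewrite /Phi EFinM.
rewrite ge0_integralZl//.
- congr (_ * _)%E.
  rewrite (@integral_same_law _ _ _ _ _ P (xis n.+1) xi
    (fun x : R => (phi (`|x| * step k w))%:E))//.
  + exact: echo_law driven _ n2.
  + by move=> x; rewrite lee_fin.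
- exact: (measurableT_comp mphik).
- by move=> *; rewrite lee_fin.
- by rewrite lee_fin.
Qed.

End spins.
End one_step.

(** * Sums of powers of the steps *)

Section moments.
Context {d : measure_display} {T : measurableType d} {R : realType}.
Variables (P : probability T R) (p : R) (X xi : {RV P >-> R}).
Variables (Xs : nat -> {RV P >-> R}) (eps : nat -> {RV P >-> bool})
  (U : nat -> {RV P >-> nat}) (xis : nat -> {RV P >-> R}).
Hypothesis p01 : 0 < p < 1.
Hypothesis driven : rwes_driven Xs eps U xis p X xi.
Variable f : nat -> R -> R.
Hypothesis mf : forall n, measurable_fun setT (f n).
Hypothesis f0 : forall n x, 0 <= f n x.

Local Notation known := (known Xs eps U xis).
Local Notation mfun_known D f :=
  (measurable_fun (setT : set (g_sigma_algebraType (known D))) f).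
Local Notation spin := (spin Xs f).
Local Notation step := (step Xs eps U xis f).
Local Notation walk := (walk Xs eps U xis f).

Definition powsum (g : R) n w : R := \sum_(1 <= k < n.+1) step k w `^ g.

Lemma powsum_ge0 g n w : 0 <= powsum g n w.
Proof. by apply: sumr_ge0 => k _; exact: powR_ge0. Qed.

Lemma powsum1 n w : powsum 1 n w = walk n w.
Proof. by apply: eq_bigr => k _; rewrite powRr1// step_ge0. Qed.

Lemma powsumS g n w : powsum g n.+1 w = powsum g n w + step n.+1 w `^ g.
Proof. by rewrite /powsum big_nat_recr. Qed.

Lemma mfun_known_powsum g n : mfun_known (past n) (powsum g n).
Proof.
apply: measurable_sum_nat => k /andP[k1 kn].
apply: (measurableT_comp (measurable_powR g)).
by apply: mfun_knownS (mfun_known_step mf k1); exact: past_sub.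
Qed.

Lemma measurable_powsum g n : measurable_fun setT (powsum g n).
Proof. exact: mfun_known_measurable (@mfun_known_powsum g n). Qed.

Section exponent.
Variables (g mg : R).
Hypothesis g0 : 0 < g.
Hypothesis xi_g : (\int[P]_w (`|xi w| `^ g)%:E = mg%:E)%E.

Lemma echo_moment_ge0 : 0 <= mg.
Proof.
by rewrite -lee_fin -xi_g; apply: integral_ge0 => w _; rewrite lee_fin powR_ge0.
Qed.

(** For a power the echo factors out of [phi], and the sum over parents closes up into the same
    power sum: this is why power sums satisfy an exact linear recursion. *)
Lemma integral_step_powR (H : T -> R) n : (1 <= n)%N ->
  mfun_known (past n) H -> (forall w, 0 <= H w) ->
  (\int[P]_w (H w * step n.+1 w `^ g)%:E =
   (1 - p)%:E * \int[P]_w (spin n.+1 w `^ g)%:E * \int[P]_w (H w)%:E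
   + (p * mg / n%:R)%:E * \int[P]_w (H w * powsum g n w)%:E)%E.
Proof.
move=> n1 mH H0; have mg0 := echo_moment_ge0.
have mphi : measurable_fun setT (fun x : R => `|x| `^ g).
  exact: (measurableT_comp (measurable_powR g)).
have mHT := mfun_known_measurable mH.
have := @integral_one_step _ _ _ P p X xi Xs eps U xis p01 driven f mf
  (fun x => `|x| `^ g) H n n1 mphi (fun x => powR_ge0 _ _) mH H0.
under eq_integral do rewrite ger0_norm ?step_ge0//.
under [in X in (_ = _ * X * _ + _)%E -> _]eq_integral do rewrite ger0_norm ?spin_ge0//.
move=> ->; congr (_ + _)%E.
have -> : (\int[P]_w (H w * powsum g n w)%:E =
    \sum_(1 <= k < n.+1) \int[P]_w (H w * step k w `^ g)%:E)%E.
  under eq_integral do rewrite /powsum mulr_sumr.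
  rewrite ge0_integral_sum_nat//.
    move=> k /andP[k1 _]; apply: measurable_funM => //.
    by apply: (measurableT_comp (measurable_powR g)); exact: measurable_step.
  by move=> k w; rewrite mulr_ge0 ?powR_ge0.
rewrite !ge0_sume_distrr; last 2 first.
- by move=> k _; apply: integral_ge0 => w _; rewrite lee_fin mulr_ge0 ?powR_ge0.
- move=> k _; apply: integral_ge0 => w _; rewrite mule_ge0 ?lee_fin//.
  by apply: integral_ge0 => *; rewrite lee_fin powR_ge0.
apply: eq_big_nat => k /andP[k1 kn].
have mHs : measurable_fun setT (fun w => (H w * step k w `^ g)%:E).
  apply/measurable_EFinP; apply: measurable_funM => //.
  by apply: (measurableT_comp (measurable_powR g)); exact: measurable_step.
transitivity ((p / n%:R)%:E * \int[P]_w (mg%:E * (H w * step k w `^ g)%:E))%E.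
  congr (_ * _)%E; apply: eq_integral => w _.
  transitivity ((H w)%:E * \int[P]_w' ((`|xi w'| `^ g)%:E * (step k w `^ g)%:E))%E.
    congr (_ * _)%E; apply: eq_integral => w' _.
    by rewrite ger0_norm ?mulr_ge0 ?step_ge0// powRM ?step_ge0// EFinM.
  rewrite ge0_integralZr//.
  - by rewrite xi_g EFinM muleCA.
  - apply/measurable_EFinP; apply: (measurableT_comp (measurable_powR g)).
    exact: measurableT_comp.
  - by rewrite lee_fin powR_ge0.
rewrite ge0_integralZl//; first by rewrite muleA -EFinM mulrAC.
by move=> w _; rewrite lee_fin mulr_ge0 ?powR_ge0.
Qed.

Lemma integral_powsumS (H : T -> R) n : (1 <= n)%N ->
  mfun_known (past n) H -> (forall w, 0 <= H w) ->
  (\int[P]_w (H w * powsum g n.+1 w)%:E =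
   (1 + p * mg / n%:R)%:E * \int[P]_w (H w * powsum g n w)%:E
   + (1 - p)%:E * \int[P]_w (spin n.+1 w `^ g)%:E * \int[P]_w (H w)%:E)%E.
Proof.
move=> n1 mH H0; have mHT := mfun_known_measurable mH.
have mp n' : measurable_fun setT (fun w => (H w * powsum g n' w)%:E).
  by apply/measurable_EFinP; apply: measurable_funM => //; exact: measurable_powsum.
have ms : measurable_fun setT (fun w => (H w * step n.+1 w `^ g)%:E).
  apply/measurable_EFinP; apply: measurable_funM => //.
  by apply: (measurableT_comp (measurable_powR g)); exact: measurable_step.
have i0 : (0 <= \int[P]_w (H w * powsum g n w)%:E)%E.
  by apply: integral_ge0 => w _; rewrite lee_fin mulr_ge0 ?powsum_ge0.
under eq_integral do rewrite powsumS mulrDr EFinD.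
rewrite ge0_integralD//; last 2 first.
- by move=> w _; rewrite lee_fin mulr_ge0 ?powsum_ge0.
- by move=> w _; rewrite lee_fin mulr_ge0 ?powR_ge0.
have q0 : 0 <= p * mg / n%:R.
  by rewrite divr_ge0 ?mulr_ge0 ?echo_moment_ge0//; case/andP : p01 => /ltW.
rewrite integral_step_powR//.
move: i0; set I1 := (\int[P]_w (H w * powsum g n w)%:E)%E => i0.
have -> : ((1 + p * mg / n%:R)%:E * I1 = I1 + (p * mg / n%:R)%:E * I1)%E.
  by rewrite EFinD ge0_muleDl ?lee_fin// mul1e.
by rewrite -[RHS]addeA [X in _ = (_ + X)%E]addeC.
Qed.

Variables (b : R) (s : nat -> R).
Hypothesis b1 : 1 < b.
Hypothesis bp : p * mg <= b.
Hypothesis s0 : forall n, 0 <= s n.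
Hypothesis spin_s : forall n, (1 <= n)%N -> (\int[P]_w (spin n w `^ g)%:E <= (s n)%:E)%E.

(** Index [n] stands for time [n.+1]: the recursion divides by the time and starts at time 1. *)
Definition scaled_powsum n w : R := n.+1%:R `^ (- b) * powsum g n.+1 w.

Lemma scaled_powsum_ge0 n w : 0 <= scaled_powsum n w.
Proof. by rewrite mulr_ge0 ?powR_ge0 ?powsum_ge0. Qed.

(** [natr_powR_scale] absorbs the growth factor, as [b] is at least [p * mg]; only the contribution
    of the fresh spin remains as an error. *)
Lemma scaled_powsum_step (H : T -> R) n :
  mfun_known (past n.+1) H -> (forall w, 0 <= H w <= 1) ->
  (\int[P]_w (H w * scaled_powsum n.+1 w)%:E <=
   \int[P]_w (H w * scaled_powsum n w)%:E + (n.+2%:R `^ (- b) * s n.+2)%:E)%E.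
Proof.
move=> mH H01; have H0 w : 0 <= H w by case/andP : (H01 w).
have mHT := mfun_known_measurable mH.
have mHp m : measurable_fun setT (fun w => (H w * powsum g m w)%:E).
  by apply/measurable_EFinP; apply: measurable_funM => //; exact: measurable_powsum.
have e m : (\int[P]_w (H w * scaled_powsum m w)%:E =
    (m.+1%:R `^ (- b))%:E * \int[P]_w (H w * powsum g m.+1 w)%:E)%E.
  rewrite -ge0_integralZl ?lee_fin ?powR_ge0//.
  - by apply: eq_integral => w _; rewrite -EFinM mulrCA.
  - by move=> w _; rewrite lee_fin mulr_ge0 ?powsum_ge0.
rewrite !e integral_powsumS//.
have iH : (\int[P]_w (H w)%:E <= 1)%E.
  rewrite -(integral_cst_prob P 1); apply: ge0_le_integral => //.
  - by move=> w _; rewrite lee_fin.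
  - exact/measurable_EFinP.
  - by move=> w _; rewrite lee_fin; case/andP : (H01 w).
have iH0 : (0 <= \int[P]_w (H w)%:E)%E by apply: integral_ge0 => w _; rewrite lee_fin.
have is0 : (0 <= \int[P]_w (spin n.+2 w `^ g)%:E)%E.
  by apply: integral_ge0 => w _; rewrite lee_fin powR_ge0.
have i0 : (0 <= \int[P]_w (H w * powsum g n.+1 w)%:E)%E.
  by apply: integral_ge0 => w _; rewrite lee_fin mulr_ge0 ?powsum_ge0.
have pp : 0 <= p <= 1 by case/andP : p01 => /ltW -> /ltW ->.
have q0 : 0 <= p * mg / n.+1%:R.
  by rewrite divr_ge0 ?mulr_ge0 ?echo_moment_ge0//; case/andP : pp.
rewrite ge0_muleDr; last 2 first.
- by rewrite mule_ge0// lee_fin addr_ge0.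
- by rewrite !mule_ge0// lee_fin subr_ge0; case/andP : pp.
apply: leeD.
  rewrite muleA -EFinM; apply: lee_wpmul2r => //; rewrite lee_fin mulrC.
  apply: le_trans (natr_powR_scale b1 (ltn0Sn n)).
  by rewrite ler_wpM2r ?powR_ge0// lerD2l ler_wpM2r.
rewrite EFinM; apply: lee_wpmul2l; first by rewrite lee_fin powR_ge0.
rewrite -[leRHS]mule1; apply: lee_pmul => //.
  by rewrite mule_ge0// lee_fin subr_ge0; case/andP : pp.
rewrite -[leRHS]mul1e; apply: lee_pmul => //; last exact: spin_s.
  by rewrite lee_fin subr_ge0; case/andP : pp.
by rewrite lee_fin gerBl; case/andP : pp.
Qed.

Lemma integral_scaled_powsum n :
  (\int[P]_w (scaled_powsum n w)%:E <=
   (\sum_(0 <= k < n.+1) k.+1%:R `^ (- b) * s k.+1)%:E)%E.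
Proof.
elim: n => [|n IH].
  rewrite big_nat1 powR1 mul1r; apply: le_trans (spin_s (ltn0Sn 0)).
  rewrite le_eqVlt; apply/orP; left; apply/eqP; apply: eq_integral => w _.
  by rewrite /scaled_powsum /powsum big_nat1 powR1 mul1r.
have := @scaled_powsum_step (fun=> 1) n (measurable_cst _).
under eq_integral do rewrite mul1r.
under [X in _ -> (_ <= X + _)%E]eq_integral do rewrite mul1r.
move=> /(_ (fun=> ltac:(by rewrite ler01 lexx)))/le_trans; apply.
by rewrite big_nat_recr//= EFinD; exact: leeD.
Qed.

Lemma ae_cvg_scaled_powsum C :
  (forall n, \sum_(0 <= k < n) k.+1%:R `^ (- b) * s k.+1 <= C) ->
  {ae P, forall w, cvgn (scaled_powsum ^~ w)}.
Proof.
move=> sC.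
apply: (@ae_cvgn_almost_supermartingale _ _ _ P (fun n => known (past n.+1))
  scaled_powsum (fun n => n.+2%:R `^ (- b) * s n.+2) C).
- by move=> n; exact: known_measurable.
- by move=> n; apply: known_sub; exact: past_sub.
- move=> n; apply: measurable_funM; first exact: measurable_cst.
  exact: mfun_known_powsum.
- exact: scaled_powsum_ge0.
- by apply: (le_trans (integral_scaled_powsum 0)); rewrite lee_fin.
- move=> n; apply: le_trans (sC n.+1); rewrite big_nat_recl//= lerDr.
  by rewrite mulr_ge0 ?powR_ge0.
- move=> n h mh; apply: scaled_powsum_step.
    exact: measurable_natr_bool.
  by move=> w; case: (h w); rewrite ?lexx ?ler01.
Qed.

End exponent.
End moments.

(** * Measurability and independence of the tree limits *)

Section measurable_limits.
Context {d : measure_display} {T : measurableType d} {R : realType}.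
Implicit Types f : nat -> T -> R.

(** A Cauchy criterion with integer quantifiers only, which makes the set of convergence a countable
    combination of measurable sets. *)
Lemma cvgn_cauchyP (x : nat -> R) : cvgn x <->
  forall k, exists N, forall n, (N <= n)%N -> `|x n - x N| <= k.+1%:R^-1.
Proof.
split=> [/cvg_ex[l xl] k|h].
  have e0 : 0 < k.+1%:R^-1 / 2 :> R by rewrite divr_gt0.
  move/cvgrPdist_le : xl => /(_ _ e0)[N _ hN]; exists N => n Nn.
  have := hN n Nn; have := hN N (leqnn N); rewrite /= => h1 h2.
  rewrite (_ : x n - x N = (l - x N) - (l - x n)); last by ring.
  by rewrite (le_trans (ler_normB _ _))// [leRHS]splitr lerD.
apply/cauchy_cvgP/cauchy_exP => e e0.
have [N hN] := h (Num.truncn e^-1).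
exists (x N); exists N => // n /= /hN xn.
rewrite /ball/= distrC; apply: (le_lt_trans xn).
rewrite invf_plt ?posrE//; exact: truncnS_gt.
Qed.

Lemma measurable_limn f : (forall n, measurable_fun setT (f n)) ->
  measurable_fun setT (fun w => limn (f ^~ w)).
Proof.
move=> mf; pose C := [set w | cvgn (f ^~ w)].
have mC : measurable C.
  have -> : C = \bigcap_k \bigcup_N \bigcap_n
      [set w | (N <= n)%N -> `|f n w - f N w| <= k.+1%:R^-1].
    apply/seteqP; split => w.
      by move=> /cvgn_cauchyP h k _; have [N hN] := h k; exists N => // n _; exact: hN.
    move=> h; apply/cvgn_cauchyP => k; have [N _ hN] := h k I.
    by exists N => n; exact: (hN n I).
  apply: bigcapT_measurable => k; apply: bigcupT_measurable => N.
  apply: bigcapT_measurable => n; have [Nn|Nn] := leqP N n; last first.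
    by rewrite [X in measurable X](_ : _ = setT)//; apply/seteqP; split.
  rewrite [X in measurable X](_ : _ =
    (fun w => `|f n w - f N w|) @^-1` `]-oo, k.+1%:R^-1]%classic); last first.
    by apply/seteqP; split => w /=; rewrite in_itv/=; [move=> /(_ isT)|].
  rewrite -[X in measurable X]setTI.
  have mfn : measurable_fun setT (fun w => `|f n w - f N w|).
    by apply: measurableT_comp => //; exact: measurable_funB.
  by apply: mfn => //; exact: measurable_itv.
rewrite -(setvU C); apply/measurable_funU => //; first exact: measurableC.
split.
  (* Where the sequence diverges, [limn] takes the default value [point]. *)
  apply: (eq_measurable_fun (cst point)); last exact: measurable_cst.
  by move=> w; rewrite inE/= => /dvgP ->.
apply: (@measurable_fun_cvg _ _ _ C f) => [n|w Cw]; last exact: Cw.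
exact: measurable_funTS.
Qed.

Lemma measurable_random_index {d'} {S : measurableType d'} (F : nat -> T -> S)
    (N : T -> nat) : (forall n, measurable_fun setT (F n)) ->
  measurable_fun setT N -> measurable_fun setT (fun w => F (N w) w).
Proof.
move=> mF mN _ B mB; rewrite setTI.
rewrite [X in measurable X](_ : _ =
    \bigcup_k (N @^-1` [set k] `&` F k @^-1` B)); last first.
  by apply/seteqP; split => w /=; [exists (N w)|move=> [k _ [/= <-]]].
apply: bigcupT_measurable => k; apply: measurableI.
  by rewrite -[X in measurable X]setTI; exact: mN.
by rewrite -[X in measurable X]setTI; exact: mF.
Qed.

End measurable_limits.

Section measurable_trees.
Context {d : measure_display} {T : measurableType d} {R : realType}.
Variables (eps : nat -> T -> bool) (U : nat -> T -> nat) (xi : nat -> T -> R).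
Hypothesis meps : forall n, (2 <= n)%N -> measurable_fun setT (eps n).
Hypothesis mU : forall n, (2 <= n)%N -> measurable_fun setT (U n).
Hypothesis mxi : forall n, (2 <= n)%N -> measurable_fun setT (xi n).

Lemma measurable_echoed_fuel1 k n : measurable_fun setT
  (fun w => echoed_fuel (fun=> 1) (eps ^~ w) (U ^~ w) (xi ^~ w) k n : R).
Proof.
elim: k n => [n|k IH n] /=; first exact: measurable_cst.
have [n1|n2] := leqP n 1; first exact: measurable_cst.
have mb : measurable_fun setT (fun w => (eps n w)%:R : R).
  by apply: measurable_natr_bool; exact: meps.
apply: measurable_funD.
  by apply: measurable_funM => //; apply: measurable_funB.
apply: measurable_funM; first by apply: measurable_funM => //; exact: mxi.
exact: (@measurable_random_index _ _ _ _ (fun j w =>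
  echoed_fuel (fun=> 1) (eps ^~ w) (U ^~ w) (xi ^~ w) k j) _ _ (mU n2)).
Qed.

(** Descent through at most [k] kept edges. Unlike the inductive predicate it is a boolean computed
    from finitely many queries, and being a kept descendant is the union of these events over
    [k]. *)
Fixpoint kept_depth (e : nat -> bool) (u : nat -> nat) (r k i : nat) : bool :=
  (i == r) || (if k is k'.+1 then [&& (2 <= i)%N, e i & kept_depth e u r k' (u i)]
               else false).

Lemma kept_depthP e u r i :
  kept_descendant e u r i <-> exists k, kept_depth e u r k i.
Proof.
split=> [|[k]].
  elim=> [|j j2 ej _ [k hk]]; first by exists 0%N; rewrite /= eqxx.
  by exists k.+1; rewrite /= j2 ej hk orbT.
elim: k i => [|k IH] i /= /orP[/eqP ->|//]; try exact: kept_root.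
by move=> /and3P[i2 ei /IH ki]; exact: kept_child.
Qed.

Lemma measurable_kept_depth r k i : measurable_fun setT
  (fun w => kept_depth (eps ^~ w) (U ^~ w) r k i).
Proof.
elim: k i => [i|k IH i] /=.
  exact: measurable_cst.
have [i1|i2] := leqP i 1.
  by rewrite (_ : (fun _ => _) = fun=> (i == r) || false)//; exact: measurable_cst.
rewrite /=; apply: measurable_or; first exact: measurable_cst.
apply: measurable_and; first exact: meps.
exact: (@measurable_random_index _ _ _ _ (fun j w =>
  kept_depth (eps ^~ w) (U ^~ w) r k j) _ _ (mU i2)).
Qed.

Lemma measurable_perc_tree r n i : (1 <= r)%N ->
  measurable_fun setT (fun w => `[< perc_tree (eps ^~ w) (U ^~ w) r n i >]).
Proof.
move=> r1.
have mr : measurable_fun setT (fun w => (r == 1%N) || ~~ eps r w).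
  have [->|rn] := eqVneq r 1%N; first exact: measurable_cst.
  apply: (measurableT_comp (f := negb)) => //; apply: meps.
  by rewrite ltn_neqAle eq_sym rn.
apply: (@measurable_fun_bool _ _ _ _ true).
rewrite setTI [X in measurable X](_ : _ = [set w | (1 <= i <= n)%N] `&`
    ((fun w => (r == 1%N) || ~~ eps r w) @^-1` [set true] `&`
    \bigcup_k ((fun w => kept_depth (eps ^~ w) (U ^~ w) r k i) @^-1` [set true]))).
  apply: measurableI.
    case: (1 <= i <= n)%N.
      by rewrite [X in measurable X](_ : _ = setT)//; apply/seteqP; split.
    by rewrite [X in measurable X](_ : _ = set0)//; apply/seteqP; split.
  apply: measurableI; first by rewrite -[X in measurable X]setTI; exact: mr.
  apply: bigcupT_measurable => k; rewrite -[X in measurable X]setTI.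
  exact: measurable_kept_depth.
apply/seteqP; split => w /=.
  move=> /asboolP[h1 h2 /kept_depthP[k hk]]; split => //; split; last by exists k.
  by case: h2 => [->|->]; rewrite ?eqxx ?orbT.
move=> [h1 [h2 [k _ hk]]]; apply/asboolP; split => //; last by apply/kept_depthP; exists k.
by move/orP : h2 => [/eqP|/negbTE]; [left|right].
Qed.

Lemma measurable_scaled_tree_weight a r n : (1 <= r)%N -> measurable_fun setT
  (fun w => scaled_tree_weight a (eps ^~ w) (U ^~ w) (xi ^~ w) r n : R).
Proof.
move=> r1; apply: measurable_funM; first exact: measurable_cst.
rewrite /tree_weight; under eq_fun do rewrite big_mkcond/=.
apply: measurable_sum => i; apply: measurable_fun_ifT => //.
- exact: measurable_perc_tree.
- exact: measurable_echoed_fuel1.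
Qed.

Lemma measurable_tree_limit a r : (1 <= r)%N -> measurable_fun setT
  (fun w => tree_limit a (eps ^~ w) (U ^~ w) (xi ^~ w) r : R).
Proof. by move=> r1; apply: measurable_limn => n; exact: measurable_scaled_tree_weight. Qed.

End measurable_trees.

Section limit_independence.
Context {d : measure_display} {T : measurableType d} {R : realType}.
Variables (P : probability T R) (p : R) (X xi : {RV P >-> R}).
Variables (Xs : nat -> {RV P >-> R}) (eps : nat -> {RV P >-> bool})
  (U : nat -> {RV P >-> nat}) (xis : nat -> {RV P >-> R}).
Hypothesis driven : rwes_driven Xs eps U xis p X xi.

(** The limits are measurable functions of the memory variables, echoes and parents alone, at every
    point since [limn] is total; the spins occupy the complementary index set. *)
Lemma L_independent a : independent2 P
  (sigma_of_family [set r | (1 <= r)%N] (L_ eps U xis a))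
  (sigma_of_family [set r | (1 <= r)%N] Xs).
Proof.
pose DL : set driving_index := [set i | driving_dom i /\ if i is inl (inl _) then False else True].
pose DX : set driving_index := [set i | driving_dom i /\ if i is inl (inl _) then True else False].
move=> A B sA sB; apply: (known_independent driven (D := DL) (D' := DX)).
- by move=> i [].
- by move=> i [].
- by apply/disj_setPS => -[[]n|n] [[_ +] [_]].
- move: A sA; apply: smallest_sub; first exact: smallest_sigma_algebra.
  move=> A [r r1 [B0 mB0 <-]].
  suff : measurable_fun (setT : set (g_sigma_algebraType (known Xs eps U xis DL)))
    (L_ eps U xis a r) by apply.
  apply: measurable_tree_limit => // n n2.
  + by apply: mfun_known_eps; split.
  + by apply: mfun_known_U; split.
  + by apply: mfun_known_xi; split.
- move: B sB; apply: smallest_sub; first exact: smallest_sigma_algebra.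
  move=> B [r r1 BX]; apply: sub_sigma_algebra.
  by exists (inl (inl r)).
Qed.

Lemma measurable_L a r : (1 <= r)%N -> measurable_fun setT (L_ eps U xis a r).
Proof. by move=> r1; apply: measurable_tree_limit. Qed.

Lemma measurable_limit_series a : measurable_fun setT (limit_series Xs eps U xis a).
Proof.
apply: measurable_limn => n; apply: measurable_sum_nat => r /andP[r1 _].
by apply: measurable_funM => //; exact: measurable_L.
Qed.

End limit_independence.

(** * Almost sure limits *)

Lemma limn_einf_mono {R : realType} (u v : nat -> \bar R) :
  (forall n, u n <= v n)%E -> (limn_einf u <= limn_einf v)%E.
Proof.
move=> uv; rewrite !limn_einf_lim; apply: lee_lim; [exact: is_cvg_einfs..|].
apply: nearW => n; apply: le_ereal_inf_tmp => _ [k /= nk <-].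
by apply: le_trans (uv k); apply: ereal_inf_lbound; exists k.
Qed.

Lemma cvgn_ge0 {R : realType} (x : nat -> R) (l : R) :
  x n @[n --> \oo] --> l -> (forall n, 0 <= x n) -> 0 <= l.
Proof.
move=> xl x0; rewrite -(cvg_lim _ xl)//; apply: limr_ge; last exact: nearW.
by apply/cvg_ex; exists l.
Qed.

Lemma cvg_sum_nat {R : realType} (u : nat -> nat -> R) (l : nat -> R) i j :
  (forall k, (i <= k < j)%N -> u k n @[n --> \oo] --> l k) ->
  \sum_(i <= k < j) u k n @[n --> \oo] --> \sum_(i <= k < j) l k.
Proof.
have [ji _|/ltnW ij] := leqP j i.
  by rewrite big_geq//; under eq_fun do rewrite big_geq//; exact: cvg_cst.
elim: j ij => [|j IH] ij ul.
  by rewrite big_geq//; under eq_fun do rewrite big_geq//; exact: cvg_cst.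
move: ij; rewrite leq_eqVlt => /predU1P[->|ij].
  by rewrite big_geq//; under eq_fun do rewrite big_geq//; exact: cvg_cst.
rewrite big_nat_recr//=; under eq_fun do rewrite big_nat_recr//=.
apply: cvgD; last by apply: ul; rewrite leqnn andbT.
by apply: IH => // k /andP[ik kj]; apply: ul; rewrite ik ltnW.
Qed.

Section almost_sure_limits.
Context {d : measure_display} {T : measurableType d} {R : realType}.
Variables (P : probability T R) (p : R) (X xi : {RV P >-> R}).
Variables (Xs : nat -> {RV P >-> R}) (eps : nat -> {RV P >-> bool})
  (U : nat -> {RV P >-> nat}) (xis : nat -> {RV P >-> R}).
Hypothesis p01 : 0 < p < 1.
Hypothesis driven : rwes_driven Xs eps U xis p X xi.
Hypothesis xi_ge0 : {ae P, forall w, 0 <= xi w}.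
Variables (m a : R).
Hypothesis xi1 : (\int[P]_w (`|xi w| `^ 1)%:E = m%:E)%E.
Hypothesis am : a = p * m.
Hypothesis a1 : 1 < a.

Local Notation walk := (walk Xs eps U xis).

Definition scaled_walk (f : nat -> R -> R) n w : R := n%:R `^ (- a) * walk f n w.
Local Notation W := scaled_walk.

(** An everywhere defined nonnegative version of the limit, to which Fatou's lemma applies before
    convergence is known. *)
Definition lower_limit (f : nat -> R -> R) w : \bar R :=
  limn_einf (fun n => (W f n w)%:E).

Section spins.
Variables (f : nat -> R -> R) (s : nat -> R).
Hypothesis mf : forall n, measurable_fun setT (f n).
Hypothesis f0 : forall n x, 0 <= f n x.
Hypothesis s0 : forall n, 0 <= s n.
Hypothesis spin_s : forall n, (1 <= n)%N -> (\int[P]_w (spin Xs f n w)%:E <= (s n)%:E)%E.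
Variable C : R.
Hypothesis sC : forall n, \sum_(0 <= k < n) k.+1%:R `^ (- a) * s k.+1 <= C.

Let spin_s1 n : (1 <= n)%N -> (\int[P]_w (spin Xs f n w `^ 1)%:E <= (s n)%:E)%E.
Proof.
by move=> n1; under eq_integral do rewrite powRr1 ?spin_ge0//; exact: spin_s.
Qed.

Let WE n w : scaled_powsum Xs eps U xis f 1 a n w = W f n.+1 w.
Proof. by rewrite /scaled_powsum powsum1. Qed.

Lemma scaled_walk_ge0 n w : 0 <= W f n w.
Proof. by rewrite mulr_ge0 ?powR_ge0 ?walk_ge0. Qed.

Lemma measurable_scaled_walk n : measurable_fun setT (W f n).
Proof. by apply: measurable_funM; [exact: measurable_cst|exact: measurable_walk]. Qed.

Lemma ae_cvgn_scaled_walk : {ae P, forall w, cvgn (W f ^~ w)}.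
Proof.
have ap : p * m <= a by rewrite am.
have := ae_cvg_scaled_powsum p01 driven mf f0 xi1 a1 ap s0 spin_s1 sC.
apply: filterS => w /cvg_ex[l h]; apply/cvg_ex; exists l.
by rewrite -cvg_shiftS /=; move: h; under eq_fun do rewrite WE.
Qed.

Lemma integral_scaled_walk n : (\int[P]_w (W f n w)%:E <= C%:E)%E.
Proof.
have C0 : 0 <= C by have := sC 0; rewrite big_geq.
case: n => [|n].
  under eq_integral do rewrite /W /walk /echoed_sum big_geq// mulr0.
  by rewrite integral0 lee_fin.
have ap : p * m <= a by rewrite am.
have := integral_scaled_powsum p01 driven mf f0 xi1 a1 ap spin_s1 n.
under eq_integral do rewrite WE.
by move/le_trans; apply; rewrite lee_fin.
Qed.

Lemma lower_limit_ge0 w : (0 <= lower_limit f w)%E.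
Proof. by apply: limn_einf_ge => n; rewrite lee_fin scaled_walk_ge0. Qed.

Lemma measurable_lower_limit : measurable_fun setT (lower_limit f).
Proof.
apply: measurable_fun_limn_einf => n; apply/measurable_EFinP.
exact: measurable_scaled_walk.
Qed.

Lemma integral_lower_limit : (\int[P]_w lower_limit f w <= C%:E)%E.
Proof.
apply: (le_trans (fatou P measurableT _ _)).
- by move=> n; apply/measurable_EFinP; exact: measurable_scaled_walk.
- by move=> n w _; rewrite lee_fin scaled_walk_ge0.
- by apply: limn_einf_le; exact: integral_scaled_walk.
Qed.

End spins.

Lemma lower_limitE f w l : W f n w @[n --> \oo] --> l -> lower_limit f w = l%:E.
Proof.
move=> h; apply: (cvg_limn_einf_sup _).1.
by apply: cvg_EFin; [exact: nearW|exact: h].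
Qed.

Definition zeta_bound : R := 1 + (a - 1)^-1.

Definition tree_spin r : nat -> R -> R := fun n _ => (n == r)%:R.

Definition regular w : Prop := forall n, (2 <= n)%N ->
  U n w = parent U n w /\ xis n w = echo xis n w.

Lemma scaled_TE r n w : regular w ->
  scaled_T eps U xis a r n w = W (tree_spin r) n w.
Proof.
move=> rw; rewrite /scaled_T /scaled_tree_weight tree_weightE; last first.
  by move=> k k2; rewrite (rw k k2).1; exact: parentP.
congr (_ * _); apply: echoed_sum_eq => k k2; first exact: (rw k k2).1.
exact: (rw k k2).2.
Qed.

Definition pos_spin : nat -> R -> R := fun _ x => Num.max x 0.
Definition neg_spin : nat -> R -> R := fun _ x => Num.max (- x) 0.

Lemma rwesE n w : regular w ->
  rwes Xs eps U xis n w / n%:R `^ a = W pos_spin n w - W neg_spin n w.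
Proof.
move=> rw; rewrite /W powRN -mulrBr mulrC; congr (_ * _).
rewrite /rwes (@echoed_sum_eq _ _ _ _ (parent U ^~ w) _ (echo xis ^~ w)); last 2 first.
- by move=> k k2; exact: (rw k k2).1.
- by move=> k k2; exact: (rw k k2).2.
rewrite -mulN1r /walk -echoed_sumZ; last exact: parentP.
rewrite -echoed_sumD; last exact: parentP.
apply: eq_echoed_sum => [|k _]; first exact: parentP.
rewrite /spin /pos_spin /neg_spin mulN1r.
by case: (leP (Xs k w) 0) => h; case: leP => ?; lra.
Qed.

(** The convergence theorem for the walk whose only nonzero spin is 1 at time [r]; its error terms
    reduce to a single power. *)
Lemma ae_tree_limits : {ae P, forall w, forall r,
  W (tree_spin r) n w @[n --> \oo] --> L_ eps U xis a r w}.
Proof.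
apply: ae_forall_countable => r.
have cv : {ae P, forall w, cvgn (W (tree_spin r) ^~ w)}.
  apply: (@ae_cvgn_scaled_walk _ (fun n => (n == r)%:R) _ _ _ _ zeta_bound) => //.
  - by move=> n; exact: measurable_cst.
  - by move=> n n1; rewrite /spin /tree_spin integral_cst_prob.
  - move=> n; apply: le_trans (sum_powRN_le n a1); apply: ler_sum => k _.
    by case: eqP => _; rewrite ?mulr1// mulr0 powR_ge0.
apply: filterS2 (ae_driving_regular driven xi_ge0) cv => w rw cw.
have e : (fun n => W (tree_spin r) n w) = (fun n => scaled_T eps U xis a r n w).
  by apply/funext => n; rewrite scaled_TE.
by move: cw; rewrite e.
Qed.

Section series.
Variables (g : R -> R) (mu : R).
Hypothesis mg : measurable_fun setT g.
Hypothesis g0 : forall x, 0 <= g x.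
Hypothesis gmu : (\int[P]_w (g (X w))%:E <= mu%:E)%E.

Let mu0 : 0 <= mu.
Proof. by rewrite -lee_fin (le_trans _ gmu)// integral_ge0// => w _; rewrite lee_fin. Qed.

(** The spins up to time [N] are silenced; the walk is then the finite combination of the first [N]
    trees plus the walk of this tail. *)
Let tail_spin N : nat -> R -> R := fun n x => (N < n)%:R * g x.

Let mtail N n : measurable_fun setT (tail_spin N n).
Proof. by apply: measurable_funM => //; exact: measurable_cst. Qed.

Let tail0 N n x : 0 <= tail_spin N n x.
Proof. by rewrite mulr_ge0. Qed.

Let u k : R := k.+1%:R `^ (- a).
Let S : R := limn (series u).

Let u0 k : 0 <= u k. Proof. exact: powR_ge0. Qed.

Let ndS : nondecreasing_seq (series u).
Proof. by apply/nondecreasing_seqP => n; rewrite !seriesEnat/= big_nat_recr//= lerDl. Qed.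

Let cvgS : cvgn (series u).
Proof.
apply: nondecreasing_is_cvgn => //; exists zeta_bound => _ [n _ <-].
by rewrite seriesEnat/=; exact: sum_powRN_le.
Qed.

Let tail_sum N n :
  \sum_(0 <= k < n) k.+1%:R `^ (- a) * ((N < k.+1)%:R * mu) <= mu * (S - series u N).
Proof.
have [nN|Nn] := leqP n N.
  rewrite big_nat big1; last first.
    by move=> k /andP[_ kn]; rewrite ltnS leqNgt (leq_trans kn nN)/= mul0r mulr0.
  by rewrite mulr_ge0// subr_ge0; exact: nondecreasing_cvgn_le.
rewrite (@big_cat_nat _ _ _ N)//=; last exact: ltnW.
rewrite big_nat big1 ?add0r; last first.
  by move=> k /andP[_ kn]; rewrite ltnS leqNgt kn/= mul0r mulr0.
rewrite (eq_big_nat _ _ (F2 := fun k => mu * u k)); last first.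
  by move=> k /andP[Nk _]; rewrite ltnS Nk mul1r mulrC.
rewrite -mulr_sumr ler_wpM2l//.
have : series u n <= S by exact: nondecreasing_cvgn_le.
rewrite [in X in X <= _ -> _]seriesEnat/= (@big_cat_nat _ _ _ N)//=; last exact: ltnW.
by rewrite seriesEnat/= lerBrDl.
Qed.

Let spin_tail N n : (1 <= n)%N ->
  (\int[P]_w (spin Xs (tail_spin N) n w)%:E <= ((N < n)%:R * mu)%:E)%E.
Proof.
move=> n1; rewrite /spin /tail_spin.
have mgX : measurable_fun setT (fun w => (g (Xs n w))%:E).
  by apply/measurable_EFinP; exact: measurableT_comp.
under eq_integral do rewrite EFinM.
rewrite ge0_integralZl ?lee_fin//; last by move=> w _; rewrite lee_fin.
rewrite EFinM; apply: lee_wpmul2l; first by rewrite lee_fin.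
apply: le_trans gmu.
rewrite (@integral_same_law _ _ _ _ _ P (Xs n) X (EFin \o g))//.
- exact: spin_law driven _ n1.
- exact: measurableT_comp.
Qed.

Let ae_cvg_tail : {ae P, forall w, forall N, cvgn (W (tail_spin N) ^~ w)}.
Proof.
apply: ae_forall_countable => N.
apply: (@ae_cvgn_scaled_walk _ (fun n => (N < n)%:R * mu) _ _ _ _ (mu * (S - series u N))) => //.
- by move=> n; rewrite mulr_ge0.
- by move=> n; exact: spin_tail.
Qed.

(** Fatou's lemma in [N]: the limit of the tail walk has mean at most [mu] times the remainder of
    the series of [r^(- a)], which tends to 0. *)
Let ae_tail_vanishes : {ae P, forall w,
  limn_einf (fun N => lower_limit (tail_spin N) w) = 0%E}.
Proof.
pose t w := limn_einf (fun N => lower_limit (tail_spin N) w).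
have mt : measurable_fun setT t.
  by apply: measurable_fun_limn_einf => N; exact: measurable_lower_limit.
have t0 w : (0 <= t w)%E.
  by apply: limn_einf_ge => N; exact: lower_limit_ge0.
have it : (\int[P]_w t w <= 0)%E.
  apply: (le_trans (fatou P measurableT _ _)).
  - by move=> N; exact: measurable_lower_limit.
  - by move=> N w _; exact: lower_limit_ge0.
  have h : (fun N => (mu * (S - series u N))%:E) @ \oo --> 0%:E.
    apply: cvg_EFin; first exact: nearW.
    rewrite -[X in _ --> X](mulr0 mu) -(subrr S).
    by apply: cvgMr; apply: cvgB => //; exact: cvg_cst.
  have <- : limn_einf (fun N => (mu * (S - series u N))%:E) = 0%E.
    exact: (cvg_limn_einf_sup h).1.
  apply: limn_einf_mono => N.
  apply: (@integral_lower_limit _ (fun n => (N < n)%:R * mu)) => //.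
  by move=> n; exact: spin_tail.
have := (ae_eq_integral_abs P measurableT mt).1; rewrite /ae_eq.
have -> : (\int[P]_w `|t w| = 0)%E.
  under eq_integral do rewrite gee0_abs//.
  by apply/eqP; rewrite eq_le it integral_ge0.
by move=> /(_ erefl); apply: filterS => w /(_ I).
Qed.

(** For every [N], the limit of the walk is the partial sum up to [N] plus the limit [t N] of the
    tail walk; the series converges to that limit exactly because [t N] tends to 0. *)
Lemma ae_walk_series : {ae P, forall w, exists l : R,
  [/\ W (fun=> g) n w @[n --> \oo] --> l,
     \sum_(1 <= r < n.+1) g (Xs r w) * L_ eps U xis a r w @[n --> \oo] --> l
   & lower_limit (fun=> g) w = l%:E]}.
Proof.
apply: filterS3 ae_tree_limits ae_cvg_tail ae_tail_vanishes => w Lw tw vw.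
pose t N := limn (W (tail_spin N) ^~ w).
have Wdec N n : W (fun=> g) n w =
    \sum_(1 <= r < N.+1) g (Xs r w) * W (tree_spin r) n w + W (tail_spin N) n w.
  have -> : \sum_(1 <= r < N.+1) g (Xs r w) * W (tree_spin r) n w =
      n%:R `^ (- a) * \sum_(1 <= r < N.+1) g (Xs r w) * walk (tree_spin r) n w.
    by rewrite mulr_sumr; apply: eq_bigr => r _; rewrite /W mulrCA.
  rewrite -mulrDr; congr (_ * _).
  rewrite /walk -(@echoed_sum_head _ (eps ^~ w) (parent U ^~ w) (echo xis ^~ w)
    _ (spin Xs (fun=> g) ^~ w)); last exact: parentP.
  rewrite -echoed_sumD; last exact: parentP.
  apply: eq_echoed_sum => [|k _]; first exact: parentP.
  rewrite /spin /tail_spin -mulrDl.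
  by case: (leqP k N) => _; rewrite /= ?addr0 ?add0r mul1r.
have Ysum N : W (fun=> g) n w @[n --> \oo] -->
    \sum_(1 <= r < N.+1) g (Xs r w) * L_ eps U xis a r w + t N.
  under eq_fun do rewrite (Wdec N).
  apply: cvgD; last exact: tw.
  by apply: cvg_sum_nat => r _; apply: cvgMr; exact: Lw.
pose l := limn (W (fun=> g) ^~ w).
have Wl : W (fun=> g) n w @[n --> \oo] --> l.
  by apply/cvg_ex; exists (\sum_(1 <= r < 1) g (Xs r w) * L_ eps U xis a r w + t 0%N); exact: Ysum.
have lE N : l = \sum_(1 <= r < N.+1) g (Xs r w) * L_ eps U xis a r w + t N.
  exact: (cvg_unique _ Wl (Ysum N)).
exists l; split => //; last exact: lower_limitE.
have L0 r : 0 <= L_ eps U xis a r w.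
  by apply: (cvgn_ge0 (Lw r)) => n; exact: scaled_walk_ge0.
have t0 N : 0 <= t N.
  by apply: (cvgn_ge0 (tw N)) => n; exact: scaled_walk_ge0.
have tE N : t N = l - \sum_(1 <= r < N.+1) g (Xs r w) * L_ eps U xis a r w.
  by rewrite (lE N) addrC addKr.
(* Monotonicity turns the vanishing inferior limit of the tails into convergence to 0. *)
have nit : nonincreasing_seq t.
  apply/nonincreasing_seqP => N; rewrite !tE lerD2l lerN2 [leRHS]big_nat_recr//= lerDl.
  by rewrite mulr_ge0.
have ct : cvgn t by apply: nonincreasing_is_cvgn => //; exists 0 => _ [N _ <-].
have t00 : t n @[n --> \oo] --> (0 : R).
  suff e : limn t = 0 by rewrite -e; exact: ct.
  have h : (fun N => (t N)%:E) @ \oo --> (limn t)%:E.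
    by apply: cvg_EFin; [exact: nearW|exact: ct].
  have := (cvg_limn_einf_sup h).1.
  under [in X in X = _ -> _]eq_fun do rewrite -(lower_limitE (tw _)).
  by rewrite vw => -[].
have -> : (fun n => \sum_(1 <= r < n.+1) g (Xs r w) * L_ eps U xis a r w) =
    (fun n => l - t n).
  by apply/funext => N; rewrite tE opprB addrC subrK.
by rewrite -[X in _ --> X]subr0; apply: cvgB => //; exact: cvg_cst.
Qed.

Lemma integral_lower_limit_series : (\int[P]_w lower_limit (fun=> g) w < +oo)%E.
Proof.
apply: le_lt_trans (ltry (mu * zeta_bound)).
apply: (@integral_lower_limit _ (fun=> mu)) => //.
- move=> n n1; have := spin_tail 0 n1.
  rewrite n1 mul1r; apply: le_trans; rewrite le_eqVlt; apply/orP; left; apply/eqP.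
  by apply: eq_integral => w _; rewrite /spin /tail_spin n1 mul1r.
- move=> n; rewrite -mulr_suml mulrC ler_wpM2l//; exact: sum_powRN_le.
Qed.

End series.

Lemma L_Lfun1 r : (1 <= r)%N -> L_ eps U xis a r \in Lfun P 1%E.
Proof.
move=> r1; apply/Lfun1_integrable; apply/integrableP.
have mL := @measurable_L _ _ _ P eps U xis a r r1.
split; first exact/measurable_EFinP.
apply: le_lt_trans (ltry zeta_bound).
apply: (@le_trans _ _ (\int[P]_w lower_limit (tree_spin r) w)%E).
  rewrite le_eqVlt; apply/orP; left; apply/eqP; apply: ae_eq_integral => //.
  - by apply: measurableT_comp => //; exact/measurable_EFinP.
  - by apply: measurable_lower_limit => n; exact: measurable_cst.
  - apply: filterS ae_tree_limits => w /(_ r) h _.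
    rewrite (lower_limitE h) /= ger0_norm//.
    by apply: (cvgn_ge0 h) => n; exact: scaled_walk_ge0.
apply: (@integral_lower_limit _ (fun n => (n == r)%:R)) => //.
- by move=> n; exact: measurable_cst.
- by move=> n n1; rewrite /spin /tree_spin integral_cst_prob.
- move=> n; apply: le_trans (sum_powRN_le n a1); apply: ler_sum => k _.
  by case: eqP => _; rewrite ?mulr1// mulr0 powR_ge0.
Qed.

End almost_sure_limits.

(** * The critical and supercritical case *)

Lemma sum_sqrN_le {R : realType} n0 j : (0 < n0)%N ->
  \sum_(0 <= i < j) (n0 + i)%:R ^- 2 <= 2 :> R.
Proof.
move=> n00; have -> : 2 = 1 + (2 - 1)^-1 :> R by rewrite (_ : 2 - 1 = 1) ?invr1; lra.
apply: le_trans (sum_powRN_le j _); last by lra.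
apply: ler_sum => i _; rewrite powRN (powR_mulrn 2)//.
by rewrite lef_pV2 ?posrE ?exprn_gt0 ?ltr0n ?addn_gt0 ?n00// ler_sqr ?nnegrE// ler_nat -addn1 addnC leq_add2r.
Qed.

Lemma harmonic_unbounded {R : realType} n0 (M : R) : (0 < n0)%N ->
  exists j, M < \sum_(0 <= i < j) (n0 + i)%:R^-1.
Proof.
move=> n00; apply: contrapT => /forallNP h.
apply: (@dvg_harmonic R).
have nd : nondecreasing_seq (series (@harmonic R)).
  by apply/nondecreasing_seqP => n; rewrite !seriesEnat/= big_nat_recr//= lerDl.
apply: nondecreasing_is_cvgn => //.
exists (series harmonic n0 + M) => _ [n _ <-].
apply: (@le_trans _ _ (series harmonic (n0 + n))); first exact/nd/leq_addl.
rewrite !seriesEnat/= (@big_cat_nat _ _ _ n0)//= ?leq_addr// lerD2l.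
have := h n.+1 => /negP; rewrite -leNgt; apply: le_trans.
have -> : \sum_(n0 <= k < n0 + n) harmonic k = \sum_(0 <= i < n) harmonic (i + n0)%N :> R.
  by rewrite -{1}[n0]add0n big_addn addKn.
rewrite big_nat_recl//=.
apply: (@le_trans _ _ (\sum_(0 <= i < n) (n0 + i.+1)%:R^-1)); last by rewrite lerDr.
by apply: ler_sum => i _; rewrite /harmonic/= addnC addnS.
Qed.

(** Summing the recursion, the errors contribute at most [2 * D], so [h] stays bounded and the sum
    of [theta * q n / n] is finite. If [q] stayed above [e], the harmonic series would contradict
    this. *)
Lemma drift_dichotomy {R : realType} (h q : nat -> R) (theta D : R) n0 :
  0 < theta -> 0 <= D -> (0 < n0)%N ->
  (forall n, 0 <= h n) -> (forall n, 0 <= q n) ->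
  (forall n, (n0 <= n)%N ->
    h n.+1 + theta / n%:R * q n <= h n + D / n%:R ^+ 2) ->
  (forall n, (n0 <= n)%N -> h n <= h n0 + 2 * D) /\
  (forall e, 0 < e -> exists2 n, (n0 <= n)%N & q n <= e).
Proof.
move=> t0 D0 n00 h0 q0 rec.
have sum j : h (n0 + j)%N + \sum_(0 <= i < j) theta / (n0 + i)%:R * q (n0 + i)%N
    <= h n0 + 2 * D.
  apply: (@le_trans _ _ (h n0 + D * \sum_(0 <= i < j) (n0 + i)%:R ^- 2)); last first.
    by rewrite lerD2l mulrC ler_wpM2r// sum_sqrN_le.
  elim: j => [|j IH]; first by rewrite !big_geq// addn0 mulr0.
  rewrite !big_nat_recr//= addnS mulrDr.
  have := rec (n0 + j)%N (leq_addr _ _); move: IH.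
  set A := \sum_(0 <= i < j) _; set B := \sum_(0 <= i < j) _; lra.
split=> [n n0n|e e0].
  have := sum (n - n0)%N; rewrite subnKC//; apply: le_trans; rewrite lerDl.
  apply: sumr_ge0 => i _; apply: mulr_ge0 => //; apply: divr_ge0 => //.
  exact: ltW.
apply: contrapT => hq.
have qe n : (n0 <= n)%N -> e <= q n.
  by move=> nn; rewrite leNgt; apply/negP => /ltW qn; apply: hq; exists n.
have [j hj] := @harmonic_unbounded R n0 ((h n0 + 2 * D) / (theta * e)) n00.
move: hj; rewrite ltr_pdivrMr ?mulr_gt0//; apply/negP; rewrite -leNgt.
apply: le_trans (sum j); apply: (@le_trans _ _ (\sum_(0 <= i < j) theta / (n0 + i)%:R * q (n0 + i)%N)).
  rewrite mulr_suml; apply: ler_sum => i _.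
  rewrite mulrCA -mulrA ler_wpM2l ?(ltW t0)// ler_wpM2l ?invr_ge0//.
  exact/qe/leq_addr.
by rewrite lerDr.
Qed.

Lemma limn_einf_io_le {R : realType} (u : nat -> \bar R) (e : \bar R) :
  infinitely_often (fun n => (u n <= e)%E) -> (limn_einf u <= e)%E.
Proof.
move=> io; rewrite limn_einf_lim; apply: lime_le; first exact: is_cvg_einfs.
apply: nearW => N; have [n Nn une] := io N; apply: le_trans une.
by apply: ereal_inf_lbound; exists n.
Qed.

Lemma ge0_integral_eq0_ae {d : measure_display} {T : measurableType d}
    {R : realType} (P : probability T R) (t : T -> \bar R) :
  measurable_fun setT t -> (forall w, 0 <= t w)%E -> (\int[P]_w t w <= 0)%E ->
  {ae P, forall w, t w = 0%E}.
Proof.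
move=> mt t0 it; have := (ae_eq_integral_abs P measurableT mt).1; rewrite /ae_eq.
have -> : (\int[P]_w `|t w| = 0)%E.
  under eq_integral do rewrite gee0_abs//.
  by apply/eqP; rewrite eq_le it integral_ge0.
by move=> /(_ erefl); apply: filterS => w /(_ I).
Qed.

Lemma fine_recursion {R : realType} (x y z v : \bar R) (t e c : R) :
  x \is a fin_num -> y \is a fin_num -> z \is a fin_num -> 0 <= e ->
  (v <= c%:E)%E -> (x + t%:E * y <= z + e%:E * v)%E ->
  fine x + t * fine y <= fine z + e * c.
Proof.
move=> xf yf zf e0 vc h; rewrite -lee_fin !EFinD !EFinM !fineK//.
apply: (le_trans h); apply: leeD => //; apply: lee_wpmul2l => //.
Qed.

Lemma lee_indicator_combination {R : realType} (b : bool) (x1 x2 x3 x4 c t e : R)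
    (z : \bar R) :
  (b -> (x1%:E + c%:E * z + (t * x2)%:E <= (x3 + e * x4)%:E)%E) ->
  ((b%:R * x1)%:E + c%:E * ((b%:R)%:E * z) + t%:E * (b%:R * x2)%:E
   <= (b%:R * x3)%:E + e%:E * (b%:R * x4)%:E)%E.
Proof.
case: b => /= h; last by rewrite !mul0r mul0e !mule0 !adde0.
by rewrite !mul1r mul1e -!EFinM -EFinD; exact: h.
Qed.

Section critical.
Context {d : measure_display} {T : measurableType d} {R : realType}.
Variables (P : probability T R) (p : R) (X xi : {RV P >-> R}).
Variables (Xs : nat -> {RV P >-> R}) (eps : nat -> {RV P >-> bool})
  (U : nat -> {RV P >-> nat}) (xis : nat -> {RV P >-> R}).
Hypothesis p01 : 0 < p < 1.
Hypothesis driven : rwes_driven Xs eps U xis p X xi.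
Hypothesis xi_ge0 : {ae P, forall w, 0 <= xi w}.
Variables (m a : R).
Hypothesis xi1 : (\int[P]_w (`|xi w| `^ 1)%:E = m%:E)%E.
Hypothesis am : a = p * m.
Hypothesis a1 : 1 < a.
Variables (delta m' m'' l : R).
Hypothesis delta0 : 0 < delta.
Hypothesis xi_d : (\int[P]_w (`|xi w| `^ (1 + delta))%:E = m'%:E)%E.
Hypothesis xi_2d : (\int[P]_w (`|xi w| `^ (1 + 2 * delta))%:E = m''%:E)%E.
Hypothesis xlogx_int : P.-integrable setT (fun w => (`|xi w| * ln `|xi w|)%:E).
Hypothesis xlogxE : (\int[P]_w (`|xi w| * ln `|xi w|)%:E = l%:E)%E.
Hypothesis ml : m <= l.
Hypothesis gap : m * (1 + delta) < m'.

Let mxi : measurable_fun setT (fun w => `|xi w|). Proof. exact: measurableT_comp. Qed.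

Let mpow g : measurable_fun setT (fun w => (`|xi w| `^ g)%:E).
Proof. by apply/measurable_EFinP; exact: (measurableT_comp (measurable_powR g)). Qed.

Let ipow g c : (\int[P]_w (`|xi w| `^ g)%:E = c%:E)%E ->
  P.-integrable setT (fun w => (`|xi w| `^ g)%:E).
Proof.
move=> h; apply/integrableP; split => //.
under eq_integral do rewrite gee0_abs ?lee_fin ?powR_ge0//.
by rewrite h ltry.
Qed.

Let p0 : 0 < p. Proof. by case/andP : p01. Qed.
Let a0 : 0 < a. Proof. exact: lt_trans a1. Qed.

Let m''0 : 0 <= m''.
Proof. by rewrite -lee_fin -xi_2d integral_ge0// => w _; rewrite lee_fin powR_ge0. Qed.

(** * Evolution of the potential below a barrier *)

Section barrier.
Variables (K K' : R).
Hypothesis K1 : 1 <= K.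
Hypothesis KK' : K <= K'.
(** The mean truncation error from [entropy_potentialM_le], per unit of [x^(1 + delta)]. For fixed
    [K] it tends to 0 as [K'] grows, which is how [eta_gap] is met. *)
Let eta := (1 + delta^-1) * K' `^ (- delta) * K `^ delta * m''.
Hypothesis eta_gap : eta < m' - m * (1 + delta).
Let B := ln K' + K' `^ delta.
Local Notation k := (entropy_potential B delta).

Let K'1 : 1 <= K'. Proof. exact: le_trans KK'. Qed.
Let K0 : 0 < K. Proof. exact: lt_le_trans K1. Qed.
Let BK' : ln K' + K' `^ delta <= B. Proof. exact: lexx. Qed.

Lemma integral_entropy_potential x : 0 < x <= K ->
  (\int[P]_w (k (`|xi w| * x))%:E
   <= (x * (B - ln x) * m - x * l - x `^ (1 + delta) * (m' - eta))%:E)%E.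
Proof.
move=> xK.
pose c2 := (1 + delta^-1) * K' `^ (- delta) * K `^ delta * x `^ (1 + delta).
pose G w : \bar R := ((((x * (B - ln x))%:E * (`|xi w| `^ 1)%:E
  + (- x)%:E * (`|xi w| * ln `|xi w|)%:E)
  + (- x `^ (1 + delta))%:E * (`|xi w| `^ (1 + delta))%:E)
  + c2%:E * (`|xi w| `^ (1 + 2 * delta))%:E)%E.
have kG w : ((k (`|xi w| * x))%:E <= G w)%E.
  rewrite /G -!EFinM -!EFinD lee_fin powRr1//.
  have := entropy_potentialM_le delta0 K'1 BK' xK (normr_ge0 (xi w)).
  by move/le_trans; apply; rewrite !mulNr.
have i1 := integrableZl measurableT (x * (B - ln x)) (ipow xi1).
have i2 := integrableZl measurableT (- x) xlogx_int.
have i3 := integrableZl measurableT (- x `^ (1 + delta)) (ipow xi_d).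
have i4 := integrableZl measurableT c2 (ipow xi_2d).
have i12 := integrableD measurableT i1 i2.
have i123 := integrableD measurableT i12 i3.
apply: (@le_trans _ _ (\int[P]_w G w)%E).
  apply: ge0_le_integral => //.
  - by move=> w _; rewrite lee_fin entropy_potential_ge0.
  - apply/measurable_EFinP; apply: (measurableT_comp (measurable_entropy_potential _ _)).
    by apply: measurable_funM => //; exact: measurable_cst.
  - exact: measurable_int (integrableD measurableT i123 i4).
rewrite /G (integralD measurableT i123 i4) (integralD measurableT i12 i3).
rewrite (integralD measurableT i1 i2).
rewrite (integralZl measurableT (ipow xi1)) (integralZl measurableT xlogx_int).
rewrite (integralZl measurableT (ipow xi_d)) (integralZl measurableT (ipow xi_2d)).
rewrite xi1 xlogxE xi_d xi_2d -!EFinM -!EFinD lee_fin le_eqVlt; apply/orP; left; apply/eqP.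
by rewrite /c2 /eta; ring.
Qed.

Variable r : nat.
Local Notation step := (step Xs eps U xis (tree_spin r)).
Local Notation walk := (walk Xs eps U xis (tree_spin r)).
Local Notation W := (scaled_walk Xs eps U xis a (tree_spin r)).
Local Notation mfun_known D f :=
  (measurable_fun (setT : set (g_sigma_algebraType (known Xs eps U xis D))) f).

(** The whole history stays below the barrier. The event is known at time [n], decreases with [n],
    and bounds each normalised step by [K], as the estimates on the potential require. *)
Fixpoint alive n w : bool :=
  (if n is n'.+1 then alive n' w else true) && (W n w <= K).

Let mtree n : measurable_fun setT (@tree_spin R r n). Proof. exact: measurable_cst. Qed.
Let mW n : mfun_known (past n) (W n).
Proof.
by apply: measurable_funM; [exact: measurable_cst|exact: mfun_known_walk].
Qed.

Lemma mfun_known_alive n : mfun_known (past n) (alive n).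
Proof.
elim: n => [|n IH]; apply: measurable_and.
- exact: measurable_cst.
- by apply: measurable_fun_ler => //; exact: measurable_cst.
- by apply: mfun_knownS IH; exact: past_sub.
- by apply: measurable_fun_ler => //; exact: measurable_cst.
Qed.

Let malive n : measurable_fun setT (fun w => (alive n w)%:R : R).
Proof. exact: measurable_natr_bool (mfun_known_measurable (@mfun_known_alive n)). Qed.

Let mstep j : (1 <= j)%N -> measurable_fun setT (step j).
Proof. exact: measurable_step. Qed.

(** The step made at time [j], normalised at time [n]. *)
Let y n j w : R := n%:R `^ (- a) * step j w.

Let y0 n j w : 0 <= y n j w. Proof. by rewrite mulr_ge0 ?powR_ge0 ?step_ge0. Qed.

Let my n j : (1 <= j)%N -> measurable_fun setT (y n j).
Proof. by move=> j1; apply: measurable_funM; [exact: measurable_cst|exact: mstep]. Qed.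

Let WE n w : W n w = \sum_(1 <= j < n.+1) y n j w.
Proof. by rewrite /scaled_walk walkE mulr_sumr. Qed.

Let aliveW n w : alive n w -> W n w <= K.
Proof. by case: n => [|n] /=; [|move=> /andP[]]. Qed.

Let alive_y n j w : alive n w -> (1 <= j < n.+1)%N -> y n j w <= K.
Proof.
move=> aw jn; apply: le_trans (aliveW aw); rewrite WE.
rewrite (bigD1_seq j)/= ?iota_uniq ?mem_index_iota// lerDl sumr_ge0//.
Qed.

(** The net loss rate on powers of order [1 + delta], positive by [eta_gap]; [D0] collects the
    coefficients of the terms of order [n^-2]. *)
Let theta := p * (m' - eta) - a * (1 + delta).
Let D0 := a ^+ 2 + p * (m' - eta) * (a * (1 + delta)) * K `^ delta.

Let theta0 : 0 < theta.
Proof.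
rewrite /theta am -mulrA -mulrBr mulr_gt0// subr_gt0.
by have := eta_gap; lra.
Qed.

Let g0 : 0 <= m' - eta.
Proof.
have m0 : 0 < m by have := a0; rewrite am pmulr_rgt0.
have : 0 <= m * (1 + delta) by rewrite mulr_ge0 ?addr_ge0 ?ltW.
by have := eta_gap; lra.
Qed.

Let D00 : 0 <= D0.
Proof.
apply: addr_ge0; first exact: sqr_ge0.
apply: mulr_ge0; last exact: powR_ge0.
apply: mulr_ge0; first exact: (mulr_ge0 (ltW p0) g0).
by apply: mulr_ge0; [exact: ltW|exact: (addr_ge0 ler01 (ltW delta0))].
Qed.

Let ratio n : R := (n%:R / n.+1%:R) `^ a.

Let ratioE n : (0 < n)%N -> n.+1%:R `^ (- a) = ratio n * n%:R `^ (- a).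
Proof.
move=> n0; rewrite /ratio.
have nR : 0 < n%:R :> R by rewrite ltr0n.
have e : n.+1%:R^-1 `^ a = n.+1%:R `^ (- a) :> R.
  by rewrite -powR_inv1// -powRrM mulN1r.
rewrite powRM// e mulrAC [n%:R `^ (- a)]powRN divff ?mul1r// gt_eqF//.
exact: powR_gt0.
Qed.

Let yS n j w : (0 < n)%N -> y n.+1 j w = ratio n * y n j w.
Proof. by move=> n0; rewrite /y mulrA ratioE. Qed.

(** Each earlier step is charged with its own renormalisation and with its share of the mean
    potential of the new step; summing over [j] recovers the total. *)
Let potential_step n j w : (0 < n)%N -> alive n w -> (1 <= j < n.+1)%N ->
  ((k (y n.+1 j w))%:E + (p / n%:R)%:E * \int[P]_w' (k (`|xi w'| * y n.+1 j w))%:E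
   + (theta / n%:R * y n j w `^ (1 + delta))%:E
   <= (k (y n j w) + D0 / n%:R ^+ 2 * y n j w)%:E)%E.
Proof.
move=> n0 aw jn; have yK := alive_y aw jn; have yn0 := y0 n j w.
have nR : 0 < n%:R :> R by rewrite ltr0n.
have pn : 0 <= p / n%:R by rewrite divr_ge0 ?ltW.
rewrite yS//; move: yK yn0; set v := y n j w => vK v0.
have [->|vn] := eqVneq v 0.
  rewrite mulr0; under eq_integral do rewrite mulr0 entropy_potential0.
  rewrite integral0 mule0 adde0 entropy_potential0 powR0 ?mulr0 ?addr0//.
  by rewrite gt_eqF// addr_gt0.
have vp : 0 < v by rewrite lt_def vn.
have q0 : 0 < n%:R / n.+1%:R :> R by rewrite divr_gt0.
have c0 : 0 < ratio n by rewrite powR_gt0.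
have nn1 : n%:R / n.+1%:R = (1 + n%:R^-1)^-1 :> R.
  by rewrite -natr1; field; rewrite !gt_eqF//; lra.
have c1 : ratio n <= 1.
  have e1 : 1 `^ a = 1 :> R by rewrite powR1.
  rewrite -[leRHS]e1; apply: (ge0_ler_powR (ltW a0)); rewrite ?nnegrE ?(ltW q0)//.
  by rewrite ler_pdivrMr// mul1r ler_nat.
have cv : 0 < ratio n * v <= K.
  rewrite mulr_gt0//=; apply: le_trans vK; rewrite ger_pMl//.
have vvK : 0 < v <= K by rewrite vp.
have cc : 0 < ratio n <= 1 by rewrite c0.
have hstep := @entropy_potential_step R B delta delta0 K' K'1 BK' K v (ratio n) n%:R
  a p m l m' eta vvK KK' cc nR p0 a0 am ml.
apply: (@le_trans _ _ ((k (ratio n * v))%:E + (p / n%:R)%:E *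
   (ratio n * v * (B - ln (ratio n * v)) * m - ratio n * v * l
     - (ratio n * v) `^ (1 + delta) * (m' - eta))%:E
   + (theta / n%:R * v `^ (1 + delta))%:E)%E).
  rewrite leeD2r// leeD2l//; apply: lee_wpmul2l; first by rewrite lee_fin.
  exact: integral_entropy_potential.
rewrite -!EFinM -!EFinD lee_fin.
suff : k (ratio n * v) + p / n%:R *
   (ratio n * v * (B - ln (ratio n * v)) * m - ratio n * v * l
     - (ratio n * v) `^ (1 + delta) * (m' - eta)) <=
   k v - theta / n%:R * v `^ (1 + delta) + D0 / n%:R ^+ 2 * v by lra.
apply: hstep => //.
- have := natr_powR_scale a1 n0; rewrite ratioE// mulrA.
  by rewrite ger_pMl ?powR_gt0// mulrC.
- rewrite /ratio ln_powR nn1 lnV ?posrE ?addr_gt0 ?invr_gt0// mulrN opprK.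
  rewrite ler_pM2l//; apply: le_ln1Dx; apply: (@lt_trans _ _ 0) => //.
  by rewrite invr_gt0.
- rewrite /ratio -powRrM; apply: powRN_ge1 => //.
  by rewrite mulr_ge0 ?addr_ge0// ltW.
Qed.

Let mk : measurable_fun setT k. Proof. exact: measurable_entropy_potential. Qed.
Let k0 x : 0 <= k x. Proof. exact: entropy_potential_ge0. Qed.

Let mak n i j : (1 <= j)%N ->
  measurable_fun setT (fun w => ((alive n w)%:R * k (y i j w))%:E).
Proof.
move=> j1; apply/measurable_EFinP; apply: measurable_funM => //.
by apply: measurableT_comp => //; exact: my.
Qed.

Let may n j : (1 <= j)%N ->
  measurable_fun setT (fun w => ((alive n w)%:R * y n j w)%:E).
Proof. by move=> j1; apply/measurable_EFinP; apply: measurable_funM => //; exact: my. Qed.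

Let mayd n j : (1 <= j)%N ->
  measurable_fun setT (fun w => ((alive n w)%:R * y n j w `^ (1 + delta))%:E).
Proof.
move=> j1; apply/measurable_EFinP; apply: measurable_funM => //.
by apply: (measurableT_comp (measurable_powR _)); exact: my.
Qed.

Let Kb n j w : \bar R := (\int[P]_w' (k (`|xi w'| * y n.+1 j w))%:E)%E.

Let Kb0 n j w : (0 <= Kb n j w)%E.
Proof. by apply: integral_ge0 => w' _; rewrite lee_fin. Qed.

Let mKb n j : (1 <= j)%N -> measurable_fun setT (Kb n j).
Proof.
move=> j1; pose F (z : T * T) := (k (`|xi z.2| * y n.+1 j z.1))%:E.
apply: (@measurable_fun_fubini_tonelli_F _ _ T T R P F) => [|z]; last by rewrite lee_fin.
apply/measurable_EFinP; apply: measurableT_comp => //; apply: measurable_funM.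
  exact: (measurableT_comp mxi).
exact: (measurableT_comp (my _ j1)).
Qed.

Let potential_integral n j : (0 < n)%N -> (1 <= j < n.+1)%N ->
  (\int[P]_w ((alive n w)%:R * k (y n.+1 j w))%:E
   + (p / n%:R)%:E * \int[P]_w (((alive n w)%:R)%:E * Kb n j w)
   + (theta / n%:R)%:E * \int[P]_w ((alive n w)%:R * y n j w `^ (1 + delta))%:E
   <= \int[P]_w ((alive n w)%:R * k (y n j w))%:E
   + (D0 / n%:R ^+ 2)%:E * \int[P]_w ((alive n w)%:R * y n j w)%:E)%E.
Proof.
move=> n0 jn; have j1 : (1 <= j)%N by case/andP : jn.
have pn : 0 <= p / n%:R by rewrite divr_ge0// ltW.
have tn : 0 <= theta / n%:R by rewrite divr_ge0// ltW.
have dn : 0 <= D0 / n%:R ^+ 2 by rewrite divr_ge0// sqr_ge0.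
have e1 : (forall w, 0 <= ((alive n w)%:R * k (y n.+1 j w))%:E :> \bar R)%E.
  by move=> w; rewrite lee_fin mulr_ge0.
have e2 : (forall w, 0 <= (((alive n w)%:R)%:E * Kb n j w) :> \bar R)%E.
  by move=> w; rewrite mule_ge0 ?lee_fin.
have e3 : (forall w, 0 <= ((alive n w)%:R * y n j w `^ (1 + delta))%:E :> \bar R)%E.
  by move=> w; rewrite lee_fin mulr_ge0 ?powR_ge0.
have e4 : (forall w, 0 <= ((alive n w)%:R * k (y n j w))%:E :> \bar R)%E.
  by move=> w; rewrite lee_fin mulr_ge0.
have e5 : (forall w, 0 <= ((alive n w)%:R * y n j w)%:E :> \bar R)%E.
  by move=> w; rewrite lee_fin mulr_ge0.
have mE2 : measurable_fun setT (fun w => (((alive n w)%:R)%:E * Kb n j w)%E).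
  by apply: emeasurable_funM; [exact/measurable_EFinP|exact: mKb].
have m1 := @mak n n.+1 j j1; have m3 := @mayd n j j1.
have m4 := @mak n n j j1; have m5 := @may n j j1.
have s2 : measurable_fun setT (fun w => ((p / n%:R)%:E * (((alive n w)%:R)%:E * Kb n j w))%E).
  by apply: emeasurable_funM => //; exact: measurable_cst.
have s3 : measurable_fun setT (fun w => ((theta / n%:R)%:E * ((alive n w)%:R * y n j w `^ (1 + delta))%:E)%E).
  by apply: emeasurable_funM => //; exact: measurable_cst.
have s5 : measurable_fun setT (fun w => ((D0 / n%:R ^+ 2)%:E * ((alive n w)%:R * y n j w)%:E)%E).
  by apply: emeasurable_funM => //; exact: measurable_cst.
have ZD c F : 0 <= c -> measurable_fun setT F -> (forall w, 0 <= F w)%E ->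
    (c%:E * \int[P]_w F w = \int[P]_w (c%:E * F w))%E.
  by move=> c0 mF F0; rewrite ge0_integralZl ?lee_fin.
have ID F G : measurable_fun setT F -> measurable_fun setT G ->
    (forall w, 0 <= F w)%E -> (forall w, 0 <= G w)%E ->
    (\int[P]_w F w + \int[P]_w G w = \int[P]_w (F w + G w))%E.
  by move=> mF mG F0 G0; rewrite ge0_integralD.
rewrite (ZD _ _ pn mE2 e2) (ZD _ _ tn m3 e3) (ZD _ _ dn m5 e5).
have e2' w : (0 <= (p / n%:R)%:E * (((alive n w)%:R)%:E * Kb n j w))%E.
  by apply: mule_ge0; [rewrite lee_fin|exact: e2].
have e3' w : (0 <= (theta / n%:R)%:E * ((alive n w)%:R * y n j w `^ (1 + delta))%:E)%E.
  by apply: mule_ge0; [rewrite lee_fin|exact: e3].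
have e5' w : (0 <= (D0 / n%:R ^+ 2)%:E * ((alive n w)%:R * y n j w)%:E)%E.
  by apply: mule_ge0; [rewrite lee_fin|exact: e5].
have E1 := ID _ _ m1 s2 e1 e2'.
have E2 := ID _ _ (emeasurable_funD m1 s2) s3 (fun w => adde_ge0 (e1 w) (e2' w)) e3'.
have E3 := ID _ _ m4 s5 e4 e5'.
have hle (x x' z z' : \bar R) : x = x' -> z = z' -> (x' <= z' -> x <= z)%E by move=> -> ->.
apply: (hle _ _ _ _ (etrans (congr1 (fun z => (z + _)%E) E1) E2) E3).
apply: ge0_le_integral => //.
- by move=> w _; rewrite !adde_ge0.
- exact: (emeasurable_funD (emeasurable_funD m1 s2) s3).
- exact: (emeasurable_funD m4 s5).
by move=> w _; apply: lee_indicator_combination => aw; exact: potential_step.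
Qed.

Definition total_potential n : \bar R :=
  (\sum_(1 <= j < n.+1) \int[P]_w ((alive n w)%:R * k (y n j w))%:E)%E.
Definition total_power n : \bar R :=
  (\sum_(1 <= j < n.+1) \int[P]_w ((alive n w)%:R * y n j w `^ (1 + delta))%:E)%E.
Definition total_weight n : \bar R := (\int[P]_w ((alive n w)%:R * W n w)%:E)%E.

Let total_weightE n : total_weight n =
  (\sum_(1 <= j < n.+1) \int[P]_w ((alive n w)%:R * y n j w)%:E)%E.
Proof.
rewrite -ge0_integral_sum_nat.
- by apply: eq_integral => w _; rewrite WE mulr_sumr.
- by move=> j /andP[j1 _]; apply/measurable_EFinP; exact: may.
- by move=> j w; rewrite mulr_ge0.
Qed.

(** Passing from [alive n] to [alive n.+1] only decreases the nonnegative potential, so the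
    recursion can be computed on the event known at time [n]. *)
Let total_potentialS n : (0 < n)%N -> (r <= n)%N ->
  (total_potential n.+1 + (theta / n%:R)%:E * total_power n
   <= total_potential n + (D0 / n%:R ^+ 2)%:E * total_weight n)%E.
Proof.
move=> n0 rn.
have aliveS w : (alive n.+1 w)%:R <= (alive n w)%:R :> R.
  by rewrite /= ler_nat; case: (alive n w); case: (W n.+1 w <= K).
have mono j : (1 <= j)%N -> (\int[P]_w ((alive n.+1 w)%:R * k (y n.+1 j w))%:E <=
    \int[P]_w ((alive n w)%:R * k (y n.+1 j w))%:E)%E.
  move=> j1; apply: ge0_le_integral => //.
  - by move=> w _; rewrite lee_fin mulr_ge0.
  - exact: mak.
  - exact: mak.
  - by move=> w _; rewrite lee_fin ler_wpM2r.
have new : (\int[P]_w ((alive n w)%:R * k (y n.+1 n.+1 w))%:E =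
    (p / n%:R)%:E * \sum_(1 <= j < n.+1) \int[P]_w (((alive n w)%:R)%:E * Kb n j w))%E.
  have mphi : measurable_fun setT (fun x => k (n.+1%:R `^ (- a) * x)).
    by apply: measurableT_comp => //; apply: measurable_funM => //; exact: measurable_cst.
  have mal : mfun_known (past n) (fun w => (alive n w)%:R : R).
    exact: measurable_natr_bool (@mfun_known_alive n).
  have := @integral_one_step _ _ _ P p X xi Xs eps U xis p01 driven _ mtree
    (fun x => k (n.+1%:R `^ (- a) * x)) (fun w => (alive n w)%:R) n n0 mphi
    (fun x => k0 _) mal (fun w => ler0n _ _).
  rewrite -/(y n.+1 n.+1 _) => ->.
  rewrite [X in (_ * X * _ + _)%E](_ : _ = 0%E) ?mule0 ?mul0e ?add0e; last first.
    rewrite -[RHS](integral0 P setT); apply: eq_integral => w _.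
    (* No fresh spin enters: [r <= n] makes the spin at time [n.+1] vanish. *)
    by rewrite /spin /tree_spin gtn_eqF ?ltnS// mulr0 entropy_potential0.
  apply: (congr1 (fun z => ((p / n%:R)%:E * z)%E)); apply: eq_bigr => j _.
  apply: eq_integral => w _.
  apply: (congr1 (fun z => (((alive n w)%:R)%:E * z)%E)).
  apply: eq_integral => w' _.
  by rewrite /y mulrCA.
apply: (@le_trans _ _ (\sum_(1 <= j < n.+1)
   (\int[P]_w ((alive n w)%:R * k (y n.+1 j w))%:E
   + (p / n%:R)%:E * \int[P]_w (((alive n w)%:R)%:E * Kb n j w)
   + (theta / n%:R)%:E * \int[P]_w ((alive n w)%:R * y n j w `^ (1 + delta))%:E))%E).
  rewrite 2!big_split/=; apply: leeD; last first.
    rewrite ge0_sume_distrr// => j _; apply: integral_ge0 => w _.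
    by rewrite lee_fin mulr_ge0 ?powR_ge0.
  rewrite /total_potential big_nat_recr//=; apply: leeD.
    rewrite big_nat [leRHS]big_nat; apply: lee_sum => j /andP[j1 _].
    exact: mono.
  apply: (le_trans (mono n.+1 _)) => //; rewrite new ge0_sume_distrr// => j _.
  by apply: integral_ge0 => w _; rewrite mule_ge0 ?lee_fin.
rewrite total_weightE /total_potential ge0_sume_distrr; last first.
  by move=> j _; apply: integral_ge0 => w _; rewrite lee_fin mulr_ge0.
rewrite -[leRHS]big_split/= big_nat [leRHS]big_nat; apply: lee_sum => j jn.
exact: potential_integral.
Qed.

Let total_weight_le n : (total_weight n <= (zeta_bound a)%:E)%E.
Proof.
apply: (@le_trans _ _ (\int[P]_w (W n w)%:E)%E).
  have mWT : measurable_fun setT (W n) by exact: mfun_known_measurable (@mW n).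
  have W0 w : 0 <= W n w by rewrite WE sumr_ge0.
  apply: ge0_le_integral => //.
  - by move=> w _; rewrite lee_fin mulr_ge0.
  - by apply/measurable_EFinP; exact: measurable_funM.
  - exact/measurable_EFinP.
  - by move=> w _; rewrite lee_fin ler_piMl//; case: (alive n w).
apply: (@integral_scaled_walk _ _ _ P p X xi Xs eps U xis p01 driven m a xi1 am a1
  (tree_spin r) (fun n => (n == r)%:R)) => //.
- by move=> i i1; rewrite /spin /tree_spin integral_cst_prob.
- move=> i; apply: le_trans (sum_powRN_le i a1); apply: ler_sum => j _.
  by case: eqP => _; rewrite ?mulr1// mulr0 powR_ge0.
Qed.

Let B0 : 0 <= B. Proof. by rewrite addr_ge0 ?ln_ge0 ?powR_ge0. Qed.

Let bounded_integral_fin_num n (F : R -> R) c j : measurable_fun setT F ->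
  (forall x, 0 <= F x) -> (forall x, 0 <= x <= K -> F x <= c) -> (1 <= j < n.+1)%N ->
  (\int[P]_w ((alive n w)%:R * F (y n j w))%:E)%E \is a fin_num.
Proof.
move=> mF F0 Fc jn; have j1 : (1 <= j)%N by case/andP : jn.
rewrite ge0_fin_numE; last by apply: integral_ge0 => w _; rewrite lee_fin mulr_ge0.
apply: le_lt_trans (ltry c); rewrite -(integral_cst_prob P c).
have c0 : 0 <= c by apply: le_trans (Fc 0 _); rewrite // lexx ltW.
apply: ge0_le_integral => //.
- by move=> w _; rewrite lee_fin mulr_ge0.
- apply/measurable_EFinP; apply: measurable_funM => //.
  by apply: measurableT_comp => //; exact: my.
- move=> w _; rewrite lee_fin; have [aw|_] := boolP (alive n w).
    by rewrite mul1r; apply: Fc; rewrite y0 alive_y.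
  by rewrite mul0r.
Qed.

Let total_potential_fin n : total_potential n \is a fin_num.
Proof.
rewrite /total_potential big_nat; apply/sum_fin_numP => j _ jn.
apply: (@bounded_integral_fin_num n k (B * K + 1)) => // x /andP[x0 xK].
rewrite ge_max; apply/andP; split.
  by rewrite addr_ge0 ?mulr_ge0// ltW.
have [->|xn] := eqVneq x 0.
  by rewrite mul0r addr_ge0 ?mulr_ge0// ltW.
have xp : 0 < x by rewrite lt_def xn.
have h1 : x * B <= B * K by rewrite mulrC ler_wpM2l.
have h2 : x * - ln x <= 1.
  rewrite -ler_pdivlMl// mulr1 -lnV ?posrE//; apply/ltW/ln_sublinear.
  by rewrite invr_gt0.
have h3 : 0 <= x * x `^ delta by rewrite mulr_ge0 ?powR_ge0.
have -> : x * (B - ln x - x `^ delta) = x * B + x * - ln x - x * x `^ delta by ring.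
by lra.
Qed.

Let total_power_fin n : total_power n \is a fin_num.
Proof.
rewrite /total_power big_nat; apply/sum_fin_numP => j _ jn.
apply: (@bounded_integral_fin_num n (fun x => x `^ (1 + delta)) (K `^ (1 + delta))) => //.
- by move=> x; exact: powR_ge0.
- move=> x /andP[x0 xK]; apply: ge0_ler_powR; rewrite ?nnegrE// ?(ltW K0)//.
  exact: addr_ge0 ler01 (ltW delta0).
Qed.

Let total_potential_ge0 n : (0 <= total_potential n)%E.
Proof.
by apply: sume_ge0 => j _; apply: integral_ge0 => w _; rewrite lee_fin mulr_ge0.
Qed.

Let total_power_ge0 n : (0 <= total_power n)%E.
Proof.
apply: sume_ge0 => j _; apply: integral_ge0 => w _.
by rewrite lee_fin mulr_ge0 ?powR_ge0.
Qed.

(** [entropy_potential_dominates] applied to each step, all normalised steps being at most [K] while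
    alive. *)
Let total_weight_dominated Lam : 0 < Lam -> exists2 C, 0 <= C & forall n,
  (total_weight n <= (Lam^-1)%:E * total_potential n + C%:E * total_power n)%E.
Proof.
move=> L0; have KKK : 0 < K <= K' by rewrite K0 KK'.
have [C C0 hC] := entropy_potential_dominates delta0 K'1 BK' KKK L0.
have Li : 0 <= Lam^-1 by rewrite invr_ge0 ltW.
exists C => // n; rewrite total_weightE /total_potential /total_power.
rewrite !ge0_sume_distrr; last 2 first.
- by move=> j _; apply: integral_ge0 => w _; rewrite lee_fin mulr_ge0 ?powR_ge0.
- by move=> j _; apply: integral_ge0 => w _; rewrite lee_fin mulr_ge0.
rewrite -[leRHS]big_split/= big_nat [leRHS]big_nat; apply: lee_sum => j jn.
have j1 : (1 <= j)%N by case/andP : jn.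
have e1 w : (0 <= ((alive n w)%:R * k (y n j w))%:E)%E by rewrite lee_fin mulr_ge0.
have e2 w : (0 <= ((alive n w)%:R * y n j w `^ (1 + delta))%:E)%E.
  by rewrite lee_fin mulr_ge0 ?powR_ge0.
have ZD c F : 0 <= c -> measurable_fun setT F -> (forall w, 0 <= F w)%E ->
    (c%:E * \int[P]_w F w = \int[P]_w (c%:E * F w))%E.
  by move=> c0 mF F0; rewrite ge0_integralZl ?lee_fin.
have ID F G : measurable_fun setT F -> measurable_fun setT G ->
    (forall w, 0 <= F w)%E -> (forall w, 0 <= G w)%E ->
    (\int[P]_w F w + \int[P]_w G w = \int[P]_w (F w + G w))%E.
  by move=> mF mG F0 G0; rewrite ge0_integralD.
have m1 := @mak n n j j1; have m2 := @mayd n j j1.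
rewrite (ZD _ _ Li m1 e1) (ZD _ _ C0 m2 e2).
have s1 : measurable_fun setT (fun w => ((Lam^-1)%:E * ((alive n w)%:R * k (y n j w))%:E)%E).
  by apply: emeasurable_funM => //; exact: measurable_cst.
have s2 : measurable_fun setT (fun w => (C%:E * ((alive n w)%:R * y n j w `^ (1 + delta))%:E)%E).
  by apply: emeasurable_funM => //; exact: measurable_cst.
have e1' w : (0 <= (Lam^-1)%:E * ((alive n w)%:R * k (y n j w))%:E)%E.
  by apply: mule_ge0; [rewrite lee_fin|exact: e1].
have e2' w : (0 <= C%:E * ((alive n w)%:R * y n j w `^ (1 + delta))%:E)%E.
  by apply: mule_ge0; [rewrite lee_fin|exact: e2].
have E := ID _ _ s1 s2 e1' e2'.
have hle (x z z' : \bar R) : z = z' -> (x <= z' -> x <= z)%E by move=> ->.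
apply: (hle _ _ _ E); apply: ge0_le_integral => //.
- by move=> w _; rewrite lee_fin mulr_ge0.
- exact: may.
- exact: (emeasurable_funD s1 s2).
move=> w _; rewrite -!EFinM -EFinD lee_fin.
have [aw|_] := boolP (alive n w); last by rewrite !mul0r !mulr0 addr0.
by rewrite /= !mul1r; apply: hC; rewrite y0 alive_y.
Qed.

Let total_weight_small e : 0 < e -> infinitely_often (fun n => (total_weight n <= e%:E)%E).
Proof.
move=> e0 N.
pose h n := fine (total_potential n); pose q n := fine (total_power n).
have h0 n : 0 <= h n by exact: fine_ge0.
have q0 n : 0 <= q n by exact: fine_ge0.
have z0 : 0 <= zeta_bound a by rewrite addr_ge0// invr_ge0 subr_ge0 ltW.
have rec n : (0 < n)%N -> (r <= n)%N ->
    h n.+1 + theta / n%:R * q n <= h n + D0 * zeta_bound a / n%:R ^+ 2.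
  move=> n0 rn; have n2 : 0 <= D0 / n%:R ^+ 2 by rewrite divr_ge0 ?sqr_ge0.
  have -> : D0 * zeta_bound a / n%:R ^+ 2 = D0 / n%:R ^+ 2 * zeta_bound a.
    by rewrite mulrAC.
  exact: (fine_recursion (total_potential_fin n.+1) (total_power_fin n)
    (total_potential_fin n) n2 (total_weight_le n) (total_potentialS n0 rn)).
pose n0 := maxn 1 (maxn r N).
have n00 : (0 < n0)%N by rewrite leq_max.
have rn0 : (r <= n0)%N by rewrite !leq_max leqnn orbT.
have Nn0 : (N <= n0)%N by rewrite !leq_max leqnn !orbT.
have D0z : 0 <= D0 * zeta_bound a by rewrite mulr_ge0.
have [hb qs] := drift_dichotomy theta0 D0z n00 h0 q0
  (fun n nn => rec n (leq_trans n00 nn) (leq_trans rn0 nn)).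
set H := h n0 + 2 * (D0 * zeta_bound a) in hb.
have H0 : 0 <= H by rewrite addr_ge0// mulr_ge0.
(* With [H] bounding the potential, this makes the potential part at most [e / 2]. The constant [C]
   then depends on [Lam], and the power sum is afterwards taken small enough for [C]. *)
pose Lam := 2 * (H + 1) / e.
have Lam0 : 0 < Lam by rewrite divr_gt0// mulr_gt0// ltr_wpDl.
have [C C0 hC] := total_weight_dominated Lam0.
have eC : 0 < e / (2 * (C + 1)) by rewrite divr_gt0// mulr_gt0// ltr_wpDl.
have [n n0n qn] := qs _ eC.
exists n; first exact: leq_trans n0n.
apply: (le_trans (hC n)).
rewrite (_ : (_ + _)%E = (Lam^-1 * h n + C * q n)%:E); last first.
  by rewrite EFinD (EFinM Lam^-1) (EFinM C) /h /q !fineK.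
rewrite lee_fin [leRHS]splitr; apply: lerD.
  rewrite /Lam invf_div mulrAC ler_pdivrMr; last by rewrite mulr_gt0// ltr_wpDl.
  have -> : e / 2 * (2 * (H + 1)) = e * (H + 1) by field.
  apply: ler_wpM2l; first exact: ltW.
  by apply: (le_trans (hb n n0n)); rewrite lerDl.
apply: (@le_trans _ _ (C * (e / (2 * (C + 1))))); first by rewrite ler_wpM2l.
have C1 : 0 < C + 1 by rewrite ltr_wpDl.
have -> : C * (e / (2 * (C + 1))) = e / 2 * (C / (C + 1)) by field; rewrite gt_eqF.
apply: ler_piMr; first by rewrite divr_ge0// ltW.
by rewrite ler_pdivrMr// mul1r lerDl.
Qed.

(** Small means infinitely often are enough for Fatou's lemma, which bounds the mean of the inferior
    limit by every [e > 0]. *)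
Lemma ae_barrier_vanishes : {ae P, forall w,
  limn_einf (fun n => ((alive n w)%:R * W n w)%:E) = 0%E}.
Proof.
have mWT n : measurable_fun setT (W n) by exact: mfun_known_measurable (@mW n).
have W0 n w : 0 <= W n w by rewrite WE sumr_ge0.
have maW n : measurable_fun setT (fun w => ((alive n w)%:R * W n w)%:E).
  by apply/measurable_EFinP; exact: measurable_funM.
apply: ge0_integral_eq0_ae.
- exact: measurable_fun_limn_einf.
- by move=> w; apply: limn_einf_ge => n; rewrite lee_fin mulr_ge0.
- apply: (le_trans (fatou P measurableT maW _)).
    by move=> n w _; rewrite lee_fin mulr_ge0.
  apply/lee_addgt0Pr => e e0; rewrite add0e; apply: limn_einf_io_le.
  exact: total_weight_small.
Qed.

End barrier.
Let barrier_exists K : 1 <= K -> exists2 K', K <= K' &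
  (1 + delta^-1) * K' `^ (- delta) * K `^ delta * m'' < m' - m * (1 + delta).
Proof.
move=> K1; pose Q := (1 + delta^-1) * K `^ delta * m''; pose g := m' - m * (1 + delta).
have g0 : 0 < g by rewrite subr_gt0.
have di : 0 <= delta^-1 by rewrite invr_ge0 ltW.
have Q0 : 0 <= Q by rewrite !mulr_ge0 ?powR_ge0 ?addr_ge0.
(* The choice gives [Q < g * z], hence [Q / K'^delta < g] as soon as [K'^delta >= z]. *)
pose z := 2 * (Q + 1) / g.
have z0 : 0 < z by rewrite divr_gt0// mulr_gt0// ltr_wpDl.
pose K' := Num.max K (z `^ delta^-1).
have KK' : K <= K' by rewrite le_max lexx.
have K'0 : 0 < K' by apply: lt_le_trans KK'; exact: lt_le_trans K1.
exists K' => //.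
have zK : z <= K' `^ delta.
  have -> : z = (z `^ delta^-1) `^ delta by rewrite -powRrM mulVf ?gt_eqF// powRr1 ?ltW.
  apply: (ge0_ler_powR (ltW delta0)); rewrite ?nnegrE ?powR_ge0 ?(ltW K'0)//.
  by rewrite le_max lexx orbT.
have -> : (1 + delta^-1) * K' `^ (- delta) * K `^ delta * m'' = Q / K' `^ delta.
  by rewrite powRN /Q; ring.
rewrite ltr_pdivrMr ?powR_gt0// -/g; apply: (@lt_le_trans _ _ (g * z)); last first.
  by rewrite ler_pM2l.
have -> : g * z = 2 * (Q + 1) by rewrite /z; field; rewrite gt_eqF.
by lra.
Qed.

(** A convergent path is bounded, so it is alive forever for some integer barrier; its limit is then
    the inferior limit of the walk on that barrier, which is 0. *)
Theorem ae_critical_L_eq0 r : {ae P, forall w, L_ eps U xis a r w = 0}.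
Proof.
have van : {ae P, forall w, forall i : nat,
    limn_einf (fun n => ((alive i.+1%:R r n w)%:R *
      scaled_walk Xs eps U xis a (tree_spin r) n w)%:E) = 0%E}.
  apply: ae_forall_countable => i.
  have K1 : 1 <= i.+1%:R :> R by rewrite ler1n.
  have [K' KK' eta] := barrier_exists K1.
  exact: (ae_barrier_vanishes K1 KK' eta).
have lim := @ae_tree_limits _ _ _ P p X xi Xs eps U xis p01 driven xi_ge0 m a xi1 am a1.
apply: filterS2 van lim => w vw /(_ r) Lw.
have [C Cb] : exists C, forall n, scaled_walk Xs eps U xis a (tree_spin r) n w <= C.
  have /cvg_seq_bounded/bounded_fun_has_ubound[C hC] :
      cvgn (scaled_walk Xs eps U xis a (tree_spin r) ^~ w).
    by apply/cvg_ex; eexists; exact: Lw.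
  by exists C => n; apply: hC; exists n.
have C0 : C <= (Num.truncn C).+1%:R by apply/ltW/truncnS_gt.
have al n : alive (Num.truncn C).+1%:R r n w.
  by elim: n => [|n IH] /=; rewrite ?IH /= (le_trans (Cb _)).
have := vw (Num.truncn C); under eq_fun do rewrite al mul1r.
by have := lower_limitE Lw; rewrite /lower_limit => -> [].
Qed.

End critical.

(** * Moment bound in the subcritical case *)

Lemma lee_shrink {R : realType} (c : R) (x y : \bar R) :
  0 <= c <= 1 -> (0 <= x)%E -> (x <= y)%E -> (c%:E * x <= y)%E.
Proof.
move=> /andP[c0 c1] x0 xy; apply: le_trans xy; rewrite -[leRHS]mul1e.
by apply: lee_wpmul2r => //; rewrite lee_fin.
Qed.

Section subcritical.
Context {d : measure_display} {T : measurableType d} {R : realType}.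
Variables (P : probability T R) (p : R) (X xi : {RV P >-> R}).
Variables (Xs : nat -> {RV P >-> R}) (eps : nat -> {RV P >-> bool})
  (U : nat -> {RV P >-> nat}) (xis : nat -> {RV P >-> R}).
Hypothesis p01 : 0 < p < 1.
Hypothesis driven : rwes_driven Xs eps U xis p X xi.
Variables (m a : R).
Hypothesis xi1 : (\int[P]_w (`|xi w| `^ 1)%:E = m%:E)%E.
Hypothesis am : a = p * m.
Hypothesis a1 : 1 < a.
Variables (t mt : R).
Hypothesis t01 : 0 < t < 1.
Hypothesis xi_t : (\int[P]_w (`|xi w| `^ (1 + t))%:E = mt%:E)%E.
Hypothesis mtm : mt < (1 + t) * m.

Local Notation mfun_known D f :=
  (measurable_fun (setT : set (g_sigma_algebraType (known Xs eps U xis D))) f).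

Section spins.
Variables (g : R -> R) (mu mut : R).
Hypothesis mg : measurable_fun setT g.
Hypothesis g0 : forall x, 0 <= g x.
Hypothesis gmu : (\int[P]_w (g (X w))%:E <= mu%:E)%E.
Hypothesis gmut : (\int[P]_w (g (X w) `^ (1 + t))%:E <= mut%:E)%E.

Local Notation f := (fun _ : nat => g).
Local Notation spin := (spin Xs f).
Local Notation step := (step Xs eps U xis f).
Local Notation walk := (walk Xs eps U xis f).
Local Notation W := (scaled_walk Xs eps U xis a f).
Local Notation powsum := (powsum Xs eps U xis f).

Let mf (n : nat) : measurable_fun setT (f n). Proof. exact: mg. Qed.
Let f0 (n : nat) x : 0 <= f n x. Proof. exact: g0. Qed.

Let t0 : 0 < t. Proof. by case/andP : t01. Qed.
Let p0 : 0 < p. Proof. by case/andP : p01. Qed.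
Let a0 : 0 < a. Proof. exact: lt_trans a1. Qed.

Let mu0 : 0 <= mu.
Proof. by rewrite -lee_fin (le_trans _ gmu)// integral_ge0// => w _; rewrite lee_fin. Qed.

Let mut0 : 0 <= mut.
Proof.
by rewrite -lee_fin (le_trans _ gmut)// integral_ge0// => w _; rewrite lee_fin powR_ge0.
Qed.

Let mt0 : 0 <= mt.
Proof. by rewrite -lee_fin -xi_t integral_ge0// => w _; rewrite lee_fin powR_ge0. Qed.

Let spin_powR e n : (1 <= n)%N ->
  (\int[P]_w (spin n w `^ e)%:E = \int[P]_w (g (X w) `^ e)%:E)%E.
Proof.
move=> n1; rewrite (@integral_same_law _ _ _ _ _ P (Xs n) X (fun x => (g x `^ e)%:E))//.
- exact: spin_law driven _ n1.
- by apply/measurable_EFinP; exact: (measurableT_comp (measurable_powR e)).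
- by move=> x; rewrite lee_fin powR_ge0.
Qed.

Let spin_mu n : (1 <= n)%N -> (\int[P]_w (spin n w `^ 1)%:E <= mu%:E)%E.
Proof.
by move=> n1; rewrite spin_powR//; under eq_integral do rewrite powRr1//.
Qed.

Let spin_mut n : (1 <= n)%N -> (\int[P]_w (spin n w `^ (1 + t))%:E <= mut%:E)%E.
Proof. by move=> n1; rewrite spin_powR. Qed.

(** The growth exponent used for the sum of powers of order [1 + t]; the maximum keeps it above 1.
    By [mtm] it is strictly less than [(1 + t) * a], so the individual steps are negligible against
    the [(1 + t)]-th power of the walk. *)
Let b := Num.max (p * mt) a.
Let b1 : 1 < b. Proof. by rewrite lt_max a1 orbT. Qed.
Let bp : p * mt <= b. Proof. by rewrite le_max lexx. Qed.
Let bga : b < (1 + t) * a.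
Proof.
rewrite gt_max am; apply/andP; split; first by rewrite mulrCA ltr_pM2l.
by rewrite -am ltr_pMl// ltrDl.
Qed.

Let zeta s : R := 1 + (s - 1)^-1.

Let integral_powsum_le n : (1 <= n)%N ->
  (\int[P]_w (powsum (1 + t) n w)%:E <= (n%:R `^ b * (mut * zeta b))%:E)%E.
Proof.
case: n => // n _.
have h := @integral_scaled_powsum _ _ _ P p X xi Xs eps U xis p01 driven f mf f0
  (1 + t) mt xi_t b (fun=> mut) b1 bp (fun n => @spin_mut n) n.
have np : 0 < n.+1%:R `^ b :> R by rewrite powR_gt0.
have e : (\int[P]_w (scaled_powsum Xs eps U xis f (1 + t) b n w)%:E =
    (n.+1%:R `^ (- b))%:E * \int[P]_w (powsum (1 + t) n.+1 w)%:E)%E.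
  rewrite -ge0_integralZl ?lee_fin ?powR_ge0//.
  - by apply/measurable_EFinP; exact: measurable_powsum.
  - by move=> w _; rewrite lee_fin powsum_ge0.
rewrite e powRN in h.
rewrite lee_pdivrMl// in h; apply: (le_trans h).
rewrite -EFinM lee_fin ler_pM2l// -mulr_suml mulrC ler_wpM2l//.
exact: sum_powRN_le.
Qed.

Let walk_mean n : (\int[P]_w (W n w)%:E <= (mu * zeta a)%:E)%E.
Proof.
apply: (@integral_scaled_walk _ _ _ P p X xi Xs eps U xis p01 driven m a xi1 am a1
  f (fun=> mu)) => //.
- by move=> i i1; under eq_integral do rewrite -[spin _ _]powRr1 ?spin_ge0//; exact: spin_mu.
- by move=> i; rewrite -mulr_suml mulrC ler_wpM2l//; exact: sum_powRN_le.
Qed.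

(** After normalisation, [x^t <= 1 + x] reduces the power to the bounded mean. *)
Let walk_pow_t n : (1 <= n)%N ->
  (\int[P]_w (walk n w `^ t)%:E <= (n%:R `^ (a * t) * (1 + mu * zeta a))%:E)%E.
Proof.
move=> n1; have nR : 0 < n%:R :> R by rewrite ltr0n.
have mW : measurable_fun setT (W n) by exact: measurable_scaled_walk.
have W0 w : 0 <= W n w by exact: scaled_walk_ge0.
apply: (@le_trans _ _ (\int[P]_w ((n%:R `^ (a * t))%:E * (1 + (W n w)%:E)))%E).
  apply: ge0_le_integral => //.
  - by move=> w _; rewrite lee_fin powR_ge0.
  - apply/measurable_EFinP; apply: (measurableT_comp (measurable_powR _)).
    exact: measurable_walk.
  - apply: emeasurable_funM; first exact: measurable_cst.
    by apply: emeasurable_funD; [exact: measurable_cst|exact/measurable_EFinP].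
  - move=> w _; rewrite -EFinD -EFinM lee_fin.
    have -> : walk n w = n%:R `^ a * W n w.
      by rewrite /scaled_walk mulrA powRN divff ?mul1r// gt_eqF// powR_gt0.
    rewrite powRM ?powR_ge0// -powRrM ler_wpM2l ?powR_ge0//.
    have [W1|W1] := leP (W n w) 1.
      apply: (@le_trans _ _ 1); last by rewrite lerDl.
      have e1 : 1 `^ t = 1 :> R by rewrite powR1.
      by rewrite -[leRHS]e1; apply: (ge0_ler_powR (ltW t0)); rewrite ?nnegrE.
    apply: (@le_trans _ _ (W n w)); last by rewrite lerDr.
    by apply: ler1_powR; [exact: ltW|case/andP : t01 => _ /ltW].
rewrite ge0_integralZl ?lee_fin ?powR_ge0//; last 2 first.
- by apply: emeasurable_funD; [exact: measurable_cst|exact/measurable_EFinP].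
- by move=> w _; rewrite adde_ge0// lee_fin.
rewrite EFinM; apply: lee_wpmul2l; first by rewrite lee_fin powR_ge0.
rewrite ge0_integralD//; last 2 first.
- by move=> w _; rewrite lee_fin.
- exact/measurable_EFinP.
by rewrite integral_cst_prob EFinD; apply: leeD => //; exact: walk_mean.
Qed.

Let Ez n : \bar R := (\int[P]_w (walk n w `^ (1 + t))%:E)%E.

Let mwalkp e n : measurable_fun setT (fun w => walk n w `^ e).
Proof. by apply: (measurableT_comp (measurable_powR e)); exact: measurable_walk. Qed.

Let mstepp e n : (1 <= n)%N -> measurable_fun setT (fun w => step n w `^ e).
Proof. by move=> n1; apply: (measurableT_comp (measurable_powR e)); exact: measurable_step. Qed.

(** [powR_taylor] with the walk and its next step. In the linear term the one-step identity is
    tested against the [t]-th power of the walk and returns its [(1 + t)]-th power, whence the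
    growth factor [1 + (1 + t) a / n]. *)
Let moment_step n (A1 A2 A3 : R) : (1 <= n)%N -> (Ez n <= A1%:E)%E ->
  (\int[P]_w (walk n w `^ t)%:E <= A2%:E)%E ->
  (\int[P]_w (powsum (1 + t) n w)%:E <= A3%:E)%E ->
  (Ez n.+1 <= (A1 + (1 + t) * (mu * A2 + a / n%:R * A1)
               + (mut + p * mt / n%:R * A3))%:E)%E.
Proof.
move=> n1 h1 h2 h3.
have tp : 0 <= 1 + t by rewrite addr_ge0// ltW.
have p1 : 0 <= 1 - p by case/andP : p01 => _ /ltW; rewrite subr_ge0.
have p1' : 0 <= 1 - p <= 1 by rewrite p1 gerBl ltW.
have an : 0 <= a / n%:R by rewrite divr_ge0// ltW.
have ptn : 0 <= p * mt / n%:R by rewrite divr_ge0// mulr_ge0// ltW.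
have W0 w : 0 <= walk n w by exact: walk_ge0.
have S0 w : 0 <= step n.+1 w by exact: step_ge0.
have m1 := mwalkp (1 + t) n.
have m2 : measurable_fun setT (fun w => walk n w `^ t * step n.+1 w `^ 1).
  by apply: measurable_funM => //; exact: mstepp.
have m3 : measurable_fun setT (fun w => 1 * step n.+1 w `^ (1 + t)).
  by apply: measurable_funM; [exact: measurable_cst|exact: mstepp].
pose F1 w := (walk n w `^ (1 + t))%:E.
pose F2 w := ((1 + t)%:E * (walk n w `^ t * step n.+1 w `^ 1)%:E)%E.
pose F3 w := (1 * step n.+1 w `^ (1 + t))%:E.
have e1 w : (0 <= F1 w)%E by rewrite lee_fin powR_ge0.
have e2' w : (0 <= (walk n w `^ t * step n.+1 w `^ 1)%:E)%E by rewrite lee_fin mulr_ge0 ?powR_ge0.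
have e2 w : (0 <= F2 w)%E by apply: mule_ge0; [rewrite lee_fin|exact: e2'].
have e3 w : (0 <= F3 w)%E by rewrite lee_fin mul1r powR_ge0.
have s1 : measurable_fun setT F1 by exact/measurable_EFinP.
have s2 : measurable_fun setT F2.
  by apply: emeasurable_funM; [exact: measurable_cst|exact/measurable_EFinP].
have s3 : measurable_fun setT F3 by exact/measurable_EFinP.
apply: (@le_trans _ _ (\int[P]_w (F1 w + F2 w + F3 w))%E).
  apply: ge0_le_integral => //.
  - by move=> w _; rewrite lee_fin powR_ge0.
  - by apply/measurable_EFinP; exact: mwalkp.
  - exact: (emeasurable_funD (emeasurable_funD s1 s2) s3).
  - move=> w _; rewrite /F1 /F2 /F3 -EFinM -!EFinD lee_fin walkS mul1r powRr1//.
    exact: powR_taylor.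
rewrite (ge0_integralD P measurableT (fun w _ => adde_ge0 (e1 w) (e2 w))
  (emeasurable_funD s1 s2) (fun w _ => e3 w) s3).
rewrite (ge0_integralD P measurableT (fun w _ => e1 w) s1 (fun w _ => e2 w) s2).
have i2 : (\int[P]_w F2 w <= ((1 + t) * (mu * A2 + a / n%:R * A1))%:E)%E.
  rewrite /F2 ge0_integralZl ?lee_fin//; last exact/measurable_EFinP.
  rewrite EFinM; apply: lee_wpmul2l; first by rewrite lee_fin.
  have mH : mfun_known (past n) (fun w => walk n w `^ t).
    by apply: (measurableT_comp (measurable_powR t)); exact: mfun_known_walk.
  have H0 w : 0 <= walk n w `^ t by exact: powR_ge0.
  rewrite (integral_step_powR p01 driven mf f0 xi1 n1 mH H0) (EFinD (mu * A2)); apply: leeD.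
    rewrite (EFinM mu); apply: lee_pmul => //.
    - apply: mule_ge0; first by rewrite lee_fin.
      by apply: integral_ge0 => w _; rewrite lee_fin powR_ge0.
    - by apply: integral_ge0 => w _; rewrite lee_fin.
    - apply: lee_shrink p1' _ (spin_mu (ltn0Sn n)).
      by apply: integral_ge0 => w _; rewrite lee_fin powR_ge0.
  rewrite -am (EFinM (a / n%:R)); apply: lee_wpmul2l; first by rewrite lee_fin.
  apply: le_trans h1; rewrite le_eqVlt; apply/orP; left; apply/eqP.
  apply: eq_integral => w _; rewrite powsum1//; congr (_%:E).
  by rewrite powR1D// mulrC.
have i3 : (\int[P]_w F3 w <= (mut + p * mt / n%:R * A3)%:E)%E.
  have mc : mfun_known (past n) (fun _ : T => 1 : R) by exact: measurable_cst.
  rewrite /F3 (integral_step_powR p01 driven mf f0 xi_t n1 mc (fun=> ler01)).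
  rewrite integral_cst_prob mule1 (EFinD mut); apply: leeD.
    apply: lee_shrink p1' _ (spin_mut (ltn0Sn n)).
    by apply: integral_ge0 => w _; rewrite lee_fin powR_ge0.
  rewrite (EFinM (p * mt / n%:R)); apply: lee_wpmul2l; first by rewrite lee_fin.
  by under eq_integral do rewrite mul1r.
rewrite (EFinD _ (mut + _)) (EFinD A1); apply: leeD => //; exact: leeD.
Qed.

Let ga := (1 + t) * a.
Let ga1 : 1 < ga.
Proof. by apply: (lt_trans a1); rewrite ltr_pMl// ltrDl. Qed.

(** The three error terms of [moment_step] divided by [n^ga], at [n = k.+1]. The exponents [a], [ga]
    and [ga - b + 1] all exceed 1, the last one by [bga], so the sum converges. *)
Let rest k : R := (1 + t) * mu * (1 + mu * zeta a) * k.+1%:R `^ (- a)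
  + mut * k.+1%:R `^ (- ga) + p * mt * (mut * zeta b) * k.+1%:R `^ (- (ga - b + 1)).

Let zeta_ge0 s : 1 < s -> 0 <= zeta s.
Proof. by move=> s1; rewrite addr_ge0// invr_ge0 subr_ge0 ltW. Qed.

Let rest0 k : 0 <= rest k.
Proof.
have := zeta_ge0 a1; have := zeta_ge0 b1 => zb za.
apply: addr_ge0; [apply: addr_ge0|]; (apply: mulr_ge0; last exact: powR_ge0) => //.
- apply: mulr_ge0; first by apply: mulr_ge0 => //; exact: addr_ge0 ler01 (ltW t0).
  by apply: addr_ge0 => //; exact: mulr_ge0.
- apply: mulr_ge0; last exact: mulr_ge0.
  by apply: mulr_ge0 => //; exact: ltW.
Qed.

(** The growth factor [1 + ga / n] is absorbed by [natr_powR_scale] with exponent [ga], leaving only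
    the accumulated [rest]. *)
Let moment_bound n :
  (Ez n.+1 <= (n.+1%:R `^ ga * (mut + \sum_(0 <= k < n) rest k))%:E)%E.
Proof.
elim: n => [|n IH].
  rewrite big_geq// addr0 powR1 mul1r; apply: le_trans (spin_mut (ltn0Sn 0)).
  rewrite le_eqVlt; apply/orP; left; apply/eqP; apply: eq_integral => w _.
  by rewrite walkE big_nat1 /step echoed1.
have N1 : (1 <= n.+1)%N by [].
have h := moment_step N1 IH (walk_pow_t N1) (integral_powsum_le N1).
apply: (le_trans h); rewrite lee_fin big_nat_recr//=.
set S := mut + _; have S0 : 0 <= S by rewrite addr_ge0// sumr_ge0.
have NR : 0 < n.+1%:R :> R by [].
have Nn : n.+1%:R != 0 :> R by rewrite pnatr_eq0.
have s1 : (1 + ga / n.+1%:R) * n.+1%:R `^ ga <= n.+2%:R `^ ga.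
  have := natr_powR_scale ga1 N1; rewrite !powRN.
  by rewrite ler_pdivrMr ?powR_gt0// ler_pdivlMl ?powR_gt0// mulrC.
have s2 : n.+1%:R `^ ga <= n.+2%:R `^ ga :> R.
  apply: ge0_ler_powR; rewrite ?nnegrE// ?ler_nat//.
  by apply: ltW; exact: lt_trans ga1.
have r1 : n.+1%:R `^ (a * t) = n.+1%:R `^ ga * n.+1%:R `^ (- a) :> R.
  rewrite -powRD ?Nn ?implybT//; congr (_ `^ _); rewrite /ga; ring.
have r2 : n.+1%:R `^ ga * n.+1%:R `^ (- ga) = 1 :> R.
  by rewrite powRN divff// gt_eqF// powR_gt0.
have r3 : n.+1%:R `^ b / n.+1%:R = n.+1%:R `^ ga * n.+1%:R `^ (- (ga - b + 1)) :> R.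
  rewrite -powRD ?Nn ?implybT// -[X in _ / X]powRr1// -powRB ?Nn ?implybT//.
  by congr (_ `^ _); ring.
apply: (@le_trans _ _ ((1 + ga / n.+1%:R) * n.+1%:R `^ ga * S + n.+1%:R `^ ga * rest n)).
  have e1 : mut = n.+1%:R `^ ga * (mut * n.+1%:R `^ (- ga)) by rewrite mulrCA r2 mulr1.
  have e2 : p * mt / n.+1%:R * (n.+1%:R `^ b * (mut * zeta b)) =
      n.+1%:R `^ ga * (p * mt * (mut * zeta b) * n.+1%:R `^ (- (ga - b + 1))).
    transitivity (p * mt * (mut * zeta b) * (n.+1%:R `^ b / n.+1%:R)); first by ring.
    by rewrite r3; ring.
  rewrite r1 e2 {1}e1 le_eqVlt; apply/orP; left; apply/eqP.
  rewrite /rest; set G := _ `^ ga; set A := _ `^ (- a).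
  set Gi := _ `^ (- ga); set Q := _ `^ (- (ga - b + 1)); rewrite /ga; ring.
rewrite [X in _ <= _ * X]addrA -/S [leRHS]mulrDr; apply: lerD; exact: ler_wpM2r.
Qed.

Lemma walk_moment_bound : exists2 C, 0 <= C &
  forall n, (\int[P]_w (W n w `^ (1 + t))%:E <= C%:E)%E.
Proof.
pose C := mut + ((1 + t) * mu * (1 + mu * zeta a) * zeta a + mut * zeta ga
  + p * mt * (mut * zeta b) * zeta (ga - b + 1)).
have gb1 : 1 < ga - b + 1 by have := bga; rewrite -/ga; lra.
have za := zeta_ge0 a1; have zb := zeta_ge0 b1; have zg := zeta_ge0 ga1.
have zgb := zeta_ge0 gb1.
have t1 : 0 <= 1 + t by rewrite addr_ge0// ltW.
have c1 : 0 <= (1 + t) * mu * (1 + mu * zeta a).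
  exact: mulr_ge0 (mulr_ge0 t1 mu0) (addr_ge0 ler01 (mulr_ge0 mu0 za)).
have c3 : 0 <= p * mt * (mut * zeta b).
  exact: mulr_ge0 (mulr_ge0 (ltW p0) mt0) (mulr_ge0 mut0 zb).
have C0 : 0 <= C.
  by apply: addr_ge0 => //; apply: addr_ge0; [apply: addr_ge0|]; exact: mulr_ge0.
have Sn n : mut + \sum_(0 <= k < n) rest k <= C.
  rewrite lerD2l !big_split/= -!mulr_sumr; apply: lerD; first apply: lerD.
  - by apply: ler_wpM2l => //; exact: sum_powRN_le.
  - by apply: ler_wpM2l => //; exact: sum_powRN_le.
  - by apply: ler_wpM2l => //; exact: sum_powRN_le.
exists C => // -[|n].
  under eq_integral do rewrite /scaled_walk walkE big_geq// mulr0 powR0 ?gt_eqF ?addr_gt0//.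
  by rewrite integral0 lee_fin.
have NR : 0 < n.+1%:R `^ ga :> R by rewrite powR_gt0.
have -> : (\int[P]_w (W n.+1 w `^ (1 + t))%:E = (n.+1%:R `^ ga)^-1%:E * Ez n.+1)%E.
  rewrite -ge0_integralZl ?lee_fin ?invr_ge0 ?ltW//.
  - apply: eq_integral => w _; rewrite -EFinM; congr (_%:E).
    rewrite /scaled_walk powRM ?powR_ge0 ?walk_ge0// -powRrM -powRN; congr (_ `^ _ * _).
    by rewrite /ga; ring.
  - by apply/measurable_EFinP; exact: mwalkp.
  - by move=> w _; rewrite lee_fin powR_ge0.
rewrite lee_pdivrMl//; apply: (le_trans (moment_bound n)).
by rewrite -EFinM lee_fin ler_pM2l.
Qed.

End spins.
End subcritical.

(** * Uniform integrability *)

Lemma cvgn_minr {R : realType} (x : nat -> R) (l B : R) :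
  x n @[n --> \oo] --> l -> Num.min (x n) B @[n --> \oo] --> Num.min l B.
Proof.
move=> /cvgrPdist_le xl; apply/cvgrPdist_le => e e0.
have [N _ hN] := xl e e0; exists N => // n /= /hN /=.
rewrite !ler_distl => /andP[h1 h2].
by case: (leP (x n) B) => ?; case: (leP l B) => ?; apply/andP; split; lra.
Qed.

Section uniform_integrability.
Context {d : measure_display} {T : measurableType d} {R : realType}.
Variables (P : probability T R) (H : T -> R).
Hypothesis mH : measurable_fun setT H.
Hypothesis H01 : forall w, 0 <= H w <= 1.

Let H0 w : 0 <= H w. Proof. by case/andP : (H01 w). Qed.

Section truncation.
Variables (M : T -> R) (B : R).
Hypothesis mM : measurable_fun setT M.
Hypothesis M0 : forall w, 0 <= M w.
Hypothesis B0 : 0 < B.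

Let mmin : measurable_fun setT (fun w => Num.min (M w) B).
Proof. by apply: measurable_minr => //; exact: measurable_cst. Qed.

Let mHmin : measurable_fun setT (fun w => (H w * Num.min (M w) B)%:E).
Proof. by apply/measurable_EFinP; exact: measurable_funM. Qed.

Lemma measurable_excess : measurable_fun setT (fun w => (H w * (M w - Num.min (M w) B))%:E).
Proof. by apply/measurable_EFinP; apply: measurable_funM => //; exact: measurable_funB. Qed.

Let min0 w : 0 <= Num.min (M w) B. Proof. by rewrite le_min M0 ltW. Qed.
Lemma excess_ge0 w : 0 <= M w - Num.min (M w) B. Proof. by rewrite subr_ge0 ge_min lexx. Qed.

Lemma integral_min_le : (\int[P]_w (H w * Num.min (M w) B)%:E <= B%:E)%E.
Proof.
rewrite -(integral_cst_prob P B); apply: ge0_le_integral => //.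
- by move=> w _; rewrite lee_fin mulr_ge0.
- move=> w _; rewrite lee_fin; apply: (@le_trans _ _ (1 * Num.min (M w) B)).
    by rewrite ler_wpM2r//; case/andP : (H01 w).
  by rewrite mul1r ge_min lexx orbT.
Qed.

(** The excess vanishes unless [M > B], where [M <= B^(- t) M^(1 + t)]. *)
Lemma integral_excess_moment t C : 0 < t ->
  (\int[P]_w (M w `^ (1 + t))%:E <= C%:E)%E ->
  (\int[P]_w (H w * (M w - Num.min (M w) B))%:E <= (C * B `^ (- t))%:E)%E.
Proof.
move=> t0 MC.
have mMt : measurable_fun setT (fun w => (M w `^ (1 + t))%:E).
  by apply/measurable_EFinP; exact: (measurableT_comp (measurable_powR _)).
apply: (@le_trans _ _ (\int[P]_w ((B `^ (- t))%:E * (M w `^ (1 + t))%:E))%E).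
  apply: ge0_le_integral => //.
  - by move=> w _; rewrite lee_fin mulr_ge0// excess_ge0.
  - exact: measurable_excess.
  - by apply: emeasurable_funM => //; exact: measurable_cst.
  - move=> w _; rewrite -EFinM lee_fin; have [MB|BM] := leP (M w) B.
      by rewrite subrr mulr0 mulr_ge0 ?powR_ge0.
    apply: (@le_trans _ _ (M w)).
      apply: (@le_trans _ _ (1 * (M w - B))).
        by rewrite ler_wpM2r ?subr_ge0 ?(ltW BM)//; case/andP : (H01 w).
      by rewrite mul1r gerBl ltW.
    rewrite powR1D// mulrCA ler_peMr// powRN ler_pdivlMl ?powR_gt0// mulr1.
    by apply: (ge0_ler_powR (ltW t0)); rewrite ?nnegrE ?M0 ?(ltW B0) ?(ltW BM).
rewrite ge0_integralZl ?lee_fin ?powR_ge0//; last first.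
  by move=> w _; rewrite lee_fin powR_ge0.
by rewrite mulrC EFinM; apply: lee_wpmul2l => //; rewrite lee_fin powR_ge0.
Qed.

Variable c : R.
Hypothesis excess_c : (\int[P]_w (H w * (M w - Num.min (M w) B))%:E <= c%:E)%E.

Let splitM : (\int[P]_w (H w * M w)%:E = \int[P]_w (H w * Num.min (M w) B)%:E
   + \int[P]_w (H w * (M w - Num.min (M w) B))%:E)%E.
Proof.
rewrite -(ge0_integralD P measurableT _ mHmin _ measurable_excess).
- by apply: eq_integral => w _; rewrite -EFinD -mulrDr addrC subrK.
- by move=> w _; rewrite lee_fin mulr_ge0.
- by move=> w _; rewrite lee_fin mulr_ge0// excess_ge0.
Qed.

Let fin1 : (\int[P]_w (H w * Num.min (M w) B)%:E)%E \is a fin_num.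
Proof.
rewrite ge0_fin_numE; last by apply: integral_ge0 => w _; rewrite lee_fin mulr_ge0.
exact: le_lt_trans integral_min_le (ltry _).
Qed.

Let fin2 : (\int[P]_w (H w * (M w - Num.min (M w) B))%:E)%E \is a fin_num.
Proof.
rewrite ge0_fin_numE; first exact: le_lt_trans excess_c (ltry _).
by apply: integral_ge0 => w _; rewrite lee_fin mulr_ge0// excess_ge0.
Qed.

Lemma integral_ui_fin : (\int[P]_w (H w * M w)%:E)%E \is a fin_num.
Proof. by rewrite splitM fin_numD fin1 fin2. Qed.

Lemma fine_truncation :
  `|fine (\int[P]_w (H w * M w)%:E) - fine (\int[P]_w (H w * Num.min (M w) B)%:E)| <= c.
Proof.
rewrite splitM fineD// addrC addKr ger0_norm; last first.
  by apply: fine_ge0; apply: integral_ge0 => w _; rewrite lee_fin mulr_ge0// excess_ge0.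
by rewrite -lee_fin fineK.
Qed.

End truncation.

Variables (t C : R) (M : nat -> T -> R) (Y : T -> R).
Hypothesis t0 : 0 < t.
Hypothesis C0 : 0 <= C.
Hypothesis mM : forall n, measurable_fun setT (M n).
Hypothesis M0 : forall n w, 0 <= M n w.
Hypothesis MC : forall n, (\int[P]_w (M n w `^ (1 + t))%:E <= C%:E)%E.
Hypothesis mY : measurable_fun setT Y.
Hypothesis Y0 : forall w, 0 <= Y w.
Hypothesis MY : {ae P, forall w, M n w @[n --> \oo] --> Y w}.

(** Fatou's lemma passes the bound on the excess to the limit. *)
Let excess_limit B : 0 < B ->
  (\int[P]_w (H w * (Y w - Num.min (Y w) B))%:E <= (C * B `^ (- t))%:E)%E.
Proof.
move=> B0; pose F n w := (H w * (M n w - Num.min (M n w) B))%:E.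
have mF n : measurable_fun setT (F n) by exact: measurable_excess.
have F0 n w : setT w -> (0 <= F n w)%E by move=> _; rewrite lee_fin mulr_ge0// excess_ge0.
have -> : (\int[P]_w (H w * (Y w - Num.min (Y w) B))%:E =
    \int[P]_w limn_einf (F ^~ w))%E.
  apply: ae_eq_integral => //.
  - exact: measurable_excess.
  - exact: measurable_fun_limn_einf.
  - apply: filterS MY => w Mw _; apply/esym.
    have h : F n w @[n --> \oo] --> (H w * (Y w - Num.min (Y w) B))%:E.
      apply: cvg_EFin; first exact: nearW.
      by apply: cvgMr; apply: cvgB => //; exact: cvgn_minr.
    exact: (cvg_limn_einf_sup h).1.
apply: (le_trans (fatou P measurableT mF F0)); apply: limn_einf_le => n.
exact: integral_excess_moment.
Qed.

Lemma integral_limit_fin : (\int[P]_w (H w * Y w)%:E)%E \is a fin_num.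
Proof. exact: integral_ui_fin (excess_limit ltr01). Qed.

(** Dominated convergence for the variables truncated at [B], the excess above [B] being uniformly
    small before and at the limit. *)
Theorem cvg_integral_ui :
  fine (\int[P]_w (H w * M n w)%:E) @[n --> \oo] --> fine (\int[P]_w (H w * Y w)%:E).
Proof.
apply/cvgrPdist_le => e e0.
(* The choice gives [C * B^(- t) <= e / 4]: two excesses and an [e / 2] for the truncated
   integrals. *)
pose B := (4 * (C + 1) / e) `^ t^-1.
have z0 : 0 < 4 * (C + 1) / e by rewrite divr_gt0// mulr_gt0// ltr_wpDl.
have B0 : 0 < B by rewrite powR_gt0.
have CB : C * B `^ (- t) <= e / 4.
  rewrite /B -powRrM mulrN mulVf ?gt_eqF// powRN powRr1 ?(ltW z0)//.
  rewrite invf_div mulrA ler_pdivrMr ?mulr_gt0 ?ltr_wpDl//.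
  have -> : e / 4 * (4 * (C + 1)) = (C + 1) * e by field.
  by rewrite ler_wpM2r ?(ltW e0)// lerDl.
have hY := fine_truncation mY Y0 B0 (excess_limit B0).
have hM n := fine_truncation (mM n) (M0 n) B0 (integral_excess_moment (mM n) (M0 n) B0 t0 (MC n)).
have mHm (Z : T -> R) : measurable_fun setT Z ->
    measurable_fun setT (fun w => (H w * Num.min (Z w) B)%:E).
  move=> mZ; apply/measurable_EFinP; apply: measurable_funM => //.
  by apply: measurable_minr => //; exact: measurable_cst.
have iB : P.-integrable setT (fun _ : T => B%:E).
  by apply: finite_measure_integrable_cst.
have min0 (Z : T -> R) w : (forall w, 0 <= Z w) -> 0 <= Num.min (Z w) B.
  by move=> Z0; rewrite le_min Z0 ltW.
have f_f : {ae P, forall w, setT w -> (H w * Num.min (M n w) B)%:E @[n --> \oo] -->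
    (H w * Num.min (Y w) B)%:E}.
  apply: filterS MY => w Mw _; apply: cvg_EFin; first exact: nearW.
  by apply: cvgMr; exact: cvgn_minr.
have f_g : {ae P, forall w n, setT w -> (`|(H w * Num.min (M n w) B)%:E| <= B%:E)%E}.
  apply: aeW => w n _; rewrite lee_fin ger0_norm ?mulr_ge0 ?min0//.
  apply: (@le_trans _ _ (1 * Num.min (M n w) B)).
    by rewrite ler_wpM2r ?min0//; case/andP : (H01 w).
  by rewrite mul1r ge_min lexx orbT.
have [_ _ dc] := dominated_convergence measurableT (fun n => mHm _ (mM n)) (mHm _ mY) f_f iB f_g.
have finY : (\int[P]_w (H w * Num.min (Y w) B)%:E)%E \is a fin_num.
  rewrite ge0_fin_numE; first exact: le_lt_trans (integral_min_le mY Y0 B0) (ltry _).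
  by apply: integral_ge0 => w _; rewrite lee_fin mulr_ge0 ?min0.
rewrite -(fineK finY) in dc.
have e2 : 0 < e / 2 by rewrite divr_gt0.
have dcf : fine (\int[P]_w (H w * Num.min (M n w) B)%:E) @[n --> \oo] -->
    fine (\int[P]_w (H w * Num.min (Y w) B)%:E) by exact: (fine_cvg dc).
move/cvgrPdist_le : dcf => /(_ _ e2)[N _ hN].
exists N => // n /= /hN /= hn; have := hM n; have := hY; move: hn.
rewrite !ler_distl; set x1 := fine _; set x2 := fine _; set x3 := fine _; set x4 := fine _.
by move=> /andP[? ?] /andP[? ?] /andP[? ?]; apply/andP; split; lra.
Qed.

End uniform_integrability.

(** * Non-degeneracy *)

(** By [natr_powR_ratio] the normalised [D n] keeps at least a proportion [expR (- (a ^+ 2 * 2))] of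
    its absolute value at [k], the sum of the [n^-2] being at most 2; it tends to 0 only if it
    started at 0. *)
Lemma linear_growth_rigid {R : realType} (a : R) (D : nat -> R) k :
  0 < a -> (0 < k)%N ->
  (forall n, (k <= n)%N -> D n.+1 = (1 + a / n%:R) * D n) ->
  n%:R `^ (- a) * D n @[n --> \oo] --> 0 -> D k = 0.
Proof.
move=> a0 k0 DS D0; apply/eqP; rewrite -normr_le0.
pose S j : R := \sum_(0 <= i < j) (k + i)%:R ^- 2.
have lb j : expR (- (a ^+ 2 * S j)) * (k%:R `^ (- a) * `|D k|) <=
    (k + j)%:R `^ (- a) * `|D (k + j)%N|.
  elim: j => [|j IH]; first by rewrite /S big_geq// mulr0 oppr0 expR0 mul1r addn0.
  have kj : (0 < k + j)%N by rewrite addn_gt0 k0.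
  have c0 : 0 <= 1 + a / (k + j)%:R by rewrite addr_ge0// divr_ge0// ltW.
  rewrite addnS DS ?leq_addr// normrM (ger0_norm c0) [leRHS]mulrA (mulrC (_ `^ _) (1 + _)).
  apply: le_trans (ler_wpM2r (normr_ge0 _) (natr_powR_ratio a0 kj)).
  have -> : - (a ^+ 2 * S j.+1) = - (a ^+ 2 / (k + j)%:R ^+ 2) + - (a ^+ 2 * S j).
    by rewrite /S big_nat_recr//= mulrDr opprD addrC.
  by rewrite expRD -mulrA -[leRHS]mulrA; apply: ler_wpM2l; rewrite ?expR_ge0.
have lb2 j : expR (- (a ^+ 2 * 2)) * (k%:R `^ (- a) * `|D k|) <=
    (k + j)%:R `^ (- a) * `|D (k + j)%N|.
  apply: le_trans (lb j); rewrite ler_wpM2r ?mulr_ge0 ?powR_ge0// ler_expR lerN2.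
  by rewrite ler_wpM2l ?sqr_ge0//; exact: sum_sqrN_le.
have h : `|n%:R `^ (- a) * D n| @[n --> \oo] --> (0 : R).
  by rewrite -[X in _ --> X](normr0 R); exact: cvg_norm.
have c0 : 0 < expR (- (a ^+ 2 * 2)) * k%:R `^ (- a) by rewrite mulr_gt0 ?expR_gt0 ?powR_gt0 ?ltr0n.
rewrite -(ler_pM2l c0) mulr0 -(cvg_lim _ h)//; apply: limr_ge.
  by apply/cvg_ex; exists 0.
exists k => // n /= kn.
rewrite normrM (ger0_norm (powR_ge0 _ _)) -(subnKC kn) -mulrA; exact: lb2.
Qed.

Lemma ge0_integrable {d : measure_display} {T : measurableType d} {R : realType}
    (P : probability T R) (f : T -> R) :
  measurable_fun setT f -> (forall w, 0 <= f w) ->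
  (\int[P]_w (f w)%:E < +oo)%E -> P.-integrable setT (EFin \o f).
Proof.
move=> mf f0 fy; apply/integrableP; split; first exact/measurable_EFinP.
by under eq_integral do rewrite /= ger0_norm//.
Qed.

Lemma Rintegral_cst1M {d : measure_display} {T : measurableType d} {R : realType}
    (P : probability T R) (f : T -> R) :
  \int[P]_w (cst 1 w * f w) = \int[P]_w f w.
Proof. by apply: eq_Rintegral => w _; rewrite mul1r. Qed.

Section nondegeneracy.
Context {d : measure_display} {T : measurableType d} {R : realType}.
Variables (P : probability T R) (p : R) (X xi : {RV P >-> R}).
Variables (Xs : nat -> {RV P >-> R}) (eps : nat -> {RV P >-> bool})
  (U : nat -> {RV P >-> nat}) (xis : nat -> {RV P >-> R}).
Hypothesis p01 : 0 < p < 1.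
Hypothesis driven : rwes_driven Xs eps U xis p X xi.
Hypothesis xi_ge0 : {ae P, forall w, 0 <= xi w}.
Variables (m a : R).
Hypothesis xi1 : (\int[P]_w (`|xi w| `^ 1)%:E = m%:E)%E.
Hypothesis am : a = p * m.
Hypothesis a1 : 1 < a.
Variables (t mt : R).
Hypothesis t01 : 0 < t < 1.
Hypothesis xi_t : (\int[P]_w (`|xi w| `^ (1 + t))%:E = mt%:E)%E.
Hypothesis mtm : mt < (1 + t) * m.

Let t0 : 0 < t. Proof. by case/andP : t01. Qed.
Let a0 : 0 < a. Proof. exact: lt_trans a1. Qed.

Local Notation mfun_known D f :=
  (measurable_fun (setT : set (g_sigma_algebraType (known Xs eps U xis D))) f).

Section spins.
Variables (g : R -> R) (mu mut : R).
Hypothesis mg : measurable_fun setT g.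
Hypothesis g0 : forall x, 0 <= g x.
Hypothesis gmu : (\int[P]_w (g (X w))%:E <= mu%:E)%E.
Hypothesis gmut : (\int[P]_w (g (X w) `^ (1 + t))%:E <= mut%:E)%E.

Local Notation f := (fun _ : nat => g).
Local Notation spin := (spin Xs f).
Local Notation walk := (walk Xs eps U xis f).
Local Notation W := (scaled_walk Xs eps U xis a f).

Let mf (n : nat) : measurable_fun setT (f n). Proof. exact: mg. Qed.
Let f0 (n : nat) x : 0 <= f n x. Proof. exact: g0. Qed.

(** The absolute value is harmless where the walk converges, and makes the variable nonnegative
    everywhere. *)
Definition walk_limit w : R := `|limn (W ^~ w)|.

Lemma measurable_walk_limit : measurable_fun setT walk_limit.
Proof.
apply: measurableT_comp => //; apply: measurable_limn => n.
exact: measurable_scaled_walk.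
Qed.

Lemma ae_walk_limit : {ae P, forall w, W n w @[n --> \oo] --> walk_limit w}.
Proof.
have := ae_walk_series p01 driven xi_ge0 xi1 am a1 mg g0 gmu.
apply: filterS => w [l [Wl _ _]]; rewrite /walk_limit (cvg_lim _ Wl)// ger0_norm//.
by apply: (cvgn_ge0 Wl) => n; exact: scaled_walk_ge0.
Qed.

Definition walk_cov (H : T -> R) n : R :=
  \int[P]_w (H w * walk n w) - \int[P]_w (H w) * \int[P]_w walk n w.

Section test_function.
Variable H : T -> R.
Hypothesis mH : measurable_fun setT H.
Hypothesis H01 : forall w, 0 <= H w <= 1.

Let H0 w : 0 <= H w. Proof. by case/andP : (H01 w). Qed.

(** Integrability is read off the [(1 + t)]-moment bound of the normalised walk. *)
Lemma integral_walk_fin n : (\int[P]_w (H w * walk n w)%:E < +oo)%E.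
Proof.
have [C C0 hC] := walk_moment_bound p01 driven xi1 am a1 t01 xi_t mtm mg g0 gmu gmut.
have mW := @measurable_scaled_walk _ _ _ P Xs eps U xis a f mf n.
have W0 w : 0 <= W n w by exact: scaled_walk_ge0.
case: n mW W0 => [|n] mW W0.
  under eq_integral do rewrite walkE big_geq// mulr0.
  by rewrite integral0.
have := integral_ui_fin mH H01 mW W0 ltr01
  (integral_excess_moment mH H01 mW W0 ltr01 t0 (hC n.+1)).
move=> fin.
have -> : (\int[P]_w (H w * walk n.+1 w)%:E =
    (n.+1%:R `^ a)%:E * \int[P]_w (H w * W n.+1 w)%:E)%E.
  rewrite -ge0_integralZl ?lee_fin ?powR_ge0//.
  - apply: eq_integral => w _; rewrite -EFinM; congr (_%:E).
    rewrite /scaled_walk [RHS]mulrCA [X in _ = _ * X]mulrA powRN divff ?mul1r//.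
  - by apply/measurable_EFinP; exact: measurable_funM.
  - by move=> w _; rewrite lee_fin mulr_ge0.
by rewrite -(fineK fin) -EFinM ltry.
Qed.

Lemma integrable_test : P.-integrable setT (EFin \o H).
Proof.
apply: ge0_integrable => //; apply: le_lt_trans (ltry 1).
rewrite -(integral_cst_prob P 1); apply: ge0_le_integral => //.
- by move=> w _; rewrite lee_fin.
- exact/measurable_EFinP.
- by move=> w _; rewrite lee_fin; case/andP : (H01 w).
Qed.

Lemma integrable_walk n : P.-integrable setT (EFin \o (fun w => H w * walk n w)).
Proof.
apply: ge0_integrable; last exact: integral_walk_fin.
- by apply: measurable_funM => //; exact: measurable_walk.
- by move=> w; rewrite mulr_ge0 ?walk_ge0.
Qed.

Lemma integrable_walk_limit : P.-integrable setT (EFin \o (fun w => H w * walk_limit w)).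
Proof.
have [C C0 hC] := walk_moment_bound p01 driven xi1 am a1 t01 xi_t mtm mg g0 gmu gmut.
have mW := @measurable_scaled_walk _ _ _ P Xs eps U xis a f mf.
have W0 n w : 0 <= W n w by exact: scaled_walk_ge0.
have Y0 w : 0 <= walk_limit w by exact: normr_ge0.
apply: ge0_integrable.
- by apply: measurable_funM => //; exact: measurable_walk_limit.
- by move=> w; rewrite mulr_ge0.
- have := integral_limit_fin mH H01 t0 mW W0 hC measurable_walk_limit Y0 ae_walk_limit.
  by rewrite ge0_fin_numE// integral_ge0// => w _; rewrite lee_fin mulr_ge0.
Qed.

Lemma cvg_integral_walk :
  n%:R `^ (- a) * \int[P]_w (H w * walk n w) @[n --> \oo] -->
  \int[P]_w (H w * walk_limit w).
Proof.
have [C C0 hC] := walk_moment_bound p01 driven xi1 am a1 t01 xi_t mtm mg g0 gmu gmut.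
have mW := @measurable_scaled_walk _ _ _ P Xs eps U xis a f mf.
have W0 n w : 0 <= W n w by exact: scaled_walk_ge0.
have Y0 w : 0 <= walk_limit w by exact: normr_ge0.
have -> : (fun n => n%:R `^ (- a) * \int[P]_w (H w * walk n w)) =
    (fun n => fine (\int[P]_w (H w * W n w)%:E)).
  apply/funext => n; rewrite -RintegralZl//; last exact: integrable_walk.
  by apply: eq_Rintegral => w _; rewrite mulrCA.
by have := cvg_integral_ui mH H01 t0 C0 mW W0 hC measurable_walk_limit Y0 ae_walk_limit; exact.
Qed.

Lemma integral_walkS n : (1 <= n)%N -> mfun_known (past n) H ->
  \int[P]_w (H w * walk n.+1 w) = (1 + a / n%:R) * \int[P]_w (H w * walk n w)
    + (1 - p) * \int[P]_w g (X w) * \int[P]_w H w.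
Proof.
move=> n1 kH; rewrite /Rintegral.
have := integral_powsumS p01 driven mf f0 xi1 n1 kH H0.
have e k : (\int[P]_w (H w * powsum Xs eps U xis f 1 k w)%:E =
    \int[P]_w (H w * walk k w)%:E)%E.
  by apply: eq_integral => w _; rewrite powsum1.
rewrite !e.
have -> : (\int[P]_w (spin n.+1 w `^ 1)%:E = \int[P]_w (g (X w))%:E)%E.
  under eq_integral do rewrite powRr1 ?spin_ge0//.
  apply: (@integral_same_law _ _ _ _ _ P (Xs n.+1) X (EFin \o g)) => //.
  - exact: spin_law driven _ _.
  - exact: measurableT_comp.
have f1 : (\int[P]_w (H w * walk n w)%:E)%E \is a fin_num.
  exact: integrable_fin_num (integrable_walk n).
have f2 : (\int[P]_w (H w)%:E)%E \is a fin_num by exact: integrable_fin_num integrable_test.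
have f3 : (\int[P]_w (g (X w))%:E)%E \is a fin_num.
  rewrite ge0_fin_numE; first exact: le_lt_trans gmu (ltry _).
  by apply: integral_ge0 => w _; rewrite lee_fin.
move=> ->; rewrite am; move: f1 f2 f3.
by case: integral => [x| |]//; case: integral => [y| |]//; case: integral => [z| |].
Qed.

End test_function.

Lemma integral_walkS1 n : (1 <= n)%N ->
  \int[P]_w (walk n.+1 w) = (1 + a / n%:R) * \int[P]_w walk n w
    + (1 - p) * \int[P]_w g (X w).
Proof.
move=> n1; have c1 : forall w : T, 0 <= (1 : R) <= 1 by rewrite ler01 lexx.
have := @integral_walkS (cst 1) (measurable_cst _) c1 n n1 (measurable_cst _).
rewrite [\int[P]_w cst 1 w]/Rintegral integral_cst_prob mulr1.
by rewrite !Rintegral_cst1M.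
Qed.

Section test_function.
Variable H : T -> R.
Hypothesis H01 : forall w, 0 <= H w <= 1.

(** The contribution of the fresh spin is independent of [H] and cancels in the covariance, which
    makes the recursion homogeneous. *)
Lemma walk_covS n : (1 <= n)%N -> mfun_known (past n) H ->
  walk_cov H n.+1 = (1 + a / n%:R) * walk_cov H n.
Proof.
move=> n1 kH; have mH := mfun_known_measurable kH.
rewrite /walk_cov integral_walkS// integral_walkS1//; ring.
Qed.

Lemma cvg_walk_cov : measurable_fun setT H ->
  n%:R `^ (- a) * walk_cov H n @[n --> \oo] -->
  \int[P]_w (H w * walk_limit w) - \int[P]_w H w * \int[P]_w walk_limit w.
Proof.
move=> mH; have c1 : forall w : T, 0 <= (1 : R) <= 1 by rewrite ler01 lexx.
have h2 := @cvg_integral_walk (cst 1) (measurable_cst _) c1.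
have e2 : n%:R `^ (- a) * \int[P]_w walk n w @[n --> \oo] --> \int[P]_w walk_limit w.
  by move: h2; rewrite Rintegral_cst1M; under eq_fun do rewrite Rintegral_cst1M.
have -> : (fun n => n%:R `^ (- a) * walk_cov H n) = (fun n =>
   n%:R `^ (- a) * \int[P]_w (H w * walk n w)
   - \int[P]_w H w * (n%:R `^ (- a) * \int[P]_w walk n w)).
  by apply/funext => n; rewrite /walk_cov mulrBr [X in _ - X]mulrCA.
by apply: cvgB; [exact: cvg_integral_walk|exact: cvgMr].
Qed.

End test_function.

End spins.

(** * A constant limit forces the spins to vanish *)

Variables (mu mut : R).
Hypothesis Xmu : (\int[P]_w `|X w|%:E = mu%:E)%E.
Hypothesis Xmut : (\int[P]_w (`|X w| `^ (1 + t))%:E = mut%:E)%E.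

Local Notation pos := (fun x : R => Num.max x 0).
Local Notation neg := (fun x : R => Num.max (- x) 0).

Let mpos : measurable_fun setT pos.
Proof. by apply: measurable_maxr => //; exact: measurable_cst. Qed.
Let mneg : measurable_fun setT neg.
Proof. by apply: measurable_maxr => //; exact: measurable_cst. Qed.
Let pos0 x : 0 <= pos x. Proof. by rewrite le_max lexx orbT. Qed.
Let neg0 x : 0 <= neg x. Proof. by rewrite le_max lexx orbT. Qed.
Let pos_le x : pos x <= `|x|. Proof. by rewrite ge_max ler_norm normr_ge0. Qed.
Let neg_le x : neg x <= `|x|. Proof. by rewrite ge_max ler_normr lexx orbT normr_ge0. Qed.
Let posBneg x : pos x - neg x = x.
Proof. by rewrite /=; case: (leP x 0) => h; case: leP => ?; lra. Qed.

Let part_mu (g : R -> R) : measurable_fun setT g -> (forall x, 0 <= g x) ->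
  (forall x, g x <= `|x|) ->
  (\int[P]_w (g (X w))%:E <= mu%:E)%E.
Proof.
move=> mg g0 gle; rewrite -Xmu; apply: ge0_le_integral => //.
- by move=> w _; rewrite lee_fin.
- by apply/measurable_EFinP; exact: measurableT_comp.
- by apply/measurable_EFinP; exact: measurableT_comp.
- by move=> w _; rewrite lee_fin.
Qed.

Let part_mut (g : R -> R) : measurable_fun setT g -> (forall x, 0 <= g x) ->
  (forall x, g x <= `|x|) ->
  (\int[P]_w (g (X w) `^ (1 + t))%:E <= mut%:E)%E.
Proof.
move=> mg g0 gle; rewrite -Xmut; apply: ge0_le_integral => //.
- by move=> w _; rewrite lee_fin powR_ge0.
- by apply/measurable_EFinP; apply: (measurableT_comp (measurable_powR _)); exact: measurableT_comp.
- by apply/measurable_EFinP; apply: (measurableT_comp (measurable_powR _)); exact: measurableT_comp.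
- move=> w _; rewrite lee_fin; apply: ge0_ler_powR; rewrite ?nnegrE//.
  by rewrite addr_ge0// ltW.
Qed.

Let pmu := part_mu mpos pos0 pos_le.
Let nmu := part_mu mneg neg0 neg_le.
Let pmut := part_mut mpos pos0 pos_le.
Let nmut := part_mut mneg neg0 neg_le.

Local Notation Yp := (walk_limit pos).
Local Notation Yn := (walk_limit neg).

Variable c : R.
Hypothesis cst_limit : {ae P, forall w, Yp w - Yn w = c}.

(** The difference of the two covariances is the covariance of [H] with the signed walk. Once
    normalised, it tends to the covariance of [H] with the constant [c], that is 0, and
    [linear_growth_rigid] brings this back to time [k]. *)
Let cov0 (H : T -> R) k : (1 <= k)%N -> (forall w, 0 <= H w <= 1) -> mfun_known (past k) H ->
  walk_cov pos H k = walk_cov neg H k.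
Proof.
move=> k1 H01 kH; apply/eqP; rewrite -subr_eq0; apply/eqP.
pose D n := walk_cov pos H n - walk_cov neg H n.
apply: (@linear_growth_rigid _ a D k) => //.
  move=> n kn; rewrite /D.
  have kHn : mfun_known (past n) H by apply: mfun_knownS kH; exact: past_sub.
  have n1 := leq_trans k1 kn.
  by rewrite (walk_covS mpos pos0 pmu pmut H01 n1 kHn) (walk_covS mneg neg0 nmu nmut H01 n1 kHn) -mulrBr.
have mH := mfun_known_measurable kH.
have := cvgB (cvg_walk_cov mpos pos0 pmu pmut H01 mH) (cvg_walk_cov mneg neg0 nmu nmut H01 mH).
have e (H' : T -> R) : measurable_fun setT H' -> (forall w, 0 <= H' w <= 1) ->
   \int[P]_w (H' w * Yp w) = \int[P]_w (H' w * Yn w) + c * \int[P]_w H' w.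
  move=> mH' H'01; have iH := integrable_test mH' H'01.
  have iYn := integrable_walk_limit mneg neg0 nmu nmut mH' H'01.
  rewrite -(RintegralZl c measurableT iH) -RintegralD//; last first.
    exact: (integrableZl measurableT c iH).
  congr fine; apply: ae_eq_integral => //.
  - apply/measurable_EFinP; apply: measurable_funM => //; exact: measurable_walk_limit.
  - apply/measurable_EFinP; apply: measurable_funD; apply: measurable_funM => //.
    exact: measurable_walk_limit.
  - apply: filterS cst_limit => w cw _; congr (_%:E); rewrite -cw; ring.
have e1 : \int[P]_w Yp w = \int[P]_w Yn w + c.
  have c1 : forall w : T, 0 <= (1 : R) <= 1 by rewrite ler01 lexx.
  have := e (cst 1) (measurable_cst _) c1.
  rewrite [\int[P]_w cst 1 w]/Rintegral integral_cst_prob mulr1.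
  by rewrite !Rintegral_cst1M.
rewrite e// e1; set z := (X in _ --> X).
have -> : z = 0 by rewrite /z; ring.
have -> : (fun n => n%:R `^ (- a) * D n) = (fun n => n%:R `^ (- a) * walk_cov pos H n)
    - (fun n => n%:R `^ (- a) * walk_cov neg H n).
  by apply/funext => n; rewrite /D mulrBr.
exact.
Qed.

Let same_law_int n (g : R -> R) : (1 <= n)%N -> measurable_fun setT g -> (forall x, 0 <= g x) ->
  \int[P]_w g (Xs n w) = \int[P]_w g (X w).
Proof.
move=> n1 mg g0; congr fine.
apply: (@integral_same_law _ _ _ _ _ P (Xs n) X (EFin \o g)) => //.
- exact: spin_law driven _ _.
- exact: measurableT_comp.
Qed.

Let part_integrable (H : T -> R) n (g : R -> R) : measurable_fun setT H -> (forall w, 0 <= H w <= 1) ->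
  (1 <= n)%N -> measurable_fun setT g -> (forall x, 0 <= g x) -> (forall x, g x <= `|x|) ->
  P.-integrable setT (EFin \o (fun w => H w * g (Xs n w))).
Proof.
move=> mH H01 n1 mg g0 gle.
have mgX : measurable_fun setT (fun w => g (Xs n w)) by exact: measurableT_comp.
have H0 w : 0 <= H w by case/andP : (H01 w).
apply: ge0_integrable.
- exact: measurable_funM.
- by move=> w; rewrite mulr_ge0.
- apply: le_lt_trans (ltry mu); apply: le_trans (part_mu mg g0 gle).
  rewrite -(@integral_same_law _ _ _ _ _ P (Xs n) X (EFin \o g))//; last 2 first.
  + exact: spin_law driven _ _.
  + exact: measurableT_comp.
  apply: ge0_le_integral => //.
  + by move=> w _; rewrite lee_fin mulr_ge0.
  + by apply/measurable_EFinP; exact: measurable_funM.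
  + exact/measurable_EFinP.
  + move=> w _; rewrite lee_fin -[leRHS]mul1r ler_wpM2r//; by case/andP : (H01 w).
Qed.

Let x0 : R := \int[P]_w pos (X w) - \int[P]_w neg (X w).

Let walk1 (g : R -> R) w : walk Xs eps U xis (fun=> g) 1 w = g (Xs 1 w).
Proof. by rewrite /walk /echoed_sum big_nat1 echoed1. Qed.

Let first_spin_cov (H : T -> R) : (forall w, 0 <= H w <= 1) -> mfun_known (past 1) H ->
  \int[P]_w (H w * (Xs 1 w - x0)) = 0.
Proof.
move=> H01 kH; have mH := mfun_known_measurable kH.
have iH := integrable_test mH H01.
have := cov0 (leqnn 1) H01 kH; rewrite /walk_cov.
have e (g : R -> R) : \int[P]_w (H w * walk Xs eps U xis (fun=> g) 1 w) = \int[P]_w (H w * g (Xs 1 w)).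
  by apply: eq_Rintegral => w _; rewrite walk1.
have e1 (g : R -> R) : \int[P]_w walk Xs eps U xis (fun=> g) 1 w = \int[P]_w g (Xs 1 w).
  by apply: eq_Rintegral => w _; rewrite walk1.
rewrite !e !e1 (same_law_int _ mpos)// (same_law_int _ mneg)// => h.
have ip := part_integrable mH H01 (leqnn 1) mpos pos0 pos_le.
have jn := part_integrable mH H01 (leqnn 1) mneg neg0 neg_le.
have -> : \int[P]_w (H w * (Xs 1 w - x0)) = \int[P]_w (H w * pos (Xs 1 w)) -
    (\int[P]_w (H w * neg (Xs 1 w)) + x0 * \int[P]_w H w).
  have ix := integrableZl measurableT x0 iH.
  rewrite -(RintegralZl x0 measurableT iH) -(RintegralD measurableT jn ix).
  rewrite -RintegralB//; last exact: (integrableD measurableT jn ix).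
  by apply: eq_Rintegral => w _; rewrite -{1}(posBneg (Xs 1 w)); ring.
rewrite /x0; move: h; set u1 := \int[P]_w _; set u2 := \int[P]_w _; set u3 := \int[P]_w _.
set u4 := \int[P]_w _; set u5 := \int[P]_w _ => h.
have {h} -> : u1 = u4 - u2 * u5 + u2 * u3 by rewrite -h; ring.
ring.
Qed.

Let centered_integrable (H : T -> R) : measurable_fun setT H -> (forall w, 0 <= H w <= 1) ->
  P.-integrable setT (EFin \o (fun w => H w * (Xs 1 w - x0))).
Proof.
move=> mH H01; have iH := integrable_test mH H01.
have ip := part_integrable mH H01 (leqnn 1) mpos pos0 pos_le.
have jn := part_integrable mH H01 (leqnn 1) mneg neg0 neg_le.
have ix := integrableZl measurableT x0 iH.
have := integrableB measurableT (integrableB measurableT ip jn) ix.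
apply: eq_integrable => // w _ /=.
by rewrite -!EFinB -{3}(posBneg (Xs 1 w)); congr (_%:E); ring.
Qed.

(** At time 1 the walk is the first spin, which is therefore uncorrelated with all its bounded
    functions; the indicators of its being above and below the mean [x0] yield its mean absolute
    deviation. *)
Let spin_dist0 : (\int[P]_w (`|X w - x0|)%:E = 0)%E.
Proof.
have mD : measurable_fun setT (EFin \o (fun x : R => `|x - x0|)).
  by apply/measurable_EFinP; apply: measurableT_comp => //; exact: measurable_funB.
have <- : (\int[P]_w (`|Xs 1 w - x0|)%:E = \int[P]_w (`|X w - x0|)%:E)%E.
  apply: (@integral_same_law _ _ _ _ _ P (Xs 1) X (EFin \o (fun x => `|x - x0|))) => //.
  - exact: spin_law driven _ _.
  - by move=> s; rewrite /= lee_fin.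
pose H1 w : R := (x0 < Xs 1 w)%R%:R; pose H2 w : R := (Xs 1 w < x0)%R%:R.
have H1_01 w : 0 <= H1 w <= 1 by rewrite /H1; case: (_ < _); rewrite ?lexx ?ler01.
have H2_01 w : 0 <= H2 w <= 1 by rewrite /H2; case: (_ < _); rewrite ?lexx ?ler01.
have kX : mfun_known (past 1) (Xs 1) by apply: mfun_known_X; split.
have k1 : mfun_known (past 1) H1.
  by apply: measurable_natr_bool; apply: measurable_fun_ltr => //; exact: measurable_cst.
have k2 : mfun_known (past 1) H2.
  by apply: measurable_natr_bool; apply: measurable_fun_ltr => //; exact: measurable_cst.
have i1 := centered_integrable (mfun_known_measurable k1) H1_01.
have i2 := centered_integrable (mfun_known_measurable k2) H2_01.
have e w : `|Xs 1 w - x0| = H1 w * (Xs 1 w - x0) - H2 w * (Xs 1 w - x0).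
  rewrite /H1 /H2; case: (ltgtP (Xs 1 w) x0) => h.
  - by rewrite ltr0_norm ?subr_lt0// mul0r mul1r sub0r.
  - by rewrite gtr0_norm ?subr_gt0// mul0r mul1r subr0.
  - by rewrite h subrr normr0 !mul0r subr0.
have i12 := integrableB measurableT i1 i2.
have := integrable_fin_num measurableT i12.
under eq_integral do rewrite /= -EFinB -e.
move=> fin; rewrite -(fineK fin); congr (_%:E).
rewrite -[LHS]/(\int[P]_w `|Xs 1 w - x0|).
under eq_Rintegral do rewrite e.
by rewrite RintegralB// !first_spin_cov// subr0.
Qed.

Let ae_spin n : (1 <= n)%N -> {ae P, forall w, Xs n w = x0}.
Proof.
move=> n1; have mD : measurable_fun setT (EFin \o (fun x : R => `|x - x0|)).
  by apply/measurable_EFinP; apply: measurableT_comp => //; exact: measurable_funB.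
have e : (\int[P]_w (`|Xs n w - x0|)%:E = 0)%E.
  rewrite -spin_dist0.
  apply: (@integral_same_law _ _ _ _ _ P (Xs n) X (EFin \o (fun x => `|x - x0|))) => //.
  - exact: spin_law driven _ _.
  - by move=> s; rewrite /= lee_fin.
have h := @ge0_integral_eq0_ae _ _ _ P (fun w => (`|Xs n w - x0|)%:E); apply: filterS (h _ _ _) => [w [/eqP]||w|].
- by rewrite normr_eq0 subr_eq0 => /eqP.
- exact: measurableT_comp mD _.
- by rewrite lee_fin.
- by rewrite e.
Qed.

Let part_mean (g : R -> R) : measurable_fun setT g -> (forall x, 0 <= g x) ->
  \int[P]_w g (X w) = g x0.
Proof.
move=> mg g0; rewrite -(@same_law_int 1%N)//.
rewrite -[RHS](_ : fine (\int[P]_w (g x0)%:E) = _); last by rewrite integral_cst_prob.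
congr fine; apply: ae_eq_integral => //.
- by apply/measurable_EFinP; exact: measurableT_comp.
- by apply: filterS (ae_spin (leqnn 1)) => w -> _.
Qed.

Let H w : R := (~~ eps 2 w)%:R.

(** With spins equal to [x0], the walk at time 2 is [2 g(x0)] when the second edge is deleted, while
    its mean is [(1 + a) g(x0) + (1 - p) g(x0)]. *)
Let second_step (g : R -> R) : measurable_fun setT g -> (forall x, 0 <= g x) ->
  (forall x, g x <= `|x|) -> walk_cov g H 2 = (1 - p) * (p - a) * g x0.
Proof.
move=> mg g0 gle.
have gmu := part_mu mg g0 gle; have gmut := part_mut mg g0 gle.
have H01 w : 0 <= H w <= 1 by rewrite /H; case: (~~ _); rewrite ?lexx ?ler01.
have mH : measurable_fun setT H.
  by apply: measurable_natr_bool; apply: measurable_neg.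
have iH := integrable_test mH H01.
have EH : \int[P]_w H w = 1 - p.
  rewrite /Rintegral (integral_memory p01 driven (g := fun b => (~~ b)%:R))//=.
  by rewrite mulr0 add0r mulr1.
rewrite /walk_cov (integral_walkS1 mg g0 gmu gmut (leqnn 1)) EH.
have -> : \int[P]_w walk Xs eps U xis (fun=> g) 1 w = g x0.
  rewrite -(part_mean mg g0) -(@same_law_int 1%N)//.
  by apply: eq_Rintegral => w _; rewrite walk1.
rewrite (part_mean mg g0).
have -> : \int[P]_w (H w * walk Xs eps U xis (fun=> g) 2 w) = (1 - p) * (2 * g x0).
  rewrite -EH -RintegralZr//; congr fine; apply: ae_eq_integral => //.
  - apply/measurable_EFinP; apply: measurable_funM => //.
    by apply: measurable_walk => n.
  - by apply/measurable_EFinP; apply: measurable_funM => //; exact: measurable_cst.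
  apply: filterS2 (ae_spin (leqnn 1)) (@ae_spin 2%N isT) => w e1 e2 _; congr (_%:E).
  rewrite walkS walk1 e1 /step echoedE//; last exact: parentP.
  rewrite /H /spin e2; case: (eps 2 w) => /=; first by rewrite !mul0r.
  by rewrite subr0 !mul1r !mul0r addr0; ring.
by rewrite divr1; ring.
Qed.

(** Subtracting the two parts gives [(1 - p) (p - a) x0 = 0], where [p < 1 < a]. *)
Lemma ae_spin_eq0 : {ae P, forall w, X w = 0}.
Proof.
have kH : mfun_known (past 2) H.
  apply: measurable_natr_bool; apply: measurable_neg.
  by apply: mfun_known_eps; split.
have H01 w : 0 <= H w <= 1 by rewrite /H; case: (~~ _); rewrite ?lexx ?ler01.
have := @cov0 H 2 isT H01 kH.
rewrite !second_step// => h.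
have x00 : x0 = 0.
  apply/eqP; have : (1 - p) * (p - a) * x0 == 0.
    by rewrite -{1}(posBneg x0) mulrBr h subrr.
  have p1 : 1 - p != 0 by case/andP : p01 => _ p1; rewrite subr_eq0 gt_eqF.
  have pa : p - a != 0.
    by case/andP : p01 => _ pl1; rewrite subr_eq0 lt_eqF// (lt_trans pl1).
  by rewrite !mulf_eq0 (negbTE p1) (negbTE pa).
have k := @ge0_integral_eq0_ae _ _ _ P (fun w => (`|X w - x0|)%:E); apply: filterS (k _ _ _) => [w [/eqP]||w|].
- by rewrite normr_eq0 subr_eq0 x00 => /eqP.
- by apply/measurable_EFinP; apply: measurableT_comp => //; exact: measurable_funB.
- by rewrite lee_fin.
- by rewrite spin_dist0.
Qed.

End nondegeneracy.

(** * Moments of the echo variable *)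

Section xlogx_bounds.
Context {R : realType}.
Implicit Types x s c t : R.

Let powRE x s : 0 < x -> x `^ s = expR (s * ln x).
Proof. by move=> x0; rewrite /powR gt_eqF. Qed.

(** As a function of [s], the power is convex and lies above its tangent at 0. *)
Lemma powR_ge_tangent x s : 0 <= x -> 0 < s -> x + s * (x * ln x) <= x `^ (1 + s).
Proof.
move=> x0 s0; rewrite powR1D//; have [->|xn] := eqVneq x 0.
  by rewrite !mul0r mulr0 addr0.
have {}x0 : 0 < x by rewrite lt_neqAle eq_sym xn.
rewrite powRE// mulrCA -{1}(mulr1 x) -mulrDr ler_pM2l//.
exact: expR_ge1Dx.
Qed.

(** Contact with the tangent leaves only [x = 0] and [x = 1]; the bound [x <= 1] is what contradicts
    a mean greater than 1. *)
Lemma powR_eq_tangent x s : 0 <= x -> 0 < s -> x `^ (1 + s) = x + s * (x * ln x) ->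
  x <= 1.
Proof.
move=> x0 s0; rewrite powR1D//; have [->//|xn] := eqVneq x 0.
have {}x0 : 0 < x by rewrite lt_neqAle eq_sym xn.
rewrite powRE// mulrCA -{3}(mulr1 x) -mulrDr => /(mulfI xn) h.
rewrite leNgt; apply/negP => x1.
have : s * ln x != 0 by rewrite mulf_neq0 ?gt_eqF// ln_gt0.
by move/expR_gt1Dx; rewrite h ltxx.
Qed.

Lemma sqr_le_expR t : 0 <= t -> t ^+ 2 <= 4 * expR t.
Proof.
move=> t0; have -> : t = t / 2 + t / 2 by field.
rewrite expRD -expr2.
have : t / 2 <= expR (t / 2) by apply: le_trans (expR_ge1Dx _); rewrite lerDr ler01.
set u := t / 2; have u0 : 0 <= u by rewrite divr_ge0.
move=> h; have : u ^+ 2 <= expR u ^+ 2 by rewrite ler_sqr// nnegrE ?expR_ge0.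
by rewrite (_ : (u + u) ^+ 2 = 4 * u ^+ 2); [rewrite ler_pM2l|ring].
Qed.

(** A second-order bound: the remainder is at most [s^2 (ln x)^2 x^(1 + s)] for [x >= 1], where both
    logarithms and the power [x^s] cost a factor [x^c] each, hence the exponent [1 + 3 c]. For
    [x < 1] it is at most [s^2 x (ln x)^2], and [x (ln x)^2 <= 4]. *)
Lemma powR_le_tangent x s c : 0 <= x -> 0 < s <= c ->
  x `^ (1 + s) <= x + s * (x * ln x) + s ^+ 2 * ((4 + c^-2) * (1 + x `^ (1 + 3 * c))).
Proof.
move=> x0 /andP[s0 sc]; have c0 : 0 < c by exact: lt_le_trans sc.
have c2 : 0 < c^-2 by rewrite invr_gt0 exprn_gt0.
have [->|xn] := eqVneq x 0.
  rewrite powR0 ?gt_eqF ?addr_gt0// !mul0r mulr0 !add0r powR0 ?gt_eqF ?addr_gt0 ?mulr_gt0//.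
  by rewrite addr0 mulr1 mulr_ge0 ?sqr_ge0// addr_ge0// ltW.
have {xn}x0 : 0 < x by rewrite lt_neqAle eq_sym xn.
rewrite powR1D ?(ltW x0)// powRE//; set u := s * ln x.
have tangent : expR u - 1 <= u * expR u.
  have := expR_ge1Dx (- u); rewrite expRN => h.
  have := ler_wpM2r (expR_ge0 u) h; rewrite mulVf ?gt_eqF ?expR_gt0//; lra.
have h : x * expR u <= x + s * (x * ln x) + x * (u * (expR u - 1)).
  have -> : x + s * (x * ln x) + x * (u * (expR u - 1)) = x * (1 + u * expR u).
    by rewrite /u; ring.
  by rewrite ler_pM2l//; lra.
apply: (le_trans h); rewrite lerD2l {h}.
have P0 : 0 <= x `^ (1 + 3 * c) by exact: powR_ge0.
have [x1|x1] := leP 1 x.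
  have l0 : 0 <= ln x by exact: ln_ge0.
  have u0 : 0 <= u by rewrite mulr_ge0// ltW.
  have lc := ln_le_powR c0 x0.
  apply: (@le_trans _ _ (s ^+ 2 * (c^-2 * x `^ (1 + 3 * c)))); last first.
    apply: ler_wpM2l; first exact: sqr_ge0.
    by apply: ler_pM; rewrite ?(ltW c2)// lerDr.
  apply: (@le_trans _ _ (x * (u * (u * expR u)))).
    by rewrite ler_pM2l// ler_wpM2l.
  have -> : x * (u * (u * expR u)) = s ^+ 2 * (x * (ln x ^+ 2 * expR u)).
    by rewrite /u; ring.
  apply: ler_wpM2l; first exact: sqr_ge0.
  have -> : x `^ (1 + 3 * c) = x * (expR (c * ln x) ^+ 2 * expR (c * ln x)).
    by rewrite powR1D ?(ltW x0) ?mulr_gt0// powRE// -!expRM_natl -expRD; congr (_ * expR _); ring.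
  rewrite [leRHS]mulrCA ler_pM2l// [leRHS]mulrA; apply: ler_pM.
  - exact: sqr_ge0.
  - exact: expR_ge0.
  - rewrite mulrC -exprVn -exprMn ler_sqr ?nnegrE ?mulr_ge0 ?expR_ge0 ?invr_ge0 ?(ltW c0)//.
    by move: lc; rewrite powRE.
  - by rewrite ler_expR ler_wpM2r.
have l0 : ln x < 0 by rewrite -(ln1 R) ltr_ln ?posrE.
apply: (@le_trans _ _ (s ^+ 2 * 4)); last first.
  apply: ler_wpM2l; first exact: sqr_ge0.
  apply: (@le_trans _ _ ((4 + c^-2) * 1)); first by rewrite mulr1 lerDl ltW.
  by apply: ler_wpM2l; [rewrite addr_ge0// ltW|rewrite lerDl].
have u0 : u <= 0 by rewrite /u nmulr_lle0 ?(ltW s0).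
have e1 := expR_ge1Dx u.
apply: (@le_trans _ _ (x * u ^+ 2)).
  rewrite ler_pM2l// expr2 ler_wnM2l//; lra.
rewrite /u exprMn mulrCA; apply: ler_wpM2l; first exact: sqr_ge0.
have := @sqr_le_expR (- ln x); rewrite oppr_ge0 (ltW l0) sqrrN expRN lnK ?posrE// => /(_ isT).
by move=> /(ler_wpM2l (ltW x0)) /le_trans; apply; rewrite mulrCA divff ?gt_eqF// mulr1.
Qed.

Lemma xlogx_bound x c : 0 <= x -> 0 < c ->
  `|x * ln x| <= (1 + c^-1) * (1 + x `^ (1 + c)).
Proof.
move=> x0 c0; have c1 : 0 < c^-1 by rewrite invr_gt0.
have P0 : 0 <= x `^ (1 + c) by exact: powR_ge0.
have cP : 0 <= c^-1 * x `^ (1 + c) by rewrite mulr_ge0// ltW.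
have E : (1 + c^-1) * (1 + x `^ (1 + c)) = 1 + c^-1 + x `^ (1 + c) + c^-1 * x `^ (1 + c).
  ring.
rewrite {}E; have [x00|xn] := eqVneq x 0.
  have -> : x * ln x = 0 by rewrite x00 mul0r.
  by rewrite normr0; lra.
have {xn}x0 : 0 < x by rewrite lt_neqAle eq_sym xn.
rewrite ler_norml; apply/andP; split.
  have := expR_ge1Dx (- ln x); rewrite expRN lnK ?posrE// => h.
  have := ler_wpM2l (ltW x0) h; rewrite divff ?gt_eqF//; lra.
have := ler_wpM2l (ltW x0) (ln_le_powR c0 x0).
by rewrite mulrA -powR1D ?(ltW x0)// mulrC; lra.
Qed.

End xlogx_bounds.

Section moments.
Context {d : measure_display} {T : measurableType d} {R : realType}.
Variable P : probability T R.

Lemma integrable_powR_norm (Y : {RV P >-> R}) alpha s :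
  1 < alpha -> (Y : T -> R) \in Lfun P alpha%:E -> 1 <= s <= alpha ->
  P.-integrable setT (EFin \o (fun w => `|Y w| `^ s)).
Proof.
move=> alpha1 Yalpha /andP[s1 salpha].
have ia := Lfun_integrable (ltW alpha1) Yalpha.
have i1 : P.-integrable setT (EFin \o cst (1 : R)) by exact: finite_measure_integrable_cst.
apply: le_integrable (integrableD measurableT i1 ia) => //.
  apply/measurable_EFinP; apply: (measurableT_comp (measurable_powR _)).
  exact: measurableT_comp.
move=> w _ /=; rewrite lee_fin (ger0_norm (powR_ge0 _ _)).
rewrite (ger0_norm (addr_ge0 ler01 (powR_ge0 _ _))).
have [y1|y1] := leP 1 `|Y w|.
  by apply: ler_wpDl => //; exact: ler_powR.
apply: ler_wpDr; first exact: powR_ge0.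
have e1 : 1 `^ s = 1 :> R by rewrite powR1.
rewrite -[leRHS]e1; apply: ge0_ler_powR; rewrite ?nnegrE ?ler01 ?(ltW y1)//.
exact: le_trans s1.
Qed.

Lemma integral_Rintegral (f : T -> R) : P.-integrable setT (EFin \o f) ->
  (\int[P]_w (f w)%:E = (\int[P]_w f w)%:E)%E.
Proof. by move=> fi; rewrite fineK//; exact: integrable_fin_num. Qed.

Variables (xi : {RV P >-> R}) (alpha : R).
Hypothesis alpha1 : 1 < alpha.
Hypothesis xi_alpha : (xi : T -> R) \in Lfun P alpha%:E.

Let moment s : R := \int[P]_w (`|xi w| `^ s).
Let entropy : R := \int[P]_w (`|xi w| * ln `|xi w|).

Lemma integrable_xlogx : P.-integrable setT (EFin \o (fun w => `|xi w| * ln `|xi w|)).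
Proof.
have c0 : 0 < alpha - 1 by rewrite subr_gt0.
have ia := Lfun_integrable (ltW alpha1) xi_alpha.
have i1 : P.-integrable setT (EFin \o cst (1 : R)) by exact: finite_measure_integrable_cst.
have := integrableZl measurableT (1 + (alpha - 1)^-1) (integrableD measurableT i1 ia).
apply: le_integrable => //.
  apply/measurable_EFinP; apply: measurable_funM; first exact: measurableT_comp.
  by apply: (measurableT_comp (@measurable_ln R)); exact: measurableT_comp.
move=> w _ /=; rewrite lee_fin; apply: le_trans (ler_norm _).
have := xlogx_bound (normr_ge0 (xi w)) c0.
by rewrite (_ : 1 + (alpha - 1) = alpha); last by ring.
Qed.

Lemma subcritical_exponent : entropy < moment 1 ->
  exists t, [/\ 0 < t < 1, 1 + t <= alpha & moment (1 + t) < (1 + t) * moment 1].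
Proof.
have final (m l k t : R) : t * (t * k) <= t * ((m - l) / 2) -> 0 < t * (m - l) ->
    m + t * l + t ^+ 2 * k < (1 + t) * m by lra.
move=> lm; pose c := (alpha - 1) / 3.
have c0 : 0 < c by rewrite divr_gt0// subr_gt0.
have ca : 1 + 3 * c = alpha by rewrite /c; field.
pose K := (4 + c^-2) * (1 + moment alpha).
have ma0 : 0 <= moment alpha by apply: Rintegral_ge0 => w _; exact: powR_ge0.
have K0 : 0 < K.
  by apply: mulr_gt0; [rewrite addr_gt0// invr_gt0 exprn_gt0|rewrite ltr_wpDr].
pose gap := moment 1 - entropy.
have gap0 : 0 < gap by rewrite subr_gt0.
(* The three bounds allow [powR_le_tangent], give [t < 1], and keep the second-order term [t^2 K] at
   most half of the gain [t * gap]. *)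
pose t := Num.min (Num.min c 2^-1) (gap / (2 * K)).
have g0 : 0 < gap / (2 * K) by rewrite divr_gt0// mulr_gt0.
have t0 : 0 < t by rewrite !lt_min c0 invr_gt0 ltr0n g0.
have tc : t <= c by rewrite !ge_min lexx.
have t2 : t <= 2^-1 by rewrite !ge_min lexx orbT.
have tg : t <= gap / (2 * K) by rewrite !ge_min lexx !orbT.
have ta : 1 + t <= alpha by rewrite -ca; lra.
exists t; split => //; first by rewrite t0/=; lra.
have i1 : P.-integrable setT (EFin \o cst (1 : R)) by exact: finite_measure_integrable_cst.
have im s : 1 <= s <= alpha -> P.-integrable setT (EFin \o (fun w => `|xi w| `^ s)).
  by move=> h; exact: integrable_powR_norm alpha1 xi_alpha h.
have m1i := im 1 ltac:(by rewrite lexx ltW).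
have mai := im alpha ltac:(by rewrite lexx ltW).
have mti := im (1 + t) ltac:(by rewrite ta lerDl ltW).
have exi := integrableZl measurableT t integrable_xlogx.
have i1a := integrableD measurableT i1 mai.
have Ki := integrableZl measurableT (t ^+ 2 * (4 + c^-2)) i1a.
have i2 := integrableD measurableT m1i exi.
have le1 : moment (1 + t) <= moment 1 + t * entropy + t ^+ 2 * K.
  have -> : moment 1 + t * entropy + t ^+ 2 * K = \int[P]_w (`|xi w| `^ 1
      + t * (`|xi w| * ln `|xi w|) + t ^+ 2 * (4 + c^-2) * (1 + `|xi w| `^ alpha)).
    rewrite (RintegralD measurableT i2 Ki) (RintegralD measurableT m1i exi).
    rewrite (RintegralZl _ measurableT integrable_xlogx) (RintegralZl _ measurableT i1a).
    rewrite (RintegralD measurableT i1 mai) [\int[P]_w cst 1 w]/Rintegral integral_cst_prob.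
    by rewrite /K mulrA.
  apply: le_Rintegral => //; first exact: (integrableD measurableT i2 Ki).
  move=> w _; rewrite powRr1// -[in leRHS]mulrA -ca; apply: powR_le_tangent => //.
  by rewrite t0.
apply: (le_lt_trans le1).
have : t * K <= gap / 2.
  have := ler_wpM2r (ltW K0) tg; have -> // : gap / (2 * K) * K = gap / 2 by field; rewrite gt_eqF.
by move=> tK; apply: final; [rewrite ler_pM2l|rewrite mulr_gt0].
Qed.

(** The mean of the tangent inequality gives the weak form. If it were not strict, the nonnegative
    difference [D] would vanish almost surely, so [|xi| <= 1] and the mean would be at most 1. *)
Lemma critical_gap t : 0 < t -> 1 + t <= alpha -> 1 < moment 1 -> moment 1 <= entropy ->
  moment 1 * (1 + t) < moment (1 + t).
Proof.
have final (m l m' : R) : m' <= m * (1 + t) -> t * m <= t * l -> m' - (m + t * l) <= 0.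
  by lra.
move=> t0 ta m1 ml; rewrite ltNge; apply/negP => hle.
have im s : 1 <= s <= alpha -> P.-integrable setT (EFin \o (fun w => `|xi w| `^ s)).
  by move=> h; exact: integrable_powR_norm alpha1 xi_alpha h.
have m1i := im 1 ltac:(by rewrite lexx ltW).
have mti := im (1 + t) ltac:(by rewrite ta lerDl ltW).
have exi := integrableZl measurableT t integrable_xlogx.
have i2 := integrableD measurableT m1i exi.
pose D w : R := `|xi w| `^ (1 + t) - (`|xi w| `^ 1 + t * (`|xi w| * ln `|xi w|)).
have iD := integrableB measurableT mti i2.
have D0 w : 0 <= D w by rewrite subr_ge0 powRr1//; exact: powR_ge_tangent.
have mD : measurable_fun setT (EFin \o D) by have /integrableP[] := iD.
have ID : (\int[P]_w (D w)%:E <= 0)%E.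
  rewrite integral_Rintegral// lee_fin (RintegralB measurableT mti i2).
  rewrite (RintegralD measurableT m1i exi) (RintegralZl _ measurableT integrable_xlogx).
  rewrite -/(moment 1) -/(moment (1 + t)) -/entropy.
  by apply: final => //; rewrite ler_pM2l.
have xi1 : {ae P, forall w, `|xi w| <= 1}.
  have := ge0_integral_eq0_ae mD _ ID; move=> h.
  apply: filterS (h _) => [w [] /eqP|w]; last by rewrite lee_fin.
  rewrite subr_eq0 powRr1// => /eqP; exact: powR_eq_tangent.
have : moment 1 <= 1.
  rewrite -lee_fin -integral_Rintegral// -(integral_cst_prob P 1).
  apply: ae_ge0_le_integral => //.
  - by have /integrableP[] := m1i.
  - by apply: filterS xi1 => w h _; rewrite lee_fin powRr1.
by rewrite leNgt m1.
Qed.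

End moments.

(** * Conclusion *)

Section echoed_limit.
Context {d : measure_display} {T : measurableType d} {R : realType}.
Variables (P : probability T R) (p : R) (X xi : {RV P >-> R}).
Variables (Xs : nat -> {RV P >-> R}) (eps : nat -> {RV P >-> bool})
  (U : nat -> {RV P >-> nat}) (xis : nat -> {RV P >-> R}).
Hypothesis p01 : 0 < p < 1.
Hypothesis driven : rwes_driven Xs eps U xis p X xi.
Hypothesis xi_ge0 : {ae P, forall w, 0 <= xi w}.
Variables (m a mu : R).
Hypothesis xi1 : (\int[P]_w (`|xi w| `^ 1)%:E = m%:E)%E.
Hypothesis am : a = p * m.
Hypothesis a1 : 1 < a.
Hypothesis Xmu : (\int[P]_w `|X w|%:E = mu%:E)%E.

Local Notation pos := (fun x : R => Num.max x 0).
Local Notation neg := (fun x : R => Num.max (- x) 0).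
Local Notation W g := (scaled_walk Xs eps U xis a (fun=> g)).
Local Notation L := (L_ eps U xis a).
Local Notation sumXL := (limit_series Xs eps U xis a).

Let mpos : measurable_fun setT pos.
Proof. by apply: measurable_maxr => //; exact: measurable_cst. Qed.
Let mneg : measurable_fun setT neg.
Proof. by apply: measurable_maxr => //; exact: measurable_cst. Qed.
Let pos0 x : 0 <= pos x. Proof. by rewrite le_max lexx orbT. Qed.
Let neg0 x : 0 <= neg x. Proof. by rewrite le_max lexx orbT. Qed.

Let part_mu (g : R -> R) : measurable_fun setT g -> (forall x, 0 <= g x) ->
  (forall x, g x <= `|x|) ->
  (\int[P]_w (g (X w))%:E <= mu%:E)%E.
Proof.
move=> mg g0 gle; rewrite -Xmu; apply: ge0_le_integral => //.
- by move=> w _; rewrite lee_fin.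
- by apply/measurable_EFinP; exact: measurableT_comp.
- by apply/measurable_EFinP; exact: measurableT_comp.
- by move=> w _; rewrite lee_fin.
Qed.

Let pmu : (\int[P]_w (pos (X w))%:E <= mu%:E)%E.
Proof. by apply: part_mu => // x; rewrite ge_max ler_norm normr_ge0. Qed.
Let nmu : (\int[P]_w (neg (X w))%:E <= mu%:E)%E.
Proof. by apply: part_mu => // x; rewrite ge_max ler_normr lexx orbT normr_ge0. Qed.

(** All pointwise conclusions, gathered on one almost sure event so that the clauses of the theorem
    are projections of it. *)
Variant limit_spec w : Prop := LimitSpec u v of
  W pos n w @[n --> \oo] --> u & W neg n w @[n --> \oo] --> v &
  sumXL w = u - v & 0 <= u & 0 <= v &
  cvgn (fun n => \sum_(1 <= r < n.+1) `|Xs r w * L r w|) &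
  rwes Xs eps U xis n w / n%:R `^ a @[n --> \oo] --> sumXL w.

Lemma ae_limit_spec : {ae P, forall w, limit_spec w}.
Proof.
have hp := ae_walk_series p01 driven xi_ge0 xi1 am a1 mpos pos0 pmu.
have hn := ae_walk_series p01 driven xi_ge0 xi1 am a1 mneg neg0 nmu.
have hL := ae_tree_limits p01 driven xi_ge0 xi1 am a1.
have hr := ae_driving_regular driven xi_ge0.
apply: filterS2 (filterI hp hn) (filterI hL hr) => w.
move=> [[u [Wu Su _]] [v [Wv Sv _]]] [Lw rw].
have L0 r : 0 <= L r w by apply: (cvgn_ge0 (Lw r)) => n; exact: scaled_walk_ge0.
have sumE : sumXL w = u - v.
  rewrite /limit_series; apply: cvg_lim => //.
  rewrite (_ : (fun _ => _) = (fun n => \sum_(1 <= r < n.+1) pos (Xs r w) * L r w) -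
      (fun n => \sum_(1 <= r < n.+1) neg (Xs r w) * L r w)); first exact: cvgB.
  apply/funext => n; rewrite fctE -sumrB; apply: eq_bigr => r _; rewrite -mulrBl; congr (_ * _).
  by case: (leP (Xs r w) 0) => h; case: leP => ?; lra.
apply: (LimitSpec Wu Wv) => //.
- by apply: (cvgn_ge0 Wu) => n; exact: scaled_walk_ge0.
- by apply: (cvgn_ge0 Wv) => n; exact: scaled_walk_ge0.
- apply/cvg_ex; exists (u + v).
  rewrite (_ : (fun _ => _) = (fun n => \sum_(1 <= r < n.+1) pos (Xs r w) * L r w) +
      (fun n => \sum_(1 <= r < n.+1) neg (Xs r w) * L r w)); first exact: cvgD.
  apply/funext => n; rewrite fctE -big_split/=; apply: eq_bigr => r _.
  rewrite normrM (ger0_norm (L0 r)) -mulrDl; congr (_ * _).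
  have [h|h] := leP (Xs r w) 0.
    by rewrite ler0_norm// add0r max_l// oppr_ge0.
  by rewrite gtr0_norm// max_r ?addr0// oppr_le0 ltW.
- rewrite sumE (_ : (fun _ => _) = (W pos ^~ w) - (W neg ^~ w)); first exact: cvgB.
  by apply/funext => n; exact: rwesE.
Qed.

Lemma limit_series_Lfun1 : sumXL \in Lfun P 1%E.
Proof.
have mS : measurable_fun setT sumXL by exact: measurable_limit_series.
apply/Lfun1_integrable/integrableP; split; first exact/measurable_EFinP.
pose ll g := lower_limit Xs eps U xis a (fun=> g).
have mll g : measurable_fun setT g -> measurable_fun setT (ll g).
  by move=> mg; exact: measurable_lower_limit.
have ll0 g w : (forall x, 0 <= g x) -> (0 <= ll g w)%E.
  by move=> g0; exact: lower_limit_ge0.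
apply: (@le_lt_trans _ _ (\int[P]_w (ll pos w + ll neg w))%E).
  apply: ae_ge0_le_integral => //.
  - by apply: measurableT_comp => //; exact/measurable_EFinP.
  - by move=> w _; rewrite adde_ge0 ?ll0.
  - by apply: emeasurable_funD; exact: mll.
  - apply: filterS ae_limit_spec => w [u v Wu Wv uv u0 v0 _ _] _.
    rewrite /ll (lower_limitE Wu) (lower_limitE Wv) -EFinD /= lee_fin uv.
    by apply: (le_trans (ler_normB _ _)); rewrite (ger0_norm u0) (ger0_norm v0).
have h1 : (\int[P]_w ll pos w < +oo)%E.
  by have := integral_lower_limit_series p01 driven xi1 am a1 mpos pos0 pmu; exact.
have h2 : (\int[P]_w ll neg w < +oo)%E.
  by have := integral_lower_limit_series p01 driven xi1 am a1 mneg neg0 nmu; exact.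
rewrite (ge0_integralD P measurableT _ (mll _ mpos) _ (mll _ mneg)).
- exact: (lte_add_pinfty h1 h2).
- by move=> w _; exact: ll0.
- by move=> w _; exact: ll0.
Qed.

End echoed_limit.

Theorem corollary5p6 (R : realType) (d : measure_display)
  (T : measurableType d) (P : probability T R) (p : R)
  (X xi : {RV P >-> R})
  (Xs : nat -> {RV P >-> R}) (eps : nat -> {RV P >-> bool})
  (U : nat -> {RV P >-> nat}) (xis : nat -> {RV P >-> R}) :
  0 < p < 1 ->
  standing X xi ->
  rwes_driven Xs eps U xis p X xi ->
  1 < p * m1 P xi ->
  let L := L_ eps U xis (p * m1 P xi) in
  let sumXL := limit_series Xs eps U xis (p * m1 P xi) in
  [/\ forall r, (1 <= r)%N ->
        {ae P, forall w,
          scaled_T eps U xis (p * m1 P xi) r n w @[n --> \oo] --> L r w}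
        /\ L r \in Lfun P 1%E,
      independent2 P (sigma_of_family [set r | (1 <= r)%N] L)
        (sigma_of_family [set r | (1 <= r)%N] Xs),
      {ae P, forall w,
        cvgn (fun n => \sum_(1 <= r < n.+1) `|Xs r w * L r w|)},
      sumXL \in Lfun P 1%E
    & {ae P, forall w,
        rwes Xs eps U xis n w / n%:R `^ (p * m1 P xi) @[n --> \oo]
          --> sumXL w}]
  /\ ((mean_xlogx P xi < (m1 P xi)%:E)%E -> non_degenerate P sumXL)
  /\ (~ (mean_xlogx P xi < (m1 P xi)%:E)%E ->
        {ae P, forall w, sumXL w = 0}).
Proof.
move=> p01 st driven a1 L sumXL.
have [X0 _ xi_ge0 [alpha [alpha1 Xa xia]]] := st.
set m := m1 P xi; set a := p * m.
have le1 : 1 <= (1 : R) <= alpha by rewrite lexx ltW.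
have ixi1 := integrable_powR_norm alpha1 xia le1.
have mE : m = \int[P]_w (`|xi w| `^ 1).
  rewrite /m /m1 unlock; congr fine; apply: ae_eq_integral => //.
  - exact/measurable_EFinP.
  - by have /integrableP[] := ixi1.
  - by apply: filterS xi_ge0 => w xi0 _; rewrite /= powRr1// ger0_norm.
have xi1 : (\int[P]_w (`|xi w| `^ 1)%:E = m%:E)%E by rewrite integral_Rintegral// mE.
have ixl := integrable_xlogx alpha1 xia.
have lE : mean_xlogx P xi = (\int[P]_w (`|xi w| * ln `|xi w|))%:E.
  rewrite /mean_xlogx unlock -integral_Rintegral//; apply: ae_eq_integral => //.
  - apply/measurable_EFinP; apply: measurable_funM => //.
    exact: (measurableT_comp (@measurable_ln R)).
  - by have /integrableP[] := ixl.
  - by apply: filterS xi_ge0 => w xi0 _; rewrite /= ger0_norm.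
have [mu Xmu] : exists mu, (\int[P]_w `|X w|%:E = mu%:E)%E.
  have iX := integrable_powR_norm alpha1 Xa le1.
  exists (\int[P]_w (`|X w| `^ 1)); rewrite -integral_Rintegral//.
  by apply: eq_integral => w _; rewrite powRr1.
have am : a = p * m by [].
have spec := ae_limit_spec p01 driven xi_ge0 xi1 am a1 Xmu.
split; [split|split].
- move=> r r1; split; last exact: (L_Lfun1 p01 driven xi_ge0 xi1 am a1 r1).
  have hr := ae_driving_regular driven xi_ge0.
  have hL := ae_tree_limits p01 driven xi_ge0 xi1 am a1.
  apply: filterS2 hr hL => w rw /(_ r).
  by under eq_fun do rewrite -scaled_TE//.
- exact: L_independent driven _.
- by apply: filterS spec => w [].
- by have := limit_series_Lfun1 p01 driven xi_ge0 xi1 am a1 Xmu; exact.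
- by apply: filterS spec => w [].
- rewrite lE lte_fin mE => lm.
  have [t [t01 ta gap]] := subcritical_exponent alpha1 xia lm.
  have t0 : 0 < t by case/andP : t01.
  have let1 : 1 <= 1 + t <= alpha by rewrite lerDl ltW.
  have ixt := integrable_powR_norm alpha1 xia let1.
  have iXt := integrable_powR_norm alpha1 Xa let1.
  rewrite -mE in gap.
  move=> [c hc].
  have hY : {ae P, forall w, walk_limit Xs eps U xis a (fun x => Num.max x 0) w
      - walk_limit Xs eps U xis a (fun x => Num.max (- x) 0) w = c}.
    apply: filterS2 hc spec => w <- [u v Wu Wv uv u0 v0 _ _].
    by rewrite /walk_limit (cvg_lim _ Wu)// (cvg_lim _ Wv)// (ger0_norm u0) (ger0_norm v0) -uv.
  have X_eq0 := ae_spin_eq0 p01 driven xi_ge0 xi1 am a1 t01 (integral_Rintegral ixt) gap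
    Xmu (integral_Rintegral iXt) hY.
  (* The spins vanish almost surely, against the standing hypothesis [P(X = 0) < 1]. *)
  move: X0; apply/negP; rewrite -leNgt.
  have mX0 : measurable [set w | X w = 0].
    exact: (measurable_funPTI X (measurable_set1 (0 : R))).
  rewrite -(integral_cst_prob P 1).
  have -> : (\int[P]_w 1%:E = \int[P]_w (\1_[set w | X w = 0] w)%:E)%E.
    apply: ae_eq_integral => //.
    - by apply/measurable_EFinP; exact: measurable_indic.
    - by apply: filterS X_eq0 => w Xw _; rewrite indicE mem_set.
  by rewrite integral_indic// setIT.
- rewrite lE lte_fin mE => /negP; rewrite -leNgt => ml.
  (* The highest moment used by the potential is of order [1 + 2 * delta], here equal to [alpha]. *)
  pose delta := (alpha - 1) / 2.
  have delta0 : 0 < delta by rewrite divr_gt0// subr_gt0.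
  have alphaE : 1 + 2 * delta = alpha by rewrite /delta; field.
  have da : 1 + delta <= alpha by rewrite -alphaE; lra.
  have led : 1 <= 1 + delta <= alpha by rewrite lerDl ltW.
  have le2d : 1 <= 1 + 2 * delta <= alpha by rewrite alphaE lexx ltW.
  have ixd := integrable_powR_norm alpha1 xia led.
  have ix2d := integrable_powR_norm alpha1 xia le2d.
  (* Since [p < 1 < p * m]; this is the mean condition of [critical_gap]. *)
  have m1 : 1 < m.
    have /andP[p0 p1] := p01; apply: (lt_trans a1); rewrite -[ltRHS]mul1r ltr_pM2r//.
    by rewrite -(pmulr_rgt0 _ p0) (lt_trans ltr01 a1).
  have gap : m * (1 + delta) < \int[P]_w (`|xi w| `^ (1 + delta)).
    by rewrite mE; apply: (critical_gap alpha1 xia delta0 da _ ml); rewrite -mE.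
  rewrite -mE in ml.
  have L0 := ae_critical_L_eq0 p01 driven xi_ge0 xi1 am a1 delta0
    (integral_Rintegral ixd) (integral_Rintegral ix2d) ixl (integral_Rintegral ixl) ml gap.
  apply: filterS (ae_forall_countable L0) => w Lw.
  rewrite /sumXL /limit_series; apply: cvg_lim => //.
  under eq_fun do under eq_bigr do rewrite Lw mulr0.
  by under eq_fun do rewrite big1//; exact: cvg_cst.
Qed.
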